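(* Let $f=h+\overline{g}$ be a sense-preserving harmonic mapping in $\mathbb{D}$. Then the following conditions are equivalent. (1) $h+g$ is SAULU; (2) $h+g$ is SAULC; (3) $h+g$ has SBAPSN; (4) $h+g$ has SBASN; (5) for any two points $\varepsilon_1,\varepsilon_2\in\overline{\mathbb{D}}$ with $\varepsilon_1\neq\varepsilon_2$, there exist a constant $m_1>0$ and a univalent analytic function $F_1$ in $\mathbb{D}$ such that $(h+\varepsilon_1 g)'=(F_1')^{m_1}$ if and only if there exist a constant $m_2>0$ and a univalent analytic function $F_2$ in $\mathbb{D}$ such that $(h+\varepsilon_2 g)'=(F_2')^{m_2}$; (6) $f$ is SHULU; (7) $f$ is SHULC; (8) $f$ has SBHPSN; (9) $f$ has SBHSN.
   Context: $\mathbb{D}=\{z\in\mathbb{C}:|z|<1\}$ with closure $\overline{\mathbb{D}}$. A harmonic mapping in $\mathbb{D}$ is written $f=h+\overline{g}$ with $h,g$ analytic in $\mathbb{D}$, $g(0)=0$; it is sense-preserving if $|h'|>|g'|$ in $\mathbb{D}$; its dilatation is $\omega=g'/h'$. For $\varepsilon\in\overline{\mathbb{D}}$, $h+\varepsilon\overline g$ is again a sense-preserving harmonic mapping and $h+\varepsilon g$ is a locally univalent analytic function. Pre-Schwarzian derivative and norm: $P_f=\frac{h''}{h'}-\frac{\overline{\omega}\omega'}{1-|\omega|^2}$, $\|P_f\|=\sup_{z\in\mathbb{D}}(1-|z|^2)|P_f(z)|$. Schwarzian derivative and norm: $$S_f=S_h+\frac{\overline{\omega}}{1-|\omega|^2}\left(\frac{h''}{h'}\omega'-\omega''\right)-\frac32\left(\frac{\overline{\omega}\omega'}{1-|\omega|^2}\right)^2,\quad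 S_h=\frac{h'''}{h'}-\frac32\left(\frac{h''}{h'}\right)^2,\quad \|S_f\|=\sup_{z\in\mathbb{D}}(1-|z|^2)^2|S_f(z)|.$$ For locally univalent analytic functions these are taken with $\omega\equiv0$. Hyperbolic distance $d_h(z,a)=2\tanh^{-1}\left|\frac{z-a}{1-\overline{a}z}\right|$; $D_h(a,\rho)=\{z\in\mathbb{D}:d_h(z,a)<\rho\}$. A sense-preserving harmonic (in particular, locally univalent analytic) mapping $f$ is ULU (uniformly locally univalent) if $\inf_{z\in\mathbb{D}}\sup_{\rho_z>0}\{\rho_z:f\text{ is univalent in }D_h(z,\rho_z)\}>0$, and ULC (uniformly locally convex) if $\inf_{z\in\mathbb{D}}\sup_{\rho_z>0}\{\rho_z:f\text{ is convex in }D_h(z,\rho_z)\}>0$, where $f$ convex in a disk means that $f$ maps it univalently onto a convex domain. Stability notions, each required for any $\varepsilon_1,\varepsilon_2\in\overline{\mathbb{D}}$ with $\varepsilon_1\ne\varepsilon_2$: - $f$ is SHULU (resp. SHULC): $h+\varepsilon_1\overline g$ is ULU (resp. ULC) in $\mathbb{D}$ iff $h+\varepsilon_2\overline g$ is ULU (resp. ULC) in $\mathbb{D}$. - $h+g$ is SAULU (resp. SAULC): $h+\varepsilon_1 g$ is ULU (resp. ULC) in $\mathbb{D}$ iff $h+\varepsilon_2 g$ is ULU (resp. ULC) in $\mathbb{D}$. - $f$ has SBHPSN (resp. SBHSN): $\|P_{h+\varepsilon_1\overline g}\|$ (resp. $\|S_{h+\varepsilon_1\overline g}\|$) is bounded iff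 $\|P_{h+\varepsilon_2\overline g}\|$ (resp. $\|S_{h+\varepsilon_2\overline g}\|$) is bounded. - $h+g$ has SBAPSN (resp. SBASN): $\|P_{h+\varepsilon_1 g}\|$ (resp. $\|S_{h+\varepsilon_1 g}\|$) is bounded iff $\|P_{h+\varepsilon_2 g}\|$ (resp. $\|S_{h+\varepsilon_2 g}\|$) is bounded. *)

(* Defs.v *)
From Stdlib Require Import Reals.
From mathcomp Require Import ssreflect ssrbool seq.
From Coquelicot Require Import Coquelicot.

Open Scope R_scope.

Definition unit_disk (z : C) : Prop := Cmod z < 1.

Definition closed_unit_disk (z : C) : Prop := Cmod z <= 1.

(** Complex differentiability at every point of the unit disk; functions are
    total, but only their values on the disk matter. *)
Definition analytic (f : C -> C) : Prop :=
  forall z, unit_disk z -> ex_derive (K := C_AbsRing) (V := C_NormedModule) f z.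

Definition univalent_on (A : C -> Prop) (f : C -> C) : Prop :=
  forall z w, A z -> A w -> f z = f w -> z = w.

(** A harmonic mapping [f = h + conj g] is represented by the pair [(h, g)],
    which [f] determines because [g 0 = 0]. *)
Definition sense_preserving_harmonic (h g : C -> C) : Prop :=
  analytic h /\ analytic g /\ g (RtoC 0) = RtoC 0 /\
  forall z, unit_disk z -> Cmod (C_derive g z) < Cmod (C_derive h z).

Definition analytic_comb (h g : C -> C) (eps : C) : C -> C :=
  fun z => (h z + eps * g z)%C.

Definition harmonic_comb (h g : C -> C) (eps : C) : C -> C :=
  fun z => (h z + eps * Cconj (g z))%C.

(** ** Pre-Schwarzian and Schwarzian derivatives of [h + conj g] *)

Definition dilatation (h g : C -> C) : C -> C :=
  fun z => (C_derive g z / C_derive h z)%C.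

Definition preSchwarzian (h g : C -> C) (z : C) : C :=
  let h1 := C_derive h in
  let h2 := C_derive h1 in
  let w := dilatation h g in
  let w1 := C_derive w in
  (h2 z / h1 z
   - Cconj (w z) * w1 z / (RtoC 1 - RtoC (Cmod (w z) ^ 2)))%C.

Definition analytic_Schwarzian (h : C -> C) (z : C) : C :=
  let h1 := C_derive h in
  let h2 := C_derive h1 in
  let h3 := C_derive h2 in
  (h3 z / h1 z - RtoC (3 / 2) * (h2 z / h1 z) ^ 2)%C.

Definition Schwarzian (h g : C -> C) (z : C) : C :=
  let h1 := C_derive h in
  let h2 := C_derive h1 in
  let w := dilatation h g in
  let w1 := C_derive w in
  let w2 := C_derive w1 in
  let d := (RtoC 1 - RtoC (Cmod (w z) ^ 2))%C in
  (analytic_Schwarzian h z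
   + Cconj (w z) / d * (h2 z / h1 z * w1 z - w2 z)
   - RtoC (3 / 2) * (Cconj (w z) * w1 z / d) ^ 2)%C.

Definition preSchwarzian_norm (h g : C -> C) : Rbar :=
  Lub_Rbar (fun x => exists z, unit_disk z /\
    x = (1 - Cmod z ^ 2) * Cmod (preSchwarzian h g z)).

Definition Schwarzian_norm (h g : C -> C) : Rbar :=
  Lub_Rbar (fun x => exists z, unit_disk z /\
    x = (1 - Cmod z ^ 2) ^ 2 * Cmod (Schwarzian h g z)).

Definition bounded_norm (N : Rbar) : Prop := Rbar_lt N p_infty.

(** ** Uniform local univalence and convexity *)

Definition artanh (x : R) : R := / 2 * ln ((1 + x) / (1 - x)).

Definition hyperbolic_dist (z a : C) : R :=
  2 * artanh (Cmod ((z - a) / (RtoC 1 - Cconj a * z))%C).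

Definition hyperbolic_disk (a : C) (rho : R) (z : C) : Prop :=
  unit_disk z /\ hyperbolic_dist z a < rho.

Definition convex_domain (U : C -> Prop) : Prop :=
  open (T := C_UniformSpace) U /\ (exists w, U w) /\
  forall u v (t : R), U u -> U v -> 0 <= t <= 1 ->
    U (RtoC (1 - t) * u + RtoC t * v)%C.

Definition image (A : C -> Prop) (f : C -> C) (w : C) : Prop :=
  exists z, A z /\ w = f z.

Definition convex_on (A : C -> Prop) (f : C -> C) : Prop :=
  univalent_on A f /\ convex_domain (image A f).

(** The inner supremum may be [p_infty], hence the infimum is taken in [Rbar]. *)
Definition uniform_radius (Q : (C -> Prop) -> (C -> C) -> Prop) (f : C -> C)
    : Rbar :=
  Rbar_glb (fun r => exists z, unit_disk z /\
    r = Lub_Rbar (fun rho => 0 < rho /\ Q (hyperbolic_disk z rho) f)).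

Definition ULU (f : C -> C) : Prop :=
  Rbar_lt 0 (uniform_radius univalent_on f).

Definition ULC (f : C -> C) : Prop :=
  Rbar_lt 0 (uniform_radius convex_on f).

(** ** Real powers of a nonvanishing function *)

Definition Cexp (z : C) : C :=
  (exp (Re z) * cos (Im z), exp (Re z) * sin (Im z)).

(** [G] is a single-valued analytic branch of [F ^ m] on the unit disk, i.e.
    [exp (m * L)] for some analytic branch [L] of [log F]. *)
Definition is_power_branch (F : C -> C) (m : R) (G : C -> C) : Prop :=
  exists L : C -> C, analytic L /\
    forall z, unit_disk z ->
      F z = Cexp (L z) /\ G z = Cexp (RtoC m * L z)%C.

Definition power_of_univalent (k : C -> C) : Prop :=
  exists (m : R) (F : C -> C), 0 < m /\
    analytic F /\ univalent_on unit_disk F /\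
    is_power_branch (C_derive F) m (C_derive k).

(** ** Stability under the choice of the parameter *)

Definition stable (P : C -> Prop) : Prop :=
  forall eps1 eps2 : C, closed_unit_disk eps1 -> closed_unit_disk eps2 ->
    eps1 <> eps2 -> (P eps1 <-> P eps2).

Definition SAULU (h g : C -> C) : Prop :=
  stable (fun eps => ULU (analytic_comb h g eps)).

Definition SAULC (h g : C -> C) : Prop :=
  stable (fun eps => ULC (analytic_comb h g eps)).

(** The analytic function [h + eps g] is the pair with zero co-analytic part,
    which makes its dilatation vanish identically. *)
Definition SBAPSN (h g : C -> C) : Prop :=
  stable (fun eps => bounded_norm
    (preSchwarzian_norm (analytic_comb h g eps) (fun _ => RtoC 0))).

Definition SBASN (h g : C -> C) : Prop :=
  stable (fun eps => bounded_norm
    (Schwarzian_norm (analytic_comb h g eps) (fun _ => RtoC 0))).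

Definition SHULU (h g : C -> C) : Prop :=
  stable (fun eps => ULU (harmonic_comb h g eps)).

Definition SHULC (h g : C -> C) : Prop :=
  stable (fun eps => ULC (harmonic_comb h g eps)).

(** [h + eps * conj g = h + conj (conj eps * g)], so its co-analytic part is
    [conj eps * g]. *)
Definition SBHPSN (h g : C -> C) : Prop :=
  stable (fun eps => bounded_norm
    (preSchwarzian_norm h (fun z => Cconj eps * g z)%C)).

Definition SBHSN (h g : C -> C) : Prop :=
  stable (fun eps => bounded_norm
    (Schwarzian_norm h (fun z => Cconj eps * g z)%C)).

(* Main.v *)
Require Import Defs.
From Stdlib Require Import Reals Lra Psatz Classical ClassicalEpsilon FunctionalExtensionality.
From mathcomp Require Import ssreflect ssrbool seq.
From Coquelicot Require Import Coquelicot.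

(** All nine families of conditions turn out to be independent of the parameter for every
    sense-preserving [h + Cconj g], because at each parameter of the closed disk each
    condition amounts to the same property of [h] alone: the function [P = h'' / h'] is
    [O(1 / (1 - Cmod z))] on the disk ([finite_preSchwarzian h]). The nine stability
    statements, and with them their equivalence, follow.

    Passing from [h] to [h + eps * g] multiplies [h'] by [1 + eps * om], where [om] is the
    dilatation. The Schwarz-Pick inequality bounds [om'] by
    [(1 - Cmod om ^ 2) / (1 - Cmod z)], so that neither this factor nor the dilatation term
    of a harmonic pre-Schwarzian changes the order of growth ([analytic_comb_finite],
    [preSchwarzian_norm_bounded]). In the same way a Schwarzian is [P' - P ^ 2 / 2] up to
    terms of order [Cmod P / (1 - Cmod z)] and [1 / (1 - Cmod z) ^ 2]
    ([Schwarzian_riccati]). If [P] grew faster than [1 / (1 - Cmod z)], then there would be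
    a point at which [P] is large and dominates its values on a disk of comparable depth
    ([point_picking]); there the Cauchy estimate makes [P'] negligible against [P ^ 2],
    and the Schwarzian is large ([Schwarzian_norm_bounded]).

    The same choice of a point treats univalence. About a dominating point, and in the
    scale [1 / Cmod P], the function [P] is nearly constant, so [h] is nearly an
    exponential and nearly takes one value twice. The dilatation is nearly constant too,
    so [h + Cconj g] is nearly a fixed real linear map applied to [h], and it takes a value
    twice: it is not univalent in a disk of fixed hyperbolic radius
    ([univalent_at_scale_dominating]). Conversely, if [P] is [O(1 / (1 - Cmod z))] then on
    small hyperbolic disks the map is, up to a real linear map, close to a similarity with
    small second differences, and such a map sends disks onto convex sets because disks
    are strictly convex ([nearly_linear_convex_image], [finite_preSchwarzian_convex]).
    This gives uniform local univalence and uniform local convexity.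

    If [k'] is a power [F' ^ m] with [F] univalent, then [P] for [k] is [m] times that
    for [F], which is controlled as above. If [P] for [k] is controlled, then a large root
    of [k'] is the derivative of a function whose pre-Schwarzian is small, and integration
    along broken segments shows that it is univalent ([small_preSchwarzian_univalent]).

    All this rests on three facts about complex differentiable functions, derived from
    Goursat's theorem: primitives exist, derivatives are differentiable, and they satisfy
    the Cauchy estimate ([primitive_exists], [C_derive_differentiable],
    [cauchy_estimate]). *)

Open Scope R_scope.

Implicit Types (z w l m : C) (f g : C -> C).

(** * Complex differentiability *)

(** An epsilon-delta form of [is_derive]: the latter involves two different uniform
    structures on [C], one for the variable and one for the values. *)
Definition cderiv (f : C -> C) (z l : C) : Prop :=
  forall eps, 0 < eps -> exists delta, 0 < delta /\
    forall w, Cmod (w - z) < delta ->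
      Cmod (f w - f z - l * (w - z)) <= eps * Cmod (w - z).

Lemma is_derive_cderiv f z l :
  is_derive (K := C_AbsRing) (V := C_NormedModule) f z l <-> cderiv f z l.
Proof.
split.
- move=> [_ H] eps He.
  have [d Hd] := H z (fun P HP => HP) (mkposreal eps He).
  exists d; split; first exact: cond_pos.
  move=> w Hw; have := Hd w Hw.
  by rewrite /= /norm /= /minus /plus /opp /scal /= /mult /= (Cmult_comm _ l).
- move=> H; split; first exact: is_linear_scal_l.
  move=> x Hx eps.
  have <- : z = x by apply: is_filter_lim_locally_unique Hx.
  have [d [Hd0 Hd]] := H eps (cond_pos eps).
  exists (mkposreal d Hd0) => w Hw; have := Hd w Hw.
  by rewrite /= /norm /= /minus /plus /opp /scal /= /mult /= (Cmult_comm _ l).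
Qed.

Lemma cderiv_C_derive f z l : cderiv f z l -> C_derive f z = l.
Proof. by move=> H; apply: is_C_derive_unique; apply/is_derive_cderiv. Qed.

Lemma ex_derive_cderiv f z :
  ex_derive (K := C_AbsRing) (V := C_NormedModule) f z -> cderiv f z (C_derive f z).
Proof.
move=> [l Hl]; have H : cderiv f z l by apply/is_derive_cderiv.
by rewrite (cderiv_C_derive _ _ _ H).
Qed.

Lemma cderiv_ex_derive f z l :
  cderiv f z l -> ex_derive (K := C_AbsRing) (V := C_NormedModule) f z.
Proof. by move=> H; exists l; apply/is_derive_cderiv. Qed.

Lemma analytic_cderiv f : analytic f ->
  forall z, unit_disk z -> cderiv f z (C_derive f z).
Proof. by move=> H z /H; apply: ex_derive_cderiv. Qed.

(** ** Moduli *)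

Lemma Cmod_pos z : z <> 0%C -> 0 < Cmod z.
Proof. by move=> /Cmod_gt_0. Qed.

Lemma Cmod_sub_sym z w : Cmod (z - w) = Cmod (w - z).
Proof. by rewrite -Cmod_opp; f_equal; ring. Qed.

Lemma Cmod_tri_sub a b : Cmod (a - b) <= Cmod a + Cmod b.
Proof. by rewrite -(Cmod_opp b); apply: Cmod_triangle. Qed.

Lemma Cmod_tri_dist b a c : Cmod (a - c) <= Cmod (a - b) + Cmod (b - c).
Proof.
have -> : (a - c = (a - b) + (b - c))%C by ring.
exact: Cmod_triangle.
Qed.

Lemma Cmod_le_add b a : Cmod a <= Cmod b + Cmod (a - b).
Proof.
have {1}-> : (a = b + (a - b))%C by ring.
exact: Cmod_triangle.
Qed.

Lemma Cmod_RtoC_pos t : 0 <= t -> Cmod (RtoC t) = t.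
Proof. by move=> Ht; rewrite Cmod_R Rabs_pos_eq. Qed.

Lemma Cmod_sub0 z : Cmod (z - z) = 0.
Proof.
have -> : (z - z = 0)%C by ring.
exact: Cmod_0.
Qed.

Lemma Cmod_zero_eq z w : Cmod (z - w) <= 0 -> z = w.
Proof.
move=> H; have /Cmod_eq_0 E : Cmod (z - w) = 0 by move: (Cmod_ge_0 (z - w)); lra.
have -> : z = ((z - w) + w)%C by ring.
by rewrite E; ring.
Qed.

(** ** Rules of differentiation *)

Lemma cderiv_ext f g z l : (forall w, f w = g w) -> cderiv f z l -> cderiv g z l.
Proof. by move=> E H eps He; have [d [H0 Hd]] := H eps He; exists d; split=> // w; rewrite -!E; apply: Hd. Qed.

Lemma cderiv_ext_loc f g z l r : 0 < r ->
  (forall w, Cmod (w - z) < r -> f w = g w) -> cderiv f z l -> cderiv g z l.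
Proof.
move=> Hr E H eps He; have [d [H0 Hd]] := H eps He.
exists (Rmin d r); split; first exact: Rmin_pos.
move=> w Hw; have Hw1 := Rlt_le_trans _ _ _ Hw (Rmin_l _ _).
have Hw2 := Rlt_le_trans _ _ _ Hw (Rmin_r _ _).
rewrite -!E //; first exact: Hd.
by rewrite Cmod_sub0.
Qed.

Lemma cderiv_eq f z l l' : l = l' -> cderiv f z l -> cderiv f z l'.
Proof. by move=> ->. Qed.

Lemma cderiv_const c z : cderiv (fun _ => c) z 0%C.
Proof.
move=> eps He; exists 1; split; [lra|] => w _.
have -> : (c - c - 0 * (w - z) = 0)%C by ring.
by rewrite Cmod_0; apply: Rmult_le_pos; [lra|apply: Cmod_ge_0].
Qed.

Lemma cderiv_id z : cderiv (fun w => w) z 1%C.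
Proof.
move=> eps He; exists 1; split; [lra|] => w _.
have -> : (w - z - 1 * (w - z) = 0)%C by ring.
by rewrite Cmod_0; apply: Rmult_le_pos; [lra|apply: Cmod_ge_0].
Qed.

Lemma cderiv_plus f g z l m : cderiv f z l -> cderiv g z m ->
  cderiv (fun w => f w + g w)%C z (l + m)%C.
Proof.
move=> Hf Hg eps He.
have [d1 [H1 D1]] := Hf (eps / 2) ltac:(lra); have [d2 [H2 D2]] := Hg (eps / 2) ltac:(lra).
exists (Rmin d1 d2); split; first exact: Rmin_pos.
move=> w Hw; have := D1 w (Rlt_le_trans _ _ _ Hw (Rmin_l _ _)).
have := D2 w (Rlt_le_trans _ _ _ Hw (Rmin_r _ _)).
have -> : (f w + g w - (f z + g z) - (l + m) * (w - z) =
  (f w - f z - l * (w - z)) + (g w - g z - m * (w - z)))%C by ring.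
move=> *; apply: Rle_trans (Cmod_triangle _ _) _; lra.
Qed.

(** Differentiability gives a Lipschitz bound at the point, which is how continuity
    enters the product, quotient and chain rules. *)
Lemma cderiv_lip f z l : cderiv f z l -> exists delta, 0 < delta /\
  forall w, Cmod (w - z) < delta -> Cmod (f w - f z) <= (Cmod l + 1) * Cmod (w - z).
Proof.
move=> H; have [d [H0 Hd]] := H 1 Rlt_0_1; exists d; split=> // w /Hd Hw.
have := Cmod_le_add (l * (w - z)) (f w - f z); rewrite Cmod_mult; lra.
Qed.

Lemma cderiv_continuous f z l : cderiv f z l -> forall eps, 0 < eps ->
  exists delta, 0 < delta /\ forall w, Cmod (w - z) < delta -> Cmod (f w - f z) < eps.
Proof.
move=> H eps He; have [d [H0 Hd]] := cderiv_lip _ _ _ H.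
have Hl := Cmod_ge_0 l.
have He' : 0 < eps / (Cmod l + 1) by apply: Rdiv_lt_0_compat; lra.
exists (Rmin d (eps / (Cmod l + 1))); split; first exact: Rmin_pos.
move=> w Hw; apply: Rle_lt_trans (Hd w (Rlt_le_trans _ _ _ Hw (Rmin_l _ _))) _.
have Hw2 := Rlt_le_trans _ _ _ Hw (Rmin_r _ _).
have -> : eps = (Cmod l + 1) * (eps / (Cmod l + 1)) by field; lra.
by apply: Rmult_lt_compat_l; lra.
Qed.

Lemma cderiv_mult f g z l m : cderiv f z l -> cderiv g z m ->
  cderiv (fun w => f w * g w)%C z (l * g z + f z * m)%C.
Proof.
move=> Hf Hg eps He.
have [Pf [Pg Pl]] := conj (Cmod_ge_0 (f z)) (conj (Cmod_ge_0 (g z)) (Cmod_ge_0 l)).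
set K := Cmod (f z) + Cmod (g z) + Cmod l + 2.
have HK : 0 < K by rewrite /K; lra.
have Hek : 0 < eps / K by apply: Rdiv_lt_0_compat.
have [d1 [H1 D1]] := Hf _ Hek; have [d2 [H2 D2]] := Hg _ Hek.
have [d3 [H3 D3]] := cderiv_lip _ _ _ Hf.
have [d4 [H4 D4]] := cderiv_continuous _ _ _ Hg _ Hek.
exists (Rmin (Rmin d1 d2) (Rmin d3 d4)); split; first by do !apply: Rmin_pos.
move=> w Hw.
have [[h1 h2] [h3 h4]] : (Cmod (w - z) < d1 /\ Cmod (w - z) < d2) /\
  (Cmod (w - z) < d3 /\ Cmod (w - z) < d4).
  by move: Hw (Rmin_l (Rmin d1 d2) (Rmin d3 d4)) (Rmin_r (Rmin d1 d2) (Rmin d3 d4))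
    (Rmin_l d1 d2) (Rmin_r d1 d2) (Rmin_l d3 d4) (Rmin_r d3 d4); lra.
move: {D1 D2 D3 D4} (D1 w h1) (D2 w h2) (D3 w h3) (D4 w h4).
have -> : (f w * g w - f z * g z - (l * g z + f z * m) * (w - z) =
  (f w - f z - l * (w - z)) * g z + f z * (g w - g z - m * (w - z))
   + (f w - f z) * (g w - g z))%C by ring.
set A := (f w - f z - _)%C; set B := (g w - g z - _)%C.
set D := (f w - f z)%C; set E := (g w - g z)%C; set x := Cmod (w - z).
have Hx : 0 <= x := Cmod_ge_0 _.
move=> HA HB HD HE.
apply: Rle_trans (Cmod_triangle _ _) _; rewrite Cmod_mult.
apply: Rle_trans (Rplus_le_compat_r _ _ _ (Cmod_triangle _ _)) _; rewrite !Cmod_mult.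
have -> : eps = (eps / K) * K by field; lra.
move: Hek HA HB HE; set e := eps / K => He0 HA HB HE.
have a1 : Cmod A * Cmod (g z) <= e * x * Cmod (g z) by apply: Rmult_le_compat_r.
have a2 : Cmod (f z) * Cmod B <= Cmod (f z) * (e * x) by apply: Rmult_le_compat_l.
have a3 : Cmod D * Cmod E <= ((Cmod l + 1) * x) * e.
  by apply: Rmult_le_compat; try exact: Cmod_ge_0; lra.
have : 0 <= e * x by apply: Rmult_le_pos; lra.
rewrite /K; nra.
Qed.

Lemma cderiv_cmult c f z l : cderiv f z l -> cderiv (fun w => c * f w)%C z (c * l)%C.
Proof.
move=> H; have := cderiv_mult _ _ _ _ _ (cderiv_const c z) H.
by apply: cderiv_eq; ring.
Qed.

Lemma cderiv_opp f z l : cderiv f z l -> cderiv (fun w => - f w)%C z (- l)%C.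
Proof.
move=> /(cderiv_cmult (-(1))) H.
apply: (cderiv_ext (fun w => -(1) * f w)%C); first by move=> w; ring.
by apply: cderiv_eq H; ring.
Qed.

Lemma cderiv_minus f g z l m : cderiv f z l -> cderiv g z m ->
  cderiv (fun w => f w - g w)%C z (l - m)%C.
Proof. by move=> Hf Hg; apply: cderiv_plus Hf (cderiv_opp _ _ _ Hg). Qed.

Lemma cderiv_comp f g z l m : cderiv g z m -> cderiv f (g z) l ->
  cderiv (fun w => f (g w)) z (l * m)%C.
Proof.
move=> Hg Hf eps He.
have Pm := Cmod_ge_0 m; have Pl := Cmod_ge_0 l.
have He1 : 0 < eps / (2 * (Cmod m + 1)) by apply: Rdiv_lt_0_compat; lra.
have He2 : 0 < eps / (2 * (Cmod l + 1)) by apply: Rdiv_lt_0_compat; lra.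
have [d1 [H1 D1]] := Hf _ He1.
have [d2 [H2 D2]] := Hg _ He2.
have [d3 [H3 D3]] := cderiv_lip _ _ _ Hg.
have [d4 [H4 D4]] := cderiv_continuous _ _ _ Hg _ H1.
exists (Rmin d2 (Rmin d3 d4)); split; first by do !apply: Rmin_pos.
move=> w Hw.
have [h2 [h3 h4]] : Cmod (w - z) < d2 /\ Cmod (w - z) < d3 /\ Cmod (w - z) < d4.
  by move: Hw (Rmin_l d2 (Rmin d3 d4)) (Rmin_r d2 (Rmin d3 d4))
    (Rmin_l d3 d4) (Rmin_r d3 d4); lra.
have -> : (f (g w) - f (g z) - l * m * (w - z) =
  (f (g w) - f (g z) - l * (g w - g z)) + l * (g w - g z - m * (w - z)))%C by ring.
apply: Rle_trans (Cmod_triangle _ _) _; rewrite (Cmod_mult l).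
have a1 := D1 _ (D4 w h4); have a2 := D2 w h2; have a3 := D3 w h3.
have b1 := Rmult_le_compat_l _ _ _ (Rlt_le _ _ He1) a3.
have b2 := Rmult_le_compat_l _ _ _ Pl a2.
have e1 : eps / (2 * (Cmod m + 1)) * ((Cmod m + 1) * Cmod (w - z)) = eps / 2 * Cmod (w - z).
  by field; lra.
have e2 : Cmod l * (eps / (2 * (Cmod l + 1)) * Cmod (w - z)) <= eps / 2 * Cmod (w - z).
  have -> : eps / 2 * Cmod (w - z) = (Cmod l + 1) * (eps / (2 * (Cmod l + 1)) * Cmod (w - z)).
    by field; lra.
  apply: Rmult_le_compat_r; last lra.
  by apply: Rmult_le_pos; [lra|apply: Cmod_ge_0].
lra.
Qed.

Lemma cderiv_inv_id z : z <> 0%C -> cderiv (fun w => / w)%C z (- / (z * z))%C.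
Proof.
move=> Hz eps He; have P := Cmod_pos _ Hz; set p := Cmod z in P.
exists (Rmin (p / 2) (eps * p ^ 3 / 2)); split.
  apply: Rmin_pos; first lra.
  have := pow_lt _ 3 P; nra.
move=> w Hw; have h1 := Rlt_le_trans _ _ _ Hw (Rmin_l _ _).
have h2 := Rlt_le_trans _ _ _ Hw (Rmin_r _ _).
have Hw2 : p / 2 <= Cmod w.
  by have := Cmod_le_add w z; rewrite (Cmod_sub_sym z w) -/p; lra.
have Hw0 : w <> 0%C by move=> E; move: Hw2; rewrite E Cmod_0; lra.
have -> : (/ w - / z - - / (z * z) * (w - z) = (w - z) * (w - z) / (w * z * z))%C.
  by field.
rewrite Cmod_div; last by do !apply: Cmult_neq_0.
rewrite !Cmod_mult -/p; set x := Cmod (w - z) in h1 h2 *.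
have Hx : 0 <= x := Cmod_ge_0 _.
apply: (Rmult_le_reg_r (Cmod w * p * p)); first by do !apply: Rmult_lt_0_compat; lra.
have -> : x * x / (Cmod w * p * p) * (Cmod w * p * p) = x * x by field; split; lra.
have a : eps * p ^ 3 / 2 <= eps * (Cmod w * p * p).
  have -> : eps * p ^ 3 / 2 = eps * (p / 2 * p * p) by field.
  by apply: Rmult_le_compat_l; [lra|]; do 2 (apply: Rmult_le_compat_r; first lra).
nra.
Qed.

Lemma cderiv_inv f z l : f z <> 0%C -> cderiv f z l ->
  cderiv (fun w => / f w)%C z (- l / (f z * f z))%C.
Proof.
move=> H0 H; have := cderiv_comp _ _ _ _ _ H (cderiv_inv_id _ H0).
by apply: cderiv_eq; field.
Qed.

Lemma cderiv_div f g z l m : g z <> 0%C -> cderiv f z l -> cderiv g z m ->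
  cderiv (fun w => f w / g w)%C z ((l * g z - f z * m) / (g z * g z))%C.
Proof.
move=> H0 Hf Hg; have := cderiv_mult _ _ _ _ _ Hf (cderiv_inv _ _ _ H0 Hg).
by apply: cderiv_eq; field.
Qed.

(** * Curves and the mean value inequality *)

Definition rderiv (g : R -> C) (t : R) (l : C) : Prop :=
  is_derive (fun s => Re (g s)) t (Re l) /\ is_derive (fun s => Im (g s)) t (Im l).

(** Pairing the increment of the curve with its own direction reduces the vector
    inequality to monotonicity of one real function. *)
Lemma curve_mean_value (g g' : R -> C) (psi psi' : R -> R) a b : a <= b ->
  (forall t, a <= t <= b ->
    [/\ rderiv g t (g' t), is_derive psi t (psi' t) & Cmod (g' t) <= psi' t]) ->
  Cmod (g b - g a) <= psi b - psi a.
Proof.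
move=> Hab H; set D := (g b - g a)%C; set q := Cmod D.
have Hq : 0 <= q := Cmod_ge_0 _.
pose phi t := (Re D * Re (g t) + Im D * Im (g t)) - (q * psi t).
pose phi' t := (Re D * Re (g' t) + Im D * Im (g' t)) - (q * psi' t).
have Hphi t : a <= t <= b -> is_derive phi t (phi' t).
  move=> /H [[h1 h2] h3 _].
  apply: (is_derive_minus (V := R_NormedModule)); last exact: is_derive_scal.
  by apply: (is_derive_plus (V := R_NormedModule)); apply: is_derive_scal.
have Hneg t : a <= t <= b -> phi' t <= 0.
  move=> /H [_ _ h]; rewrite /phi'.
  have e : Re D * Re (g' t) + Im D * Im (g' t) = Re (g' t * Cconj D).
    by rewrite re_mult re_conj im_conj; ring.
  have := Rle_trans _ _ _ (Rle_abs _) (re_le_Cmod (g' t * Cconj D)).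
  rewrite -e Cmod_mult Cmod_conj -/q; nra.
have e : Re D * Re D + Im D * Im D = q * q by have := Cmod2_alt D; rewrite -/q /=; lra.
have [c [Ec Hc]] : exists c, phi b - phi a = phi' c * (b - a) /\ a <= c <= b.
  case: (Req_dec a b) => [<-|Hne]; first by exists a; split; lra.
  have [c [Hc1 [Hc2 Hc3]]] : exists c, a <= c /\ c <= b /\ phi b - phi a = phi' c * (b - a).
    have [| |c [[h1 h2] h3]] := MVT_gen phi a b phi'.
    - by move=> x; rewrite Rmin_left // Rmax_right // => Hx; apply: Hphi; lra.
    - move=> x; rewrite Rmin_left // Rmax_right // => Hx.
      by apply: derivable_continuous_pt; exists (phi' x); apply/is_derive_Reals; apply: Hphi.
    by rewrite Rmin_left // in h1; rewrite Rmax_right // in h2; exists c.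
  by exists c; split; [|lra].
have Hn := Hneg c Hc.
have : phi b - phi a <= 0 by rewrite Ec; nra.
have -> : phi b - phi a = q * q - q * (psi b - psi a).
  by rewrite -e /phi /D re_plus im_plus re_opp im_opp; ring.
case: (Rle_lt_or_eq_dec _ _ Hq) => [Hq0|<- _]; first by nra.
have [c' [Ec' [Hc' _]]] : exists c, psi b - psi a = psi' c * (b - a) /\ a <= c <= b /\ True.
  case: (Req_dec a b) => [<-|Hne]; first by exists a; split; [|split]; lra.
  have [| |c' [[h1 h2] h3]] := MVT_gen psi a b psi'.
  - by move=> x; rewrite Rmin_left // Rmax_right // => Hx; case: (H x); [lra|].
  - move=> x; rewrite Rmin_left // Rmax_right // => Hx; case: (H x) => // _ h _.
    by apply: derivable_continuous_pt; exists (psi' x); apply/is_derive_Reals.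
  by rewrite Rmin_left // in h1; rewrite Rmax_right // in h2; exists c'.
case: (H c' Hc') => _ _ h; have := Cmod_ge_0 (g' c'); nra.
Qed.

Lemma rderiv_increment (u : R -> C) t l :
  (forall eps, 0 < eps -> exists delta, 0 < delta /\
     forall h, Rabs h < delta -> Cmod (u (t + h) - u t - h * l) <= eps * Rabs h) ->
  rderiv u t l.
Proof.
move=> H; split; apply/is_derive_Reals => eps He;
  have [d [H0 Hd]] := H (eps / 2) ltac:(lra); exists (mkposreal d H0) => h Hh Hhd;
  have {Hd} := Hd h Hhd; set D := (_ - _ - _)%C => HD;
  have Hh' := Rabs_pos_lt _ Hh.
- have -> : (Re (u (t + h)) - Re (u t)) / h - Re l = Re D / h.
    by rewrite /D !re_plus !re_opp re_scal_l; field.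
  rewrite Rabs_div //; apply: (Rmult_lt_reg_r (Rabs h)) => //.
  have -> : Rabs (Re D) / Rabs h * Rabs h = Rabs (Re D) by field; lra.
  by have := re_le_Cmod D; nra.
- have -> : (Im (u (t + h)) - Im (u t)) / h - Im l = Im D / h.
    by rewrite /D !im_plus !im_opp im_scal_l; field.
  rewrite Rabs_div //; apply: (Rmult_lt_reg_r (Rabs h)) => //.
  have -> : Rabs (Im D) / Rabs h * Rabs h = Rabs (Im D) by field; lra.
  have h1 := Rle_trans _ _ _ (Rmax_r _ _) (Rmax_Cmod D); rewrite -/(Im D) in h1; nra.
Qed.

Lemma rderiv_line f (a b : C) t l : cderiv f (a + RtoC t * b)%C l ->
  rderiv (fun s => f (a + RtoC s * b)%C) t (l * b)%C.
Proof.
move=> H; apply: rderiv_increment => eps He.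
have Pb := Cmod_ge_0 b.
have He1 : 0 < eps / (Cmod b + 1) by apply: Rdiv_lt_0_compat; lra.
have [d [H0 Hd]] := H _ He1.
exists (d / (Cmod b + 1)); split; first by apply: Rdiv_lt_0_compat; lra.
move=> h Hh; have {Hd} := Hd (a + RtoC (t + h) * b)%C.
have -> : (a + RtoC (t + h) * b - (a + t * b) = h * b)%C by rewrite RtoC_plus; ring.
rewrite Cmod_mult Cmod_R => Hd.
have Hh' : Rabs h * Cmod b < d.
  have := Rmult_lt_compat_r (Cmod b + 1) _ _ ltac:(lra) Hh.
  have -> : d / (Cmod b + 1) * (Cmod b + 1) = d by field; lra.
  have := Rabs_pos h; nra.
have -> : (h * (l * b) = l * (h * b))%C by ring.
apply: Rle_trans (Hd Hh') _.
have -> : eps * Rabs h = eps / (Cmod b + 1) * (Rabs h * (Cmod b + 1)) by field; lra.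
apply: Rmult_le_compat_l; first lra.
by apply: Rmult_le_compat_l; [exact: Rabs_pos|lra].
Qed.

Lemma segment_mean_value f f' (a b : C) (psi psi' : R -> R) T : 0 <= T ->
  (forall t, 0 <= t <= T ->
    [/\ cderiv f (a + RtoC t * b)%C (f' (a + RtoC t * b)%C), is_derive psi t (psi' t)
      & Cmod (f' (a + RtoC t * b)%C) * Cmod b <= psi' t]) ->
  Cmod (f (a + RtoC T * b)%C - f a) <= psi T - psi 0.
Proof.
move=> HT H.
have := curve_mean_value (fun s => f (a + RtoC s * b)%C)
  (fun s => f' (a + RtoC s * b) * b)%C psi psi' 0 T HT.
have -> : (a + RtoC 0 * b = a)%C by ring.
apply=> t /H [h1 h2 h3]; split=> //; first exact: rderiv_line.
by rewrite Cmod_mult.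
Qed.

Definition cconvex (A : C -> Prop) : Prop :=
  forall u v t, A u -> A v -> 0 <= t <= 1 -> A (u + RtoC t * (v - u))%C.

Lemma mean_value_convex A f f' K : cconvex A ->
  (forall z, A z -> cderiv f z (f' z) /\ Cmod (f' z) <= K) ->
  forall z w, A z -> A w -> Cmod (f z - f w) <= K * Cmod (z - w).
Proof.
move=> HA H z w Hz Hw.
have := segment_mean_value f f' w (z - w)%C (fun t => K * Cmod (z - w) * t)
  (fun _ => K * Cmod (z - w)) 1 Rle_0_1.
have -> : (w + RtoC 1 * (z - w) = z)%C by ring.
rewrite Rmult_1_r Rmult_0_r Rminus_0_r; apply=> t Ht.
have [h1 h2] := H _ (HA w z t Hw Hz Ht).
split=> //; last by apply: Rmult_le_compat_r h2; apply: Cmod_ge_0.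
by auto_derive => //; ring.
Qed.

Lemma cconvex_ball (a : C) r : cconvex (fun z => Cmod (z - a) < r).
Proof.
move=> u v t Hu Hv Ht.
have -> : (u + RtoC t * (v - u) - a = RtoC (1 - t) * (u - a) + RtoC t * (v - a))%C.
  by rewrite RtoC_minus; ring.
apply: Rle_lt_trans (Cmod_triangle _ _) _; rewrite !Cmod_mult !Cmod_RtoC_pos; try lra.
case: (Req_dec t 0) => [->|Ht0]; first by lra.
nra.
Qed.

Lemma cconvex_closed_ball (a : C) r : cconvex (fun z => Cmod (z - a) <= r).
Proof.
move=> u v t Hu Hv Ht.
have -> : (u + RtoC t * (v - u) - a = RtoC (1 - t) * (u - a) + RtoC t * (v - a))%C.
  by rewrite RtoC_minus; ring.
apply: Rle_trans (Cmod_triangle _ _) _; rewrite !Cmod_mult !Cmod_RtoC_pos; try lra.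
nra.
Qed.

(** * The complex exponential *)

Lemma Cexp_plus z w : Cexp (z + w) = (Cexp z * Cexp w)%C.
Proof.
rewrite /Cexp re_plus im_plus exp_plus cos_plus sin_plus.
by apply: injective_projections => /=; ring.
Qed.

Lemma Cexp_0 : Cexp 0 = 1%C.
Proof. by apply: injective_projections; rewrite /= exp_0 ?cos_0 ?sin_0; ring. Qed.

Lemma Cexp_opp_l z : (Cexp (- z) * Cexp z = 1)%C.
Proof. by rewrite -Cexp_plus Cplus_comm Cplus_opp_r Cexp_0. Qed.

Lemma Cexp_neq0 z : Cexp z <> 0%C.
Proof.
move=> E; have := Cexp_opp_l z; rewrite E Cmult_0_r => E'; exact: C1_nz (eq_sym E').
Qed.

Lemma Cexp_opp z : Cexp (- z) = (/ Cexp z)%C.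
Proof.
have H := Cexp_neq0 z; rewrite -(Cmult_1_l (/ Cexp z)) -(Cexp_opp_l z).
by field.
Qed.

Lemma Cmod_Cexp z : Cmod (Cexp z) = exp (Re z).
Proof.
rewrite /Cmod /=; have := sin2_cos2 (Im z); rewrite /Rsqr => H.
have -> : exp (Re z) * cos (Im z) * (exp (Re z) * cos (Im z) * 1) +
  exp (Re z) * sin (Im z) * (exp (Re z) * sin (Im z) * 1) =
  exp (Re z) * exp (Re z) * (sin (Im z) * sin (Im z) + cos (Im z) * cos (Im z)) by ring.
by rewrite H Rmult_1_r sqrt_square //; apply: Rlt_le; apply: exp_pos.
Qed.

Lemma Cexp_period z : Cexp (z + RtoC (2 * PI) * Ci) = Cexp z.
Proof.
rewrite Cexp_plus.
have -> : Cexp (RtoC (2 * PI) * Ci) = 1%C; last by ring.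
rewrite /Cexp re_mult im_mult /= !Rmult_0_r !Rmult_0_l Rmult_1_r Rminus_0_r Rplus_0_r.
by rewrite exp_0 cos_2PI sin_2PI; apply: injective_projections => /=; ring.
Qed.

Lemma Cexp_Ci_PI : Cexp (RtoC PI * Ci) = (- (1))%C.
Proof.
rewrite /Cexp re_mult im_mult /= !Rmult_0_r !Rmult_0_l Rmult_1_r Rminus_0_r Rplus_0_r.
by rewrite exp_0 cos_PI sin_PI; apply: injective_projections => /=; ring.
Qed.

Lemma re_abs_le z : Rabs (Re z) <= Cmod z.
Proof. exact: re_le_Cmod. Qed.

Lemma im_abs_le z : Rabs (Im z) <= Cmod z.
Proof. exact: Rle_trans (Rmax_r _ _) (Rmax_Cmod z). Qed.

Lemma re_le z : Re z <= Cmod z.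
Proof. exact: Rle_trans (Rle_abs _) (re_abs_le z). Qed.

Lemma Cmod_Cexp_le z : Cmod (Cexp z) <= exp (Cmod z).
Proof.
rewrite Cmod_Cexp; case: (Rle_lt_or_eq_dec _ _ (re_le z)) => [/exp_increasing|->]; lra.
Qed.

Lemma rderiv_Cexp_ray w t : rderiv (fun s => Cexp (RtoC s * w)) t (Cexp (RtoC t * w) * w)%C.
Proof.
split; rewrite /Cexp ?re_mult ?im_mult /=.
- apply: (is_derive_ext (fun s => exp (s * Re w) * cos (s * Im w))).
    by move=> s; rewrite !Rmult_0_l Rminus_0_r Rplus_0_r.
  auto_derive => //.
  rewrite -/(Re w) -/(Im w) !Rmult_0_l Rminus_0_r Rplus_0_r; ring.
- apply: (is_derive_ext (fun s => exp (s * Re w) * sin (s * Im w))).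
    by move=> s; rewrite !Rmult_0_l Rminus_0_r Rplus_0_r.
  auto_derive => //.
  rewrite -/(Re w) -/(Im w) !Rmult_0_l Rminus_0_r Rplus_0_r; ring.
Qed.

Lemma exp_le_compat x y : x <= y -> exp x <= exp y.
Proof. by case/Rle_lt_or_eq_dec => [/exp_increasing|->]; lra. Qed.

Lemma Cexp_sub1_le w : Cmod (Cexp w - 1) <= exp (Cmod w) - 1.
Proof.
have := curve_mean_value (fun s => Cexp (RtoC s * w)) (fun t => Cexp (RtoC t * w) * w)%C
  (fun t => exp (t * Cmod w)) (fun t => Cmod w * exp (t * Cmod w)) 0 1 Rle_0_1.
rewrite Cmult_0_l Cexp_0 Cmult_1_l Rmult_0_l Rmult_1_l exp_0; apply=> t Ht.
split; first exact: rderiv_Cexp_ray.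
  by auto_derive => //; ring.
rewrite Cmod_mult Rmult_comm; apply: Rmult_le_compat_l; first exact: Cmod_ge_0.
by apply: Rle_trans (Cmod_Cexp_le _) _; rewrite Cmod_mult Cmod_RtoC_pos; lra.
Qed.

Lemma Cexp_taylor1_le w : Cmod (Cexp w - 1 - w) <= exp (Cmod w) - 1 - Cmod w.
Proof.
have := curve_mean_value (fun s => Cexp (RtoC s * w) - RtoC s * w)%C
  (fun t => Cexp (RtoC t * w) * w - w)%C
  (fun t => exp (t * Cmod w) - t * Cmod w) (fun t => (exp (t * Cmod w) - 1) * Cmod w) 0 1 Rle_0_1.
rewrite !Cmult_0_l Cexp_0 !Cmult_1_l !Rmult_0_l !Rmult_1_l exp_0.
have -> : (Cexp w - w - (1 - 0) = Cexp w - 1 - w)%C by ring.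
have -> : exp (Cmod w) - Cmod w - (1 - 0) = exp (Cmod w) - 1 - Cmod w by ring.
apply=> t Ht; split.
- have [h1 h2] := rderiv_Cexp_ray w t; split.
    apply: (is_derive_ext (fun s => Re (Cexp (RtoC s * w)) - s * Re w)).
      by move=> s; rewrite re_plus re_opp re_scal_l.
    rewrite re_plus re_opp; apply: (is_derive_minus (V := R_NormedModule)) => //.
    by auto_derive => //; ring.
  apply: (is_derive_ext (fun s => Im (Cexp (RtoC s * w)) - s * Im w)).
    by move=> s; rewrite im_plus im_opp im_scal_l.
  rewrite im_plus im_opp; apply: (is_derive_minus (V := R_NormedModule)) => //.
  by auto_derive => //; ring.
- by auto_derive => //; ring.
- have -> : (Cexp (t * w) * w - w = (Cexp (t * w) - 1) * w)%C by ring.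
  rewrite Cmod_mult; apply: Rmult_le_compat_r; first exact: Cmod_ge_0.
  by apply: Rle_trans (Cexp_sub1_le _) _; rewrite Cmod_mult Cmod_RtoC_pos; lra.
Qed.

Lemma exp_le_inv_sub x : x < 1 -> exp x <= / (1 - x).
Proof.
move=> Hx; have h := exp_ineq1_le (- x).
rewrite -(Ropp_involutive x) exp_Ropp Ropp_involutive.
by apply: Rinv_le_contravar; lra.
Qed.

Lemma exp_sub1_le x : 0 <= x <= / 2 -> exp x - 1 <= 2 * x.
Proof.
move=> Hx; have := exp_le_inv_sub x ltac:(lra).
have : / (1 - x) <= 1 + 2 * x; last lra.
apply: (Rmult_le_reg_r (1 - x)); first lra.
by rewrite Rinv_l; nra.
Qed.

Lemma exp_taylor1_le x : 0 <= x <= / 2 -> exp x - 1 - x <= 2 * x * x.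
Proof.
move=> Hx; have := exp_le_inv_sub x ltac:(lra).
have : / (1 - x) <= 1 + x + 2 * x * x; last lra.
apply: (Rmult_le_reg_r (1 - x)); first lra.
rewrite Rinv_l; last lra.
have : 0 <= x * x * (1 - 2 * x); last lra.
by do 2 (apply: Rmult_le_pos; try lra).
Qed.

Lemma Cexp_sub1_small w : Cmod w <= / 2 -> Cmod (Cexp w - 1) <= 2 * Cmod w.
Proof.
move=> H; apply: Rle_trans (Cexp_sub1_le _) _; apply: exp_sub1_le.
by split; [exact: Cmod_ge_0|].
Qed.

Lemma cderiv_Cexp z : cderiv Cexp z (Cexp z).
Proof.
move=> eps He; have P := exp_pos (Re z).
exists (Rmin (/ 2) (eps / (2 * exp (Re z)))); split.
  by apply: Rmin_pos; [lra|apply: Rdiv_lt_0_compat; lra].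
move=> w Hw; have h1 := Rlt_le_trans _ _ _ Hw (Rmin_l _ _).
have h2 := Rlt_le_trans _ _ _ Hw (Rmin_r _ _).
have -> : (Cexp w - Cexp z - Cexp z * (w - z) = Cexp z * (Cexp (w - z) - 1 - (w - z)))%C.
  have {1}-> : w = (z + (w - z))%C by ring.
  by rewrite Cexp_plus; ring.
rewrite Cmod_mult Cmod_Cexp; have Hx := Cmod_ge_0 (w - z).
have h3 := Rle_trans _ _ _ (Cexp_taylor1_le (w - z)) (exp_taylor1_le _ (conj Hx (Rlt_le _ _ h1))).
apply: Rle_trans (Rmult_le_compat_l _ _ _ (Rlt_le _ _ P) h3) _.
have -> : exp (Re z) * (2 * Cmod (w - z) * Cmod (w - z)) =
  (2 * exp (Re z) * Cmod (w - z)) * Cmod (w - z) by ring.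
apply: Rmult_le_compat_r => //.
have -> : eps = 2 * exp (Re z) * (eps / (2 * exp (Re z))) by field; lra.
by apply: Rmult_le_compat_l; lra.
Qed.

Lemma Cexp_surj z : z <> 0%C -> exists l, z = Cexp l.
Proof.
move=> Hz; have P := Cmod_pos _ Hz.
set x := Re z / Cmod z; set y := Im z / Cmod z.
have Exy : x ^ 2 + y ^ 2 = 1.
  rewrite /x /y.
  have -> : (Re z / Cmod z) ^ 2 + (Im z / Cmod z) ^ 2 = (Re z ^ 2 + Im z ^ 2) / Cmod z ^ 2.
    by field; lra.
  by rewrite -Cmod2_alt; field; lra.
have Hx : -1 <= x <= 1 by nra.
have [t [Hc Hs]] : exists t, cos t = x /\ sin t = y.
  case: (Rle_dec 0 y) => Hy.
    exists (acos x); split; first exact: cos_acos.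
    rewrite sin_acos //; have -> : 1 - Rsqr x = Rsqr y by rewrite /Rsqr; lra.
    exact: sqrt_Rsqr.
  exists (- acos x); split; first by rewrite cos_neg; exact: cos_acos.
  rewrite sin_neg sin_acos //.
  have -> : 1 - Rsqr x = Rsqr (- y) by rewrite /Rsqr; lra.
  by rewrite sqrt_Rsqr; lra.
exists (ln (Cmod z), t); rewrite /Cexp /= exp_ln // Hc Hs /x /y.
by apply: injective_projections => /=; rewrite -/(Re z) -/(Im z); field; lra.
Qed.

(** * Goursat's theorem and primitives *)

Definition Cint (u : R -> C) (a b : R) : C := RInt (V := C_R_CompleteNormedModule) u a b.

(** The end points may come in either order, so that rectangles with corners at two
    arbitrary points are covered. *)
Definition between (a b s : R) : Prop := Rmin a b <= s <= Rmax a b.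

Definition rcontinuous (u : R -> C) (t : R) : Prop :=
  forall eps, 0 < eps -> exists delta, 0 < delta /\
    forall s, Rabs (s - t) < delta -> Cmod (u s - u t) < eps.

Definition rcontinuous_between (u : R -> C) (a b : R) : Prop :=
  forall t, between a b t -> rcontinuous u t.

Lemma rcontinuous_continuous (u : R -> C) t :
  rcontinuous u t -> continuous (T := R_UniformSpace) (U := C_R_CompleteNormedModule) u t.
Proof.
move=> H P [eps HP]; have [d [H0 Hd]] := H eps (cond_pos eps).
exists (mkposreal d H0) => s Hs; apply: HP.
have := Hd s Hs; set D := (_ - _)%C => HD.
have h1 := Rle_lt_trans _ _ _ (re_abs_le D) HD.
have h2 := Rle_lt_trans _ _ _ (im_abs_le D) HD.
by split; [move: h1|move: h2]; rewrite /D ?re_plus ?im_plus ?re_opp ?im_opp.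
Qed.

Lemma ex_Cint u a b : rcontinuous_between u a b ->
  ex_RInt (V := C_R_CompleteNormedModule) u a b.
Proof. by move=> H; apply: ex_RInt_continuous => t /H; apply: rcontinuous_continuous. Qed.

Lemma norm_Cmod (z : C) : @norm R_AbsRing C_R_CompleteNormedModule z = Cmod z.
Proof.
rewrite /norm /= /prod_norm /Cmod /norm /= /abs /=.
by f_equal; rewrite !Rmult_1_r -!Rabs_mult !Rabs_pos_eq //; apply: Rle_0_sqr.
Qed.

Lemma rcontinuous_minus (u v : R -> C) t :
  rcontinuous u t -> rcontinuous v t -> rcontinuous (fun s => u s - v s)%C t.
Proof.
move=> Hu Hv eps He; have [d1 [H1 D1]] := Hu (eps / 2) ltac:(lra).
have [d2 [H2 D2]] := Hv (eps / 2) ltac:(lra).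
exists (Rmin d1 d2); split; first exact: Rmin_pos.
move=> s Hs; have := D1 s (Rlt_le_trans _ _ _ Hs (Rmin_l _ _)).
have := D2 s (Rlt_le_trans _ _ _ Hs (Rmin_r _ _)).
have -> : (u s - v s - (u t - v t) = (u s - u t) - (v s - v t))%C by ring.
by have := Cmod_tri_sub (u s - u t) (v s - v t); lra.
Qed.

Lemma rcontinuous_const c t : rcontinuous (fun _ => c) t.
Proof. by move=> eps He; exists 1; split=> [|s _]; rewrite ?Cmod_sub0; lra. Qed.

Lemma Cint_Chasles u a b c : rcontinuous_between u a b -> rcontinuous_between u b c ->
  (Cint u a b + Cint u b c = Cint u a c)%C.
Proof. by move=> /ex_Cint H1 /ex_Cint H2; apply: (RInt_Chasles (V := C_R_CompleteNormedModule)). Qed.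

Lemma Cint_minus u v a b : rcontinuous_between u a b -> rcontinuous_between v a b ->
  (Cint (fun t => u t - v t) a b = Cint u a b - Cint v a b)%C.
Proof. by move=> /ex_Cint H1 /ex_Cint H2; apply: (RInt_minus (V := C_R_CompleteNormedModule)). Qed.

Lemma Cint_const (c : C) a b : Cint (fun _ => c) a b = (RtoC (b - a) * c)%C.
Proof. by rewrite /Cint (RInt_const (V := C_R_CompleteNormedModule)) scal_R_Cmult. Qed.

Lemma between_sym a b s : between a b s -> between b a s.
Proof. by rewrite /between Rmin_comm Rmax_comm. Qed.

Lemma Cint_bound u a b M : rcontinuous_between u a b ->
  (forall t, between a b t -> Cmod (u t) <= M) -> Cmod (Cint u a b) <= Rabs (b - a) * M.
Proof.
have main a' b' : a' <= b' -> rcontinuous_between u a' b' ->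
    (forall t, between a' b' t -> Cmod (u t) <= M) -> Cmod (Cint u a' b') <= Rabs (b' - a') * M.
  move=> Hab Hc HM; rewrite Rabs_pos_eq; last lra.
  rewrite -norm_Cmod; apply: (norm_RInt_le_const (V := C_R_CompleteNormedModule) u) => //.
    by move=> x Hx; rewrite norm_Cmod; apply: HM; rewrite /between Rmin_left // Rmax_right.
  by apply: (RInt_correct (V := C_R_CompleteNormedModule)); apply: ex_Cint.
move=> Hc HM; case: (Rle_dec a b) => Hab; first exact: main.
have -> : Cint u a b = (- Cint u b a)%C.
  by rewrite /Cint -(opp_RInt_swap (V := C_R_CompleteNormedModule)) //;
     apply: ex_Cint => t /between_sym; apply: Hc.
rewrite Cmod_opp Rabs_minus_sym; apply: main; first lra.
  by move=> t /between_sym; apply: Hc.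
by move=> t /between_sym; apply: HM.
Qed.

Definition rect (x1 x2 y1 y2 : R) (z : C) : Prop :=
  between x1 x2 (Re z) /\ between y1 y2 (Im z).

Definition differentiable (f : C -> C) (z : C) : Prop := exists l, cderiv f z l.

Lemma rcontinuous_horizontal f s y : differentiable f (s, y) ->
  rcontinuous (fun t => f (t, y)) s.
Proof.
move=> [l /cderiv_continuous H] eps He; have [d [H0 Hd]] := H eps He.
exists d; split=> // t Ht; apply: Hd.
have -> : ((t, y) - (s, y) = RtoC (t - s))%C by apply: injective_projections => /=; ring.
by rewrite Cmod_R.
Qed.

Lemma rcontinuous_vertical f x s : differentiable f (x, s) ->
  rcontinuous (fun t => f (x, t)) s.
Proof.
move=> [l /cderiv_continuous H] eps He; have [d [H0 Hd]] := H eps He.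
exists d; split=> // t Ht; apply: Hd.
have -> : ((x, t) - (x, s) = Ci * RtoC (t - s))%C by apply: injective_projections => /=; ring.
by rewrite Cmod_mult Cmod_Ci Rmult_1_l Cmod_R.
Qed.

Definition rect_boundary_int (f : C -> C) (x1 x2 y1 y2 : R) : C :=
  (Cint (fun s => f (s, y1)) x1 x2 + Ci * Cint (fun t => f (x2, t)) y1 y2
   - Cint (fun s => f (s, y2)) x1 x2 - Ci * Cint (fun t => f (x1, t)) y1 y2)%C.

Definition halves (a b a' b' : R) : Prop :=
  (a' = a /\ b' = (a + b) / 2) \/ (a' = (a + b) / 2 /\ b' = b).

Lemma between_cases a b s : between a b s -> a <= s <= b \/ b <= s <= a.
Proof. by rewrite /between /Rmin /Rmax; case: (Rle_dec a b) => ? ?; [left|right]; lra. Qed.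

Lemma between_intro a b s : a <= s <= b \/ b <= s <= a -> between a b s.
Proof. by rewrite /between /Rmin /Rmax; case: (Rle_dec a b) => ? [?|?]; lra. Qed.

Lemma halves_between a b a' b' s : halves a b a' b' -> between a' b' s -> between a b s.
Proof.
by case=> -[-> ->] /between_cases H; apply: between_intro; lra.
Qed.

Lemma halves_length a b a' b' : halves a b a' b' -> Rabs (b' - a') = Rabs (b - a) / 2.
Proof.
by case=> -[-> ->]; split_Rabs; lra.
Qed.

(** The common point is the supremum of the lower end points. *)
Lemma nested_intervals (a b : nat -> R) :
  (forall n, halves (a n) (b n) (a (S n)) (b (S n))) ->
  exists s, forall n, between (a n) (b n) s.
Proof.
move=> H; pose lo n := Rmin (a n) (b n); pose hi n := Rmax (a n) (b n).
have Hlo n : lo n <= lo (S n).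
  have : between (a n) (b n) (lo (S n)).
    by apply: halves_between (H n) _; split; [exact: Rle_refl|exact: Rminmax].
  by case.
have Hhi n : hi (S n) <= hi n.
  have : between (a n) (b n) (hi (S n)).
    by apply: halves_between (H n) _; split; [exact: Rminmax|exact: Rle_refl].
  by case.
have Hlo' n k : lo n <= lo (n + k)%nat.
  elim: k => [|k IH]; first by rewrite -plus_n_O; exact: Rle_refl.
  by rewrite -plus_n_Sm; apply: Rle_trans IH (Hlo _).
have Hhi' n k : hi (n + k)%nat <= hi n.
  elim: k => [|k IH]; first by rewrite -plus_n_O; exact: Rle_refl.
  by rewrite -plus_n_Sm; apply: Rle_trans (Hhi _) IH.
have Hlh n k : lo n <= hi k.
  apply: Rle_trans (Hlo' n k) _; apply: Rle_trans (Rminmax _ _) _.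
  by rewrite Nat.add_comm; apply: Hhi'.
have [||s [Hs1 Hs2]] := completeness (fun x => exists n, x = lo n).
- by exists (hi 0%nat) => x [n ->]; apply: Hlh.
- by exists (lo 0%nat), 0%nat.
exists s => n; split; first by apply: Hs1; exists n.
by apply: Hs2 => x [k ->]; apply: Hlh.
Qed.

(** A property that each rectangle passes on to one of its four quarters localizes at a
    point. *)
Lemma quadrisection (Bad : nat -> R -> R -> R -> R -> Prop) x1 x2 y1 y2 :
  Bad 0%nat x1 x2 y1 y2 ->
  (forall n a b c d, Bad n a b c d -> exists a' b' c' d',
     [/\ halves a b a' b', halves c d c' d' & Bad (S n) a' b' c' d']) ->
  exists u v, forall n, exists a b c d, [/\ Bad n a b c d,
    Rabs (b - a) = Rabs (x2 - x1) / 2 ^ n /\ Rabs (d - c) = Rabs (y2 - y1) / 2 ^ n,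
    between a b u & between c d v].
Proof.
move=> H0 Hstep.
pose good n (q q' : R * R * R * R) :=
  let: (a, b, c, d) := q in let: (a', b', c', d') := q' in
  [/\ halves a b a' b', halves c d c' d' & Bad (S n) a' b' c' d'].
pose next n q := epsilon (inhabits q) (good n q).
pose q := nat_rect (fun _ => (R * R * R * R)%type) (x1, x2, y1, y2) next.
pose A n := fst (fst (fst (q n))); pose B n := snd (fst (fst (q n))).
pose CC n := snd (fst (q n)); pose D n := snd (q n).
have Eq n : q n = (A n, B n, CC n, D n) by rewrite /A /B /CC /D; case: (q n) => [[[]]].
have Hgood n : Bad n (A n) (B n) (CC n) (D n) -> good n (q n) (q (S n)).
  move=> HB; apply: (epsilon_spec (inhabits (q n)) (good n (q n))).
  have [a [b [c [d [h1 h2 h3]]]]] := Hstep _ _ _ _ _ HB.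
  by exists (a, b, c, d); rewrite Eq.
have Hbad n : Bad n (A n) (B n) (CC n) (D n).
  by elim: n => [|n /Hgood]; [exact: H0|rewrite !Eq => -[]].
have Hh n : halves (A n) (B n) (A (S n)) (B (S n)) /\ halves (CC n) (D n) (CC (S n)) (D (S n)).
  by have := Hgood n (Hbad n); rewrite !Eq => -[].
have [u Hu] := nested_intervals A B (fun n => proj1 (Hh n)).
have [v Hv] := nested_intervals CC D (fun n => proj2 (Hh n)).
exists u, v => n; exists (A n), (B n), (CC n), (D n); split=> //.
elim: n => [|n [IH1 IH2]]; first by rewrite /A /B /CC /D /=; split; field.
have [h1 h2] := Hh n; rewrite (halves_length _ _ _ _ h1) (halves_length _ _ _ _ h2) IH1 IH2 /=.
by split; field; apply: pow_nonzero; lra.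
Qed.

Definition rect_differentiable f x1 x2 y1 y2 : Prop :=
  forall z, rect x1 x2 y1 y2 z -> differentiable f z.

Lemma rect_halves x1 x2 y1 y2 a b c d z : halves x1 x2 a b -> halves y1 y2 c d ->
  rect a b c d z -> rect x1 x2 y1 y2 z.
Proof. by move=> h1 h2 [? ?]; split; [apply: halves_between h1 _|apply: halves_between h2 _]. Qed.

Lemma between_l a b : between a b a.
Proof. by apply: between_intro; lra. Qed.

Lemma between_r a b : between a b b.
Proof. by apply: between_intro; lra. Qed.

Lemma between_mid a b : between a b ((a + b) / 2).
Proof. by apply: between_intro; lra. Qed.

Lemma rect_horizontal f x1 x2 y1 y2 a b y : rect_differentiable f x1 x2 y1 y2 ->
  (forall s, between a b s -> between x1 x2 s) -> between y1 y2 y ->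
  rcontinuous_between (fun s => f (s, y)) a b.
Proof. by move=> H Hs Hy s /Hs Hs'; apply: rcontinuous_horizontal; apply: H. Qed.

Lemma rect_vertical f x1 x2 y1 y2 a b x : rect_differentiable f x1 x2 y1 y2 ->
  (forall t, between a b t -> between y1 y2 t) -> between x1 x2 x ->
  rcontinuous_between (fun t => f (x, t)) a b.
Proof. by move=> H Hs Hy s /Hs Hs'; apply: rcontinuous_vertical; apply: H. Qed.

Lemma rect_boundary_int_split f x1 x2 y1 y2 : rect_differentiable f x1 x2 y1 y2 ->
  let m := (x1 + x2) / 2 in let k := (y1 + y2) / 2 in
  rect_boundary_int f x1 x2 y1 y2 =
  (rect_boundary_int f x1 m y1 k + rect_boundary_int f m x2 y1 k
   + rect_boundary_int f x1 m k y2 + rect_boundary_int f m x2 k y2)%C.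
Proof.
move=> H m k; rewrite /rect_boundary_int.
have hm := between_mid x1 x2; have hk := between_mid y1 y2; rewrite -/m -/k in hm hk.
have sl s : between x1 m s -> between x1 x2 s by apply: halves_between; left.
have sr s : between m x2 s -> between x1 x2 s by apply: halves_between; right.
have tl s : between y1 k s -> between y1 y2 s by apply: halves_between; left.
have tr s : between k y2 s -> between y1 y2 s by apply: halves_between; right.
have eH y : between y1 y2 y -> Cint (fun s => f (s, y)) x1 x2 =
    (Cint (fun s => f (s, y)) x1 m + Cint (fun s => f (s, y)) m x2)%C.
  by move=> Hy; rewrite Cint_Chasles //; apply: rect_horizontal H _ Hy.
have eV x : between x1 x2 x -> Cint (fun t => f (x, t)) y1 y2 =
    (Cint (fun t => f (x, t)) y1 k + Cint (fun t => f (x, t)) k y2)%C.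
  by move=> Hx; rewrite Cint_Chasles //; apply: rect_vertical H _ Hx.
rewrite (eH y1 (between_l _ _)) (eH y2 (between_r _ _)).
rewrite (eV x1 (between_l _ _)) (eV x2 (between_r _ _)).
ring.
Qed.

(** The boundary integral of an affine function vanishes, so only the error of the
    linear approximation at [w] contributes. *)
Lemma rect_boundary_int_small f x1 x2 y1 y2 w l e : 0 <= e ->
  rect_differentiable f x1 x2 y1 y2 -> rect x1 x2 y1 y2 w ->
  (forall z, rect x1 x2 y1 y2 z -> Cmod (f z - f w - l * (z - w)) <= e * Cmod (z - w)) ->
  Cmod (rect_boundary_int f x1 x2 y1 y2) <= 2 * e * (Rabs (x2 - x1) + Rabs (y2 - y1)) ^ 2.
Proof.
move=> He H Hw HE; set S := Rabs (x2 - x1) + Rabs (y2 - y1).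
have dist a b s t : between a b s -> between a b t -> Rabs (s - t) <= Rabs (b - a).
  by move=> /between_cases h1 /between_cases h2; split_Rabs; lra.
have HE' z : rect x1 x2 y1 y2 z -> Cmod (f z - f w - l * (z - w)) <= e * S.
  move=> Hz; apply: Rle_trans (HE z Hz) _; apply: Rmult_le_compat_l => //.
  case: Hz Hw => [h1 h2] [h3 h4].
  have -> : (z - w = RtoC (Re z - Re w) + Ci * RtoC (Im z - Im w))%C.
    by apply: injective_projections; rewrite /= /Re /Im; ring.
  apply: Rle_trans (Cmod_triangle _ _) _; rewrite Cmod_mult Cmod_Ci Rmult_1_l !Cmod_R.
  by apply: Rplus_le_compat; apply: dist.
have l1 := between_l x1 x2; have r1 := between_r x1 x2.
have l2 := between_l y1 y2; have r2 := between_r y1 y2.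
pose c1 := (l * (RtoC (y1 - y2) * Ci))%C; pose c2 := (l * RtoC (x2 - x1))%C.
have cH y : between y1 y2 y -> rcontinuous_between (fun s => f (s, y)) x1 x2.
  exact: rect_horizontal H (fun _ h => h).
have cV x : between x1 x2 x -> rcontinuous_between (fun t => f (x, t)) y1 y2.
  exact: rect_vertical H (fun _ h => h).
have cD u v a b : rcontinuous_between u a b -> rcontinuous_between v a b ->
    rcontinuous_between (fun t => u t - v t)%C a b.
  by move=> h1 h2 t Ht; apply: rcontinuous_minus; [apply: h1|apply: h2].
have cC c a b : rcontinuous_between (fun _ => c) a b by move=> t _; apply: rcontinuous_const.
have -> : rect_boundary_int f x1 x2 y1 y2 =
    (Cint (fun s => f (s, y1) - f (s, y2) - c1) x1 x2
     + Ci * Cint (fun t => f (x2, t) - f (x1, t) - c2) y1 y2)%C.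
  rewrite !Cint_minus; auto; rewrite !Cint_const /rect_boundary_int /c1 /c2 !RtoC_minus.
  ring.
have b1 : Cmod (Cint (fun s => f (s, y1) - f (s, y2) - c1)%C x1 x2) <= Rabs (x2 - x1) * (2 * (e * S)).
  apply: Cint_bound; first by auto.
  move=> t Ht.
  have -> : (f (t, y1) - f (t, y2) - c1 = (f (t, y1) - f w - l * ((t, y1) - w))
      - (f (t, y2) - f w - l * ((t, y2) - w)))%C.
    have -> : c1 = (l * ((t, y1) - (t, y2)))%C.
      by rewrite /c1; congr Cmult; apply: injective_projections => /=; ring.
    ring.
  apply: Rle_trans (Cmod_tri_sub _ _) _.
  have := HE' (t, y1) (conj Ht l2); have := HE' (t, y2) (conj Ht r2); lra.
have b2 : Cmod (Cint (fun t => f (x2, t) - f (x1, t) - c2)%C y1 y2) <= Rabs (y2 - y1) * (2 * (e * S)).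
  apply: Cint_bound; first by auto.
  move=> t Ht.
  have -> : (f (x2, t) - f (x1, t) - c2 = (f (x2, t) - f w - l * ((x2, t) - w))
      - (f (x1, t) - f w - l * ((x1, t) - w)))%C.
    have -> : c2 = (l * ((x2, t) - (x1, t)))%C.
      by rewrite /c2; congr Cmult; apply: injective_projections => /=; ring.
    ring.
  apply: Rle_trans (Cmod_tri_sub _ _) _.
  have := HE' (x1, t) (conj l1 Ht); have := HE' (x2, t) (conj r1 Ht); lra.
apply: Rle_trans (Cmod_triangle _ _) _; rewrite Cmod_mult Cmod_Ci Rmult_1_l.
apply: Rle_trans (Rplus_le_compat _ _ _ _ b1 b2) _; rewrite /S /=; lra.
Qed.

(** If the boundary integral were nonzero, some nested sequence of quarters would keep
    at least the fraction [/ 4 ^ n] of it, while near the limit point the linear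
    approximation makes it [o(/ 4 ^ n)]. *)
Theorem goursat f x1 x2 y1 y2 : rect_differentiable f x1 x2 y1 y2 ->
  rect_boundary_int f x1 x2 y1 y2 = 0%C.
Proof.
move=> H; set J := Cmod (rect_boundary_int f x1 x2 y1 y2).
pose Bad n a b c d := (forall z, rect a b c d z -> rect x1 x2 y1 y2 z) /\
  J / 4 ^ n <= Cmod (rect_boundary_int f a b c d).
have [||u [v Huv]] := quadrisection Bad x1 x2 y1 y2.
- by split=> //; rewrite /= /J; lra.
- move=> n a b c d [Hsub HJ].
  set m := (a + b) / 2; set k := (c + d) / 2.
  set J1 := rect_boundary_int f a m c k; set J2 := rect_boundary_int f m b c k.
  set J3 := rect_boundary_int f a m k d; set J4 := rect_boundary_int f m b k d.
  have EJ : rect_boundary_int f a b c d = (J1 + J2 + J3 + J4)%C.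
    exact: rect_boundary_int_split (fun z Hz => H z (Hsub z Hz)).
  have hp : 0 < 4 ^ n by apply: pow_lt; lra.
  have E4 : J / 4 ^ n = 4 * (J / 4 ^ S n) by rewrite /=; field; lra.
  have hl : halves a b a m by left.
  have hr : halves a b m b by right.
  have kl : halves c d c k by left.
  have kr : halves c d k d by right.
  have big : J / 4 ^ S n <= Cmod J1 \/ J / 4 ^ S n <= Cmod J2 \/
      J / 4 ^ S n <= Cmod J3 \/ J / 4 ^ S n <= Cmod J4.
    move: HJ; rewrite EJ E4 => HJ.
    have := Cmod_triangle (J1 + J2 + J3) J4; have := Cmod_triangle (J1 + J2) J3.
    have := Cmod_triangle J1 J2.
    case: (Rle_dec (J / 4 ^ S n) (Cmod J1)) => [|h1]; first by left.
    case: (Rle_dec (J / 4 ^ S n) (Cmod J2)) => [|h2]; first by right; left.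
    case: (Rle_dec (J / 4 ^ S n) (Cmod J3)) => [|h3]; first by right; right; left.
    by right; right; right; lra.
  by case: big => [h|[h|[h|h]]]; [exists a, m, c, k|exists m, b, c, k|
    exists a, m, k, d|exists m, b, k, d]; split=> //; (split; last exact: h) => z Hz;
    apply: Hsub; apply: (rect_halves _ _ _ _ _ _ _ _ _ _ _ Hz).
set S := Rabs (x2 - x1) + Rabs (y2 - y1).
have HS : 0 <= S by rewrite /S; have := Rabs_pos (x2 - x1); have := Rabs_pos (y2 - y1); lra.
have Huv0 : rect x1 x2 y1 y2 (u, v).
  by have [a [b [c [d [[Hs _] _ hu hv]]]]] := Huv 0%nat; apply: Hs.
have [l Hl] := H _ Huv0.
suff Hsmall : forall eps, 0 < eps -> J <= 2 * eps * S ^ 2.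
  apply: Cmod_eq_0; rewrite -/J; have J0 : 0 <= J := Cmod_ge_0 _.
  case: (Rle_lt_or_eq_dec _ _ J0) => // Jpos.
  have S2 := pow2_ge_0 S.
  have hd : 0 < 4 * (S ^ 2 + 1) by lra.
  have := Hsmall (J / (4 * (S ^ 2 + 1))) (Rdiv_lt_0_compat _ _ Jpos hd).
  have -> : 2 * (J / (4 * (S ^ 2 + 1))) * S ^ 2 = J * (S ^ 2 / (2 * (S ^ 2 + 1))).
    by field; lra.
  have : S ^ 2 / (2 * (S ^ 2 + 1)) <= / 2.
    apply: (Rmult_le_reg_r (2 * (S ^ 2 + 1))); first lra.
    have -> : S ^ 2 / (2 * (S ^ 2 + 1)) * (2 * (S ^ 2 + 1)) = S ^ 2.
      by field; lra.
    lra.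
  nra.
move=> eps He; have [d [d0 Hd]] := Hl eps He.
have [n Hn] : exists n, S / 2 ^ n < d.
  have [N HN] := pow_lt_1_zero (/ 2) ltac:(rewrite Rabs_pos_eq; lra) (d / (S + 1))
    ltac:(apply: Rdiv_lt_0_compat; lra).
  exists N; have := HN N (Nat.le_refl _).
  rewrite pow_inv Rabs_pos_eq; last by apply: Rlt_le; apply: Rinv_0_lt_compat; apply: pow_lt; lra.
  move=> /(Rmult_lt_compat_r (S + 1) _ _ ltac:(lra)).
  have -> : d / (S + 1) * (S + 1) = d by field; lra.
  have : 0 < / 2 ^ N by apply: Rinv_0_lt_compat; apply: pow_lt; lra.
  by rewrite /Rdiv; nra.
have [a [b [c [e [[Hs HJ] [ex ey] hu hv]]]]] := Huv n.
have p2 : 0 < 2 ^ n by apply: pow_lt; lra.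
have Esum : Rabs (b - a) + Rabs (e - c) = S / 2 ^ n by rewrite ex ey /S; field; lra.
have := rect_boundary_int_small f a b c e (u, v) l eps (Rlt_le _ _ He)
  (fun z Hz => H z (Hs z Hz)) (conj hu hv).
rewrite Esum => Hb.
have {Hb} : Cmod (rect_boundary_int f a b c e) <= 2 * eps * (S / 2 ^ n) ^ 2.
  apply: Hb => z [h1 h2]; apply: Hd; apply: Rle_lt_trans Hn; rewrite -Esum.
  have -> : (z - (u, v) = RtoC (Re z - u) + Ci * RtoC (Im z - v))%C.
    by apply: injective_projections; rewrite /= /Re /Im; ring.
  apply: Rle_trans (Cmod_triangle _ _) _; rewrite Cmod_mult Cmod_Ci Rmult_1_l !Cmod_R.
  by move: h1 h2 hu hv => /between_cases h1 /between_cases h2 /between_cases h3 /between_cases h4;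
    apply: Rplus_le_compat; split_Rabs; lra.
have E4 : (4 : R) ^ n = 2 ^ n * 2 ^ n by rewrite -Rpow_mult_distr; f_equal; lra.
have hp : 0 < 4 ^ n by apply: pow_lt; lra.
move=> /(Rle_trans _ _ _ HJ) /(Rmult_le_compat_r (4 ^ n) _ _ (Rlt_le _ _ hp)).
have -> : J / 4 ^ n * 4 ^ n = J by field; lra.
have -> : 2 * eps * (S / 2 ^ n) ^ 2 * 4 ^ n = 2 * eps * S ^ 2 by rewrite E4; field; lra.
by [].
Qed.

(** A primitive is obtained by integrating along a horizontal and then a vertical
    segment; Goursat's theorem lets the two legs be exchanged near the end point. *)
Theorem primitive_exists (U : C -> Prop) b f :
  (forall z, U z -> exists r, 0 < r /\ forall w, Cmod (w - z) < r -> U w) ->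
  (forall z w, U z -> rect (Re b) (Re z) (Im b) (Im z) w -> U w) ->
  (forall z, U z -> differentiable f z) ->
  exists F, forall z, U z -> cderiv F z (f z).
Proof.
move=> Uopen Urect Hf.
exists (fun z => Cint (fun s => f (s, Im b)) (Re b) (Re z)
  + Ci * Cint (fun t => f (Re z, t)) (Im b) (Im z))%C => z Uz eps He.
have [r [r0 Hr]] := Uopen z Uz.
have [l /cderiv_continuous Hl] := Hf z Uz.
have [d [d0 Hd]] := Hl (eps / 2) ltac:(lra).
exists (Rmin r d / 2); split; first by have := Rmin_pos _ _ r0 d0; lra.
move=> w Hw; set x := Re z; set y := Im z; set x' := Re w; set y' := Im w.
set bx := Re b; set y0 := Im b.
have near s t : between x x' s -> between y y' t ->
    Cmod ((s, t) - z) < Rmin r d.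
  move=> /between_cases h1 /between_cases h2.
  have -> : ((s, t) - z = RtoC (s - x) + Ci * RtoC (t - y))%C.
    by apply: injective_projections; rewrite /= /x /y /Re /Im; ring.
  apply: Rle_lt_trans (Cmod_triangle _ _) _; rewrite Cmod_mult Cmod_Ci Rmult_1_l !Cmod_R.
  have := re_abs_le (w - z); have := im_abs_le (w - z).
  rewrite re_plus im_plus re_opp im_opp -/x -/y -/x' -/y' => e1 e2.
  have : Rabs (s - x) <= Rabs (x' - x) by split_Rabs; lra.
  have : Rabs (t - y) <= Rabs (y' - y) by split_Rabs; lra.
  rewrite /Rminus in e1 e2 *; lra.
have nearU s t : between x x' s -> between y y' t -> U (s, t).
  by move=> h1 h2; apply: Hr; apply: Rlt_le_trans (near s t h1 h2) (Rmin_l _ _).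
have nearf s t : between x x' s -> between y y' t -> Cmod (f (s, t) - f z) <= eps / 2.
  by move=> h1 h2; apply: Rlt_le; apply: Hd; apply: Rlt_le_trans (near s t h1 h2) (Rmin_r _ _).
have lx := between_l x x'; have rx := between_r x x'.
have ly := between_l y y'; have ry := between_r y y'.
have HH s u v : (forall t, between u v t -> U (s, t)) ->
    rcontinuous_between (fun t => f (s, t)) u v.
  by move=> H t Ht; apply: rcontinuous_vertical; apply: Hf; apply: H.
have HV t u v : (forall s, between u v s -> U (s, t)) ->
    rcontinuous_between (fun s => f (s, t)) u v.
  by move=> H s Hs; apply: rcontinuous_horizontal; apply: Hf; apply: H.
have strip s t : between x x' s -> between y0 y t -> U (s, t).
  move=> h1 h2; apply: (Urect (s, y)); first exact: nearU.
  by split=> //=; exact: between_r.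
have := goursat f x x' y0 y; rewrite /rect_boundary_int => G.
have {}G := G (fun p Hp => Hf p ltac:(case: Hp => h1 h2; rewrite (surjective_pairing p); exact: strip)).
have E1 : Cint (fun s => f (s, y0)) bx x' =
    (Cint (fun s => f (s, y0)) bx x + Cint (fun s => f (s, y0)) x x')%C.
  rewrite Cint_Chasles //; apply: HV => s Hs.
    by apply: (Urect z) => //; split=> //=; exact: between_l.
  by apply: strip => //; exact: between_l.
have E2 : Cint (fun t => f (x', t)) y0 y' =
    (Cint (fun t => f (x', t)) y0 y + Cint (fun t => f (x', t)) y y')%C.
  rewrite Cint_Chasles //; apply: HH => t Ht; first exact: strip.
  exact: nearU.
have cC c u v : rcontinuous_between (fun _ => c) u v by move=> t _; apply: rcontinuous_const.
have cD u v p q : rcontinuous_between u p q -> rcontinuous_between v p q ->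
    rcontinuous_between (fun t => u t - v t)%C p q.
  by move=> h1 h2 t Ht; apply: rcontinuous_minus; [apply: h1|apply: h2].
have c1 : rcontinuous_between (fun s => f (s, y)) x x' by apply: HV => s Hs; apply: nearU.
have c2 : rcontinuous_between (fun t => f (x', t)) y y' by apply: HH => s Hs; apply: nearU.
have -> : (Cint (fun s => f (s, y0)) bx x' + Ci * Cint (fun t => f (x', t)) y0 y'
   - (Cint (fun s => f (s, y0)) bx x + Ci * Cint (fun t => f (x, t)) y0 y) - f z * (w - z) =
   Cint (fun s => f (s, y) - f z) x x' + Ci * Cint (fun t => f (x', t) - f z) y y')%C.
  rewrite !Cint_minus // !Cint_const E1 E2.
  have -> : (w - z = RtoC (x' - x) + Ci * RtoC (y' - y))%C.
    by apply: injective_projections; rewrite /= /x /y /x' /y' /Re /Im; ring.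
  apply/Ceq_minus; rewrite -[X in _ = X]G; ring.
have B1 := Cint_bound _ _ _ (eps / 2) (cD _ _ _ _ c1 (cC (f z) x x')) (fun s Hs => nearf s y Hs ly).
have B2 := Cint_bound _ _ _ (eps / 2) (cD _ _ _ _ c2 (cC (f z) y y')) (fun t Ht => nearf x' t rx Ht).
apply: Rle_trans (Cmod_triangle _ _) _; rewrite Cmod_mult Cmod_Ci Rmult_1_l.
apply: Rle_trans (Rplus_le_compat _ _ _ _ B1 B2) _.
have := re_abs_le (w - z); have := im_abs_le (w - z).
rewrite re_plus im_plus re_opp im_opp -/x -/y -/x' -/y' => e1 e2.
rewrite /Rminus in e1 e2 *; nra.
Qed.

(** * Cauchy estimates *)

Lemma differentiable_C_derive f z : differentiable f z -> cderiv f z (C_derive f z).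
Proof. by move=> [l H]; rewrite (cderiv_C_derive _ _ _ H). Qed.

(** In the coordinate [a + Cexp w] the punctured disk becomes a half-plane, on which
    [f (a + Cexp w) * Cexp (- w)] has a primitive. The increment of that primitive over
    a period does not depend on the point; far to the left it is close to
    [2 * PI * Ci] times the derivative of [f] at [a]. *)
Theorem cauchy_estimate_center f (a l : C) R M : 0 < R ->
  (forall z, Cmod (z - a) < R -> differentiable f z /\ Cmod (f z) <= M) ->
  f a = 0%C -> cderiv f a l -> Cmod l * R <= M.
Proof.
move=> R0 Hf fa Hl.
pose U w := exp (Re w) < R.
pose Phi w := (f (a + Cexp w) * Cexp (- w))%C.
have UR w : U w -> Cmod (a + Cexp w - a) < R.
  by move=> H; have -> : (a + Cexp w - a = Cexp w)%C by [ring]; rewrite Cmod_Cexp.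
have dPhi w : U w -> differentiable Phi w.
  move=> /UR /Hf [[m Hm] _]; eexists; apply: cderiv_mult.
    apply: (cderiv_comp f (fun w => a + Cexp w)%C); last exact: Hm.
    by apply: cderiv_plus; [apply: cderiv_const|apply: cderiv_Cexp].
  apply: (cderiv_comp Cexp (fun w => - w)%C); last exact: cderiv_Cexp.
  by apply: cderiv_opp; apply: cderiv_id.
have [Psi HPsi] : exists Psi, forall w, U w -> cderiv Psi w (Phi w).
  apply: (primitive_exists U (RtoC (ln (R / 2)))) => //.
    move=> z Uz; have [d [d0 Hd]] := cderiv_continuous _ _ _ (cderiv_Cexp z) (R - exp (Re z)) ltac:(rewrite /U in Uz; lra).
    exists d; split=> // w /Hd Hw.
    by rewrite /U -Cmod_Cexp; have := Cmod_le_add (Cexp z) (Cexp w); rewrite (Cmod_Cexp z); lra.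
  move=> z w Uz [/between_cases /= Hw _]; rewrite /U in Uz *.
  have : exp (Re w) <= exp (ln (R / 2)) \/ exp (Re w) <= exp (Re z).
    by case: Hw => Hw; [right|left]; apply: exp_le_compat; lra.
  by rewrite exp_ln; lra.
set T := (RtoC (2 * PI) * Ci)%C.
have UT w : U w -> U (w + T)%C.
  by rewrite /U re_plus; have -> : Re T = 0 by [rewrite /T re_mult /=; ring]; rewrite Rplus_0_r.
have PhiT w : Phi (w + T)%C = Phi w.
  rewrite /Phi Cexp_period; congr (_ * _)%C.
  by rewrite -(Cexp_period (- (w + T))); f_equal; rewrite -/T; ring.
(* The increment over a period has derivative 0 since [Phi] is periodic. *)
pose chi w := (Psi (w + T) - Psi w)%C.
have Uconv : cconvex U.
  move=> u v t Uu Uv Ht; rewrite /U re_plus re_scal_l re_plus re_opp.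
  have : Re u + t * (Re v + - Re u) <= Rmax (Re u) (Re v).
    by have := Rmax_l (Re u) (Re v); have := Rmax_r (Re u) (Re v); nra.
  move=> /exp_le_compat; rewrite /U in Uu Uv.
  by rewrite /Rmax; case: Rle_dec => _; lra.
have shift F w m : cderiv F (w + T)%C m -> cderiv (fun w => F (w + T)%C) w m.
  move=> H; have := cderiv_comp F (fun w => w + T)%C w m 1%C.
  rewrite Cmult_1_r; apply=> //.
  by have := cderiv_plus _ _ _ _ _ (cderiv_id w) (cderiv_const T w); apply: cderiv_eq; ring.
have chi_const u v : U u -> U v -> chi u = chi v.
  move=> Uu Uv; apply: Cmod_zero_eq.
  rewrite -(Rmult_0_l (Cmod (u - v))).
  apply: (mean_value_convex U chi (fun _ => 0%C)) => // w Uw.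
  rewrite Cmod_0; split; last exact: Rle_refl.
  have := cderiv_minus _ _ _ _ _ (shift _ _ _ (HPsi _ (UT _ Uw))) (HPsi _ Uw).
  by apply: cderiv_eq; rewrite PhiT; ring.
have line_conv x : cconvex (fun w => Re w = x).
  by move=> u v t Hu Hv _; rewrite re_plus re_scal_l re_plus re_opp Hu Hv; ring.
have HPI := PI_RGT_0.
have ModT : Cmod T = 2 * PI by rewrite /T Cmod_mult Cmod_Ci Cmod_RtoC_pos; lra.
have chi_le r : 0 < r < R -> Cmod (chi (RtoC (ln r))) <= M / r * (2 * PI).
  move=> Hr; rewrite /chi -ModT.
  have -> : Cmod T = Cmod (ln r + T - ln r) by f_equal; ring.
  have UU w : Re w = ln r -> U w by move=> E; rewrite /U E exp_ln; lra.
  apply: (mean_value_convex (fun w => Re w = ln r) Psi Phi) => //; last first.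
    by rewrite re_plus /T re_mult /=; ring.
  move=> w Hw; split; first exact: HPsi (UU w Hw).
  have [_ hM] := Hf _ (UR w (UU w Hw)).
  rewrite /Phi Cmod_mult Cmod_Cexp re_opp Hw exp_Ropp exp_ln; last lra.
  by apply: Rmult_le_compat_r hM; apply: Rlt_le; apply: Rinv_0_lt_compat; lra.
have chi_near eps : 0 < eps -> exists r, 0 < r < R /\
    Cmod (chi (RtoC (ln r)) - l * T) <= eps * (2 * PI).
  move=> He; have [d [d0 Hd]] := Hl eps He.
  have := Rmin_pos _ _ R0 d0; have := Rmin_l R d; have := Rmin_r R d.
  set r := Rmin R d => h1 h2 h3; exists (r / 2); split; first lra.
  rewrite /chi -ModT.
  have -> : Cmod T = Cmod (ln (r / 2) + T - ln (r / 2)) by f_equal; ring.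
  have -> : (Psi (ln (r / 2) + T) - Psi (ln (r / 2)) - l * T =
    (Psi (ln (r / 2) + T) - l * (ln (r / 2) + T)) - (Psi (ln (r / 2)) - l * ln (r / 2)))%C by ring.
  have UU w : Re w = ln (r / 2) -> U w by move=> E; rewrite /U E exp_ln; lra.
  apply: (mean_value_convex (fun w => Re w = ln (r / 2)) (fun w => Psi w - l * w)%C
    (fun w => Phi w - l)%C) => //; last first.
    by rewrite re_plus /T re_mult /=; ring.
  move=> w Hw; split.
    have := cderiv_minus _ _ _ _ _ (HPsi _ (UU w Hw)) (cderiv_cmult l _ _ _ (cderiv_id w)).
    by apply: cderiv_eq; ring.
  have hC : Cmod (Cexp w) = r / 2 by rewrite Cmod_Cexp Hw exp_ln; lra.
  have := Hd (a + Cexp w)%C.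
  have -> : (a + Cexp w - a = Cexp w)%C by ring.
  rewrite hC fa => /(_ ltac:(lra)) h.
  have -> : (Phi w - l = (f (a + Cexp w) - 0 - l * Cexp w) * Cexp (- w))%C.
    rewrite /Phi.
    have -> : ((f (a + Cexp w)%C - 0 - l * Cexp w) * Cexp (- w) =
      f (a + Cexp w)%C * Cexp (- w) - l * (Cexp (- w) * Cexp w))%C by ring.
    by rewrite Cexp_opp_l; ring.
  rewrite Cmod_mult (Cmod_Cexp (- w)) re_opp Hw exp_Ropp exp_ln; last lra.
  apply: (Rmult_le_reg_r (r / 2)); first lra.
  by rewrite Rmult_assoc Rinv_l; lra.
have key r eps : 0 < r < R -> 0 < eps -> Cmod l <= M / r + eps.
  move=> Hr He; have [r' [Hr' h]] := chi_near eps He.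
  have hc := chi_le r Hr.
  have E : chi (RtoC (ln r')) = chi (RtoC (ln r)).
    by apply: chi_const; rewrite /U /= exp_ln; lra.
  have := Cmod_le_add (chi (RtoC (ln r'))) (l * T)%C.
  rewrite Cmod_sub_sym {1}E Cmod_mult ModT => h2.
  apply: (Rmult_le_reg_r (2 * PI)); first lra.
  by rewrite Rmult_plus_distr_r; lra.
have key2 r : 0 < r < R -> Cmod l * r <= M.
  move=> Hr; apply: Rnot_lt_le => h.
  have := key r ((Cmod l - M / r) / 2) Hr.
  have e : M / r < Cmod l.
    apply: (Rmult_lt_reg_r r); first lra.
    by have -> : M / r * r = M by field; lra.
  by move=> /(_ ltac:(lra)); lra.
apply: Rnot_lt_le => h.
have l0 : 0 < Cmod l.
  have := key2 (R / 2) ltac:(lra); have := Cmod_ge_0 l => h3.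
  case: h3 => // h3; rewrite -h3 in h *; lra.
have hr : 0 < M / Cmod l + R by have := key2 (R / 2) ltac:(lra); move=> h4;
   have : 0 <= M / Cmod l; [apply: Rmult_le_pos; [nra|apply: Rlt_le; exact: Rinv_0_lt_compat]|lra].
have h5 : M / Cmod l < R.
  apply: (Rmult_lt_reg_r (Cmod l)) => //.
  by have -> : M / Cmod l * Cmod l = M by [field; lra]; lra.
have := key2 ((M / Cmod l + R) / 2) ltac:(lra).
have -> : Cmod l * ((M / Cmod l + R) / 2) = (M + Cmod l * R) / 2 by field; lra.
lra.
Qed.

(** Only the oscillation of [f] about its value at the centre matters, since a constant
    may be subtracted. *)
Lemma cauchy_estimate_osc f (a l : C) R M : 0 < R ->
  (forall z, Cmod (z - a) < R -> differentiable f z /\ Cmod (f z - f a) <= M) ->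
  cderiv f a l -> Cmod l * R <= M.
Proof.
move=> R0 Hf Hl; have d z m : cderiv f z m -> cderiv (fun z => f z - f a)%C z m.
  move=> H; have := cderiv_minus _ _ _ _ _ H (cderiv_const (f a) z).
  by apply: cderiv_eq; ring.
apply: (cauchy_estimate_center (fun z => f z - f a)%C a) => //.
- by move=> z /Hf [[m /d Hm] h]; split=> //; exists m.
- by ring.
- exact: d.
Qed.

Lemma cauchy_estimate f (a l : C) R M : 0 < R ->
  (forall z, Cmod (z - a) < R -> differentiable f z /\ Cmod (f z) <= M) ->
  cderiv f a l -> Cmod l * R <= 2 * M.
Proof.
move=> R0 Hf; apply: cauchy_estimate_osc => // z Hz.
have [h1 h2] := Hf z Hz; split=> //.
have [_ h3] := Hf a ltac:(rewrite Cmod_sub0; lra).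
by have := Cmod_tri_sub (f z) (f a); lra.
Qed.

Lemma C_complete_seq (u : nat -> C) :
  (forall eps, 0 < eps -> exists N, forall n p, (N <= n)%nat -> (N <= p)%nat ->
     Cmod (u n - u p) < eps) ->
  exists l, forall eps, 0 < eps -> exists N, forall n, (N <= n)%nat -> Cmod (u n - l) < eps.
Proof.
move=> H.
have [|x Hx] := Rcomplete.R_complete (fun n => Re (u n)).
  move=> eps He; have [N HN] := H eps He; exists N => n p hn hp.
  apply: Rle_lt_trans (HN n p hn hp); rewrite /Rdist.
  by have := re_abs_le (u n - u p); rewrite re_plus re_opp.
have [|y Hy] := Rcomplete.R_complete (fun n => Im (u n)).
  move=> eps He; have [N HN] := H eps He; exists N => n p hn hp.
  apply: Rle_lt_trans (HN n p hn hp); rewrite /Rdist.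
  by have := im_abs_le (u n - u p); rewrite im_plus im_opp.
exists (x, y) => eps He.
have [N1 H1] := Hx (eps / 2) ltac:(lra); have [N2 H2] := Hy (eps / 2) ltac:(lra).
exists (Nat.max N1 N2) => n hn.
have := H1 n ltac:(lia); have := H2 n ltac:(lia); rewrite /Rdist => h2 h1.
have -> : (u n - (x, y) = RtoC (Re (u n) - x) + Ci * RtoC (Im (u n) - y))%C.
  by apply: injective_projections; rewrite /= /Re /Im; ring.
apply: Rle_lt_trans (Cmod_triangle _ _) _; rewrite Cmod_mult Cmod_Ci Rmult_1_l !Cmod_R; lra.
Qed.

Lemma ball_triangle (a z w : C) r s :
  Cmod (z - a) < r -> Cmod (w - z) < s -> Cmod (w - a) < r + s.
Proof. by move=> h1 h2; have := Cmod_tri_dist z w a; lra. Qed.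

Lemma shift_differentiable f z (h : C) : differentiable f (z + h)%C ->
  cderiv (fun w => f (w + h)%C) z (C_derive f (z + h)%C).
Proof.
move=> /differentiable_C_derive H.
have := cderiv_comp f (fun w => w + h)%C z _ 1%C _ H; rewrite Cmult_1_r; apply.
by have := cderiv_plus _ _ _ _ _ (cderiv_id z) (cderiv_const h z); apply: cderiv_eq; ring.
Qed.

(** Applying the Cauchy estimate to [f (z + h) - f z] shows that the derivative is
    Lipschitz, and applying it to differences of difference quotients of [f] shows that
    the difference quotients of the derivative form a Cauchy family. *)
Theorem C_derive_differentiable f (a : C) R0 : 0 < R0 ->
  (forall z, Cmod (z - a) < R0 -> differentiable f z) -> differentiable (C_derive f) a.
Proof.
move=> HR0 Hf.
have [d [d0 Hd]] : exists d, 0 < d /\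
    forall w, Cmod (w - a) < d -> Cmod (f w - f a) < 1.
  have [l Hl] := Hf a ltac:(rewrite Cmod_sub0; lra).
  exact: cderiv_continuous Hl _ Rlt_0_1.
set R := Rmin R0 d; have HR : 0 < R by exact: Rmin_pos.
have RR0 : R <= R0 by exact: Rmin_l.
have Rd : R <= d by exact: Rmin_r.
set f' := C_derive f.
have Hf' z : Cmod (z - a) < R -> cderiv f z (f' z).
  by move=> Hz; apply: differentiable_C_derive; apply: Hf; lra.
pose K1 := 8 / R.
have B1 z : Cmod (z - a) < R / 2 -> Cmod (f' z) <= K1.
  move=> Hz.
  have := cauchy_estimate_osc f z (f' z) (R / 2) 2 ltac:(lra) _ (Hf' z ltac:(lra)).
  move=> h; apply: (Rmult_le_reg_r (R / 2)); first lra.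
  have -> : K1 * (R / 2) = 4 by rewrite /K1; field; lra.
  apply: Rle_trans (h _) _; last lra.
  move=> w Hw; have Hwa := ball_triangle a z w _ _ Hz Hw.
  split; first by apply: Hf; lra.
  have -> : (f w - f z = (f w - f a) - (f z - f a))%C by ring.
  apply: Rle_trans (Cmod_tri_sub _ _) _.
  by have := Hd w ltac:(lra); have := Hd z ltac:(lra); lra.
have L1 z w : Cmod (z - a) < R / 2 -> Cmod (w - a) < R / 2 ->
    Cmod (f z - f w) <= K1 * Cmod (z - w).
  apply: (mean_value_convex (fun z => Cmod (z - a) < R / 2) f f'); first exact: cconvex_ball.
  by move=> u Hu; split; [apply: Hf'; lra|apply: B1].
pose K2 := 8 / R * (2 * K1).
have L2 z (h : C) : Cmod (z - a) < R / 8 -> Cmod h < R / 4 ->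
    Cmod (f' (z + h)%C - f' z) <= K2 * Cmod h.
  move=> Hz Hh.
  have nz w : Cmod (w - z) < R / 8 -> Cmod (w - a) < R / 4.
    by move=> Hw; have := ball_triangle a z w _ _ Hz Hw; lra.
  have nzh w : Cmod (w - z) < R / 8 -> Cmod (w + h - a) < R / 2.
    move=> /nz Hw; have -> : (w + h - a = (w - a) + h)%C by ring.
    by have := Cmod_triangle (w - a) h; lra.
  have dq w : Cmod (w - z) < R / 8 ->
      cderiv (fun w => f (w + h) - f w)%C w (f' (w + h)%C - f' w)%C.
    move=> Hw; apply: cderiv_minus; last by apply: Hf'; have := nz w Hw; lra.
    by apply: shift_differentiable; apply: Hf; have := nzh w Hw; lra.
  have := cauchy_estimate (fun w => f (w + h) - f w)%C z _ (R / 8) (K1 * Cmod h) ltac:(lra) _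
    (dq z ltac:(rewrite Cmod_sub0; lra)).
  move=> hh; apply: (Rmult_le_reg_r (R / 8)); first lra.
  have -> : K2 * Cmod h * (R / 8) = 2 * (K1 * Cmod h) by rewrite /K2; field; lra.
  apply: hh => w Hw; split; first by eexists; exact: dq.
  have {2}-> : (h = w + h - w)%C by ring.
  by apply: L1; [exact: nzh|have := nz w Hw; lra].
have K20 : 0 < K2.
  by rewrite /K2 /K1; do !(apply: Rmult_lt_0_compat); try lra; apply: Rinv_0_lt_compat.
have T2 z (h : C) : Cmod (z - a) < R / 8 -> Cmod h < R / 8 ->
    Cmod (f (z + h)%C - f z - f' z * h) <= K2 * Cmod h * Cmod h.
  move=> Hz Hh.
  have -> : (f (z + h)%C - f z - f' z * h =
    (f (z + h)%C - f' z * (z + h)) - (f z - f' z * z))%C by ring.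
  have {2}-> : Cmod h = Cmod (z + h - z) by f_equal; ring.
  apply: (mean_value_convex (fun w => Cmod (w - z) <= Cmod h) (fun w => f w - f' z * w)%C
    (fun w => f' w - f' z)%C); first exact: cconvex_closed_ball.
  - move=> w Hw; split.
      have Hwa := Cmod_tri_dist z w a.
      have := cderiv_minus _ _ _ _ _ (Hf' w ltac:(lra)) (cderiv_cmult (f' z) _ _ _ (cderiv_id w)).
      by apply: cderiv_eq; ring.
    have := L2 z (w - z)%C Hz ltac:(lra).
    have -> : (z + (w - z) = w)%C by ring.
    by move=> h1; apply: Rle_trans h1 _; apply: Rmult_le_compat_l; lra.
  - by have -> : (z + h - z = h)%C by [ring]; lra.
  - by rewrite Cmod_sub0; exact: Cmod_ge_0.
pose Q (h : C) := ((f' (a + h)%C - f' a) / h)%C.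
pose K3 := 16 / R * K2.
have Qc (h k : C) : h <> 0%C -> k <> 0%C -> Cmod h < R / 8 -> Cmod k < R / 8 ->
    Cmod (Q h - Q k) <= K3 * (Cmod h + Cmod k).
  move=> h0 k0 Hh Hk.
  pose q z := ((/ h) * (f (z + h) - f z) - (/ k) * (f (z + k) - f z))%C.
  have dq z : Cmod (z - a) < R / 8 -> cderiv q z
      ((/ h) * (f' (z + h) - f' z) - (/ k) * (f' (z + k) - f' z))%C.
    move=> Hz.
    have nz (u : C) : Cmod u < R / 8 -> Cmod (z + u - a) < R0.
      move=> Hu; have -> : (z + u - a = (z - a) + u)%C by ring.
      by have := Cmod_triangle (z - a) u; lra.
    by apply: cderiv_minus; apply: cderiv_cmult; (apply: cderiv_minus;
      [apply: shift_differentiable; apply: Hf; apply: nz|apply: Hf'; lra]).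
  have one z (u : C) : u <> 0%C -> Cmod u < R / 8 -> Cmod (z - a) < R / 8 ->
      Cmod (/ u * (f (z + u)%C - f z) - f' z) <= K2 * Cmod u.
    move=> u0 Hu Hz; have P := Cmod_pos _ u0.
    have -> : (/ u * (f (z + u)%C - f z) - f' z = (f (z + u)%C - f z - f' z * u) / u)%C by field.
    rewrite Cmod_div //; apply: (Rmult_le_reg_r (Cmod u)) => //.
    have -> : forall x, x / Cmod u * Cmod u = x by move=> x; field; lra.
    exact: T2.
  have -> : (Q h - Q k = (/ h) * (f' (a + h) - f' a) - (/ k) * (f' (a + k) - f' a))%C.
    by rewrite /Q; field.
  have := cauchy_estimate q a _ (R / 8) (K2 * (Cmod h + Cmod k)) ltac:(lra) _
    (dq a ltac:(rewrite Cmod_sub0; lra)).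
  move=> hh; apply: (Rmult_le_reg_r (R / 8)); first lra.
  have -> : K3 * (Cmod h + Cmod k) * (R / 8) = 2 * (K2 * (Cmod h + Cmod k)) by rewrite /K3; field; lra.
  apply: hh => z Hz; split; first by eexists; exact: dq.
  have -> : (q z = ((/ h) * (f (z + h) - f z) - f' z) - ((/ k) * (f (z + k) - f z) - f' z))%C.
    by rewrite /q; ring.
  apply: Rle_trans (Cmod_tri_sub _ _) _.
  by have := one z h h0 Hh Hz; have := one z k k0 Hk Hz; lra.
have K30 : 0 < K3.
  by rewrite /K3; do !(apply: Rmult_lt_0_compat); try lra; apply: Rinv_0_lt_compat.
(* The limit of the difference quotients along one sequence tending to 0. *)
pose hn n := RtoC (R / 16 * / INR (S n)).
have hn_pos n : 0 < R / 16 * / INR (S n).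
  by apply: Rmult_lt_0_compat; [lra|apply: Rinv_0_lt_compat; apply: lt_0_INR; lia].
have Mhn n : Cmod (hn n) = R / 16 * / INR (S n).
  by rewrite /hn Cmod_RtoC_pos //; apply: Rlt_le.
have hn0 n : hn n <> 0%C.
  by move=> E; have := hn_pos n; rewrite -Mhn E Cmod_0; lra.
have hn8 n : Cmod (hn n) < R / 8.
  rewrite Mhn; have : / INR (S n) <= 1; last nra.
  rewrite -Rinv_1; apply: Rinv_le_contravar; first lra.
  by rewrite S_INR; have := pos_INR n; lra.
have hn_small eps : 0 < eps -> exists N, forall n, (N <= n)%nat -> Cmod (hn n) < eps.
  move=> He; have [N HN] := archimed_cor1 (eps / R) (Rdiv_lt_0_compat _ _ He HR).
  exists N => n Hn; rewrite Mhn.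
  have h1 : / INR (S n) <= / INR N.
    by apply: Rinv_le_contravar; [apply: lt_0_INR; lia|apply: le_INR; lia].
  have h2 := Rle_lt_trans _ _ _ h1 (proj1 HN).
  have := Rmult_lt_compat_r R _ _ HR h2; have -> : eps / R * R = eps by field; lra.
  by have := hn_pos n; nra.
have [|l Hl] := C_complete_seq (fun n => Q (hn n)).
  move=> eps He; have [N HN] := hn_small (eps / (2 * K3)) ltac:(apply: Rdiv_lt_0_compat; lra).
  exists N => n p hn1 hp1.
  apply: Rle_lt_trans (Qc _ _ (hn0 n) (hn0 p) (hn8 n) (hn8 p)) _.
  have -> : eps = K3 * (eps / (2 * K3) + eps / (2 * K3)) by field; lra.
  by apply: Rmult_lt_compat_l => //; apply: Rplus_lt_compat; apply: HN.
have Ql (h : C) : h <> 0%C -> Cmod h < R / 8 -> Cmod (Q h - l) <= K3 * Cmod h.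
  move=> h0 Hh; apply: Rnot_lt_le => Hlt.
  set e := Cmod (Q h - l) - K3 * Cmod h in Hlt; have He : 0 < e by rewrite /e; lra.
  have [N1 H1] := hn_small (e / (2 * K3)) ltac:(apply: Rdiv_lt_0_compat; lra).
  have [N2 H2] := Hl (e / 2) ltac:(lra).
  set n := Nat.max N1 N2.
  have a1 := H1 n ltac:(lia); have a2 := H2 n ltac:(lia).
  have a3 := Qc _ _ h0 (hn0 n) Hh (hn8 n).
  have a4 := Cmod_tri_dist (Q (hn n)) (Q h) l.
  have := Rmult_lt_compat_l K3 _ _ K30 a1.
  have -> : K3 * (e / (2 * K3)) = e / 2 by field; lra.
  rewrite /e in a2 *; lra.
exists l => eps He.
exists (Rmin (R / 8) (eps / K3)); split.
  by apply: Rmin_pos; [lra|apply: Rdiv_lt_0_compat].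
move=> w Hw; case: (Ceq_dec w a) => [->|wa].
  have -> : (C_derive f a - C_derive f a - l * (a - a) = 0)%C by ring.
  by rewrite Cmod_0 Cmod_sub0; lra.
set h := (w - a)%C; have h0 : h <> 0%C by apply: Cminus_eq_contra.
have -> : (C_derive f w - C_derive f a - l * h = (Q h - l) * h)%C.
  by rewrite /Q; have -> : (a + h = w)%C by [rewrite /h; ring]; rewrite -/f'; field.
rewrite Cmod_mult; apply: Rmult_le_compat_r; first exact: Cmod_ge_0.
apply: Rle_trans (Ql h h0 (Rlt_le_trans _ _ _ Hw (Rmin_l _ _))) _.
have := Rlt_le_trans _ _ _ Hw (Rmin_r _ _); rewrite -/h => h1.
have := Rmult_lt_compat_l K3 _ _ K30 h1.
by have -> : K3 * (eps / K3) = eps by [field; lra]; lra.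
Qed.

(** * Analytic functions on the unit disk *)

Lemma analyticP f : analytic f <-> forall z, unit_disk z -> differentiable f z.
Proof.
split=> H z Hz; first by exists (C_derive f z); apply: analytic_cderiv.
by have [l Hl] := H z Hz; apply: cderiv_ex_derive Hl.
Qed.

Lemma unit_disk_ball z w : Cmod (w - z) < 1 - Cmod z -> unit_disk w.
Proof. by rewrite /unit_disk => H; have := Cmod_le_add z w; lra. Qed.

Lemma analytic_C_derive f : analytic f -> analytic (C_derive f).
Proof.
move=> /analyticP H; apply/analyticP => z Hz.
apply: (C_derive_differentiable f z (1 - Cmod z)); first by rewrite /unit_disk in Hz; lra.
by move=> w /unit_disk_ball; apply: H.
Qed.

Lemma unit_disk_radius z : unit_disk z -> 0 < 1 - Cmod z.
Proof. by rewrite /unit_disk; lra. Qed.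

Lemma C_derive_local f g z : unit_disk z -> (forall w, unit_disk w -> f w = g w) ->
  differentiable g z -> C_derive f z = C_derive g z.
Proof.
move=> Hz E /differentiable_C_derive H; apply: cderiv_C_derive.
apply: (cderiv_ext_loc g f _ _ (1 - Cmod z)) => //; first exact: unit_disk_radius.
by move=> w /unit_disk_ball /E.
Qed.

(** A gauge [delta] below the reciprocal of the local bound turns a Lebesgue number of
    the square into a global bound. *)
Lemma analytic_bounded f r : analytic f -> r < 1 ->
  exists M, forall z, Cmod z <= r -> Cmod (f z) <= M.
Proof.
move=> Hf Hr.
have Hloc u v : exists d : posreal, forall z, Cmod (z - (u, v)) < 2 * d -> Cmod z <= r ->
    Cmod (f z) <= / d.
  case: (Rle_dec (Cmod (u, v)) r) => Huv; last first.
    have h : 0 < (Cmod (u, v) - r) / 2 by lra.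
    exists (mkposreal _ h) => z /= Hz Hz'; have := Cmod_le_add z (u, v).
    by rewrite Cmod_sub_sym; lra.
  have [l /cderiv_continuous Hl] := proj1 (analyticP f) Hf (u, v) ltac:(rewrite /unit_disk; lra).
  have [d [d0 Hd]] := Hl 1 Rlt_0_1.
  have P := Cmod_ge_0 (f (u, v)).
  have e0 : 0 < / (Cmod (f (u, v)) + 1) by apply: Rinv_0_lt_compat; lra.
  have h : 0 < Rmin (d / 2) (/ (Cmod (f (u, v)) + 1)) by apply: Rmin_pos; lra.
  exists (mkposreal _ h) => z /= Hz _.
  have h1 := Hd z; have h2 := Rmin_l (d / 2) (/ (Cmod (f (u, v)) + 1)).
  apply: (Rle_trans _ (Cmod (f (u, v)) + 1)).
    by have := Cmod_le_add (f (u, v)) (f z); have := h1 ltac:(lra); lra.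
  rewrite -{1}(Rinv_inv (Cmod (f (u, v)) + 1)).
  by apply: Rinv_le_contravar => //; exact: Rmin_r.
pose delta u v := proj1_sig (constructive_indefinite_description _ (Hloc u v)).
have Hdelta u v : forall z, Cmod (z - (u, v)) < 2 * delta u v -> Cmod z <= r ->
    Cmod (f z) <= / delta u v.
  exact: (proj2_sig (constructive_indefinite_description _ (Hloc u v))).
have [d Hd] := compactness_value_2d (-1) 1 (-1) 1 delta.
exists (/ d) => z Hz; apply: NNPP => Hn.
have inI x : Rabs x <= Cmod z -> -1 <= x <= 1 by move=> h; have := Rle_abs x; have := Rle_abs (- x); rewrite Rabs_Ropp; lra.
apply: (Hd (Re z) (Im z) (inI _ (re_abs_le z)) (inI _ (im_abs_le z))).
move=> [u [v [_ [_ [h1 [h2 h3]]]]]]; apply: Hn.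
apply: Rle_trans (Hdelta u v z _ Hz) _; last first.
  by apply: Rinv_le_contravar h3; apply: cond_pos.
have -> : (z - (u, v) = RtoC (Re z - u) + Ci * RtoC (Im z - v))%C.
  by apply: injective_projections; rewrite /= /Re /Im; ring.
by apply: Rle_lt_trans (Cmod_triangle _ _) _; rewrite Cmod_mult Cmod_Ci Rmult_1_l !Cmod_R; lra.
Qed.

Lemma analytic_primitive f : analytic f ->
  exists F, analytic F /\ forall z, unit_disk z -> C_derive F z = f z.
Proof.
move=> /analyticP Hf.
have [|||F HF] := primitive_exists unit_disk 0%C f => //.
- move=> z Hz; exists (1 - Cmod z); split; first exact: unit_disk_radius.
  by move=> w; apply: unit_disk_ball.
- move=> z w Hz [/between_cases /= h1 /between_cases /= h2].
  have sq x y : 0 <= x <= y \/ y <= x <= 0 -> x ^ 2 <= y ^ 2 by nra.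
  have : Cmod w ^ 2 <= Cmod z ^ 2.
    by rewrite !Cmod2_alt; apply: Rplus_le_compat; apply: sq; [exact: h1|exact: h2].
  rewrite /unit_disk in Hz *; have := Cmod_ge_0 w; have := Cmod_ge_0 z; nra.
exists F; split; first by apply/analyticP => z Hz; exists (f z); apply: HF.
by move=> z Hz; apply: cderiv_C_derive; apply: HF.
Qed.

Lemma cconvex_unit_disk : cconvex unit_disk.
Proof.
move=> u v t Hu Hv Ht; have := cconvex_ball 0%C 1 u v t.
have E w : (w - 0 = w)%C by ring.
by rewrite !E; apply.
Qed.

Lemma unit_disk_0 : unit_disk 0%C.
Proof. by rewrite /unit_disk Cmod_0; exact: Rlt_0_1. Qed.

(** The primitive [L] of the logarithmic derivative makes [f * Cexp (- L)] constant. *)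
Lemma analytic_log f : analytic f -> (forall z, unit_disk z -> f z <> 0%C) ->
  exists L, [/\ analytic L, forall z, unit_disk z -> C_derive L z = (C_derive f z / f z)%C
    & forall z, unit_disk z -> f z = Cexp (L z)].
Proof.
move=> Hf f0; have Hf' := analytic_C_derive f Hf.
have HQ : analytic (fun z => C_derive f z / f z)%C.
  apply/analyticP => z Hz; eexists; apply: cderiv_div; first exact: f0.
    exact: analytic_cderiv.
  exact: analytic_cderiv.
have [L [HL EL]] := analytic_primitive _ HQ.
have Econst z : unit_disk z -> (f z * Cexp (- L z) = f 0 * Cexp (- L 0))%C.
  move=> Hz; apply: Cmod_zero_eq; apply: (Rle_trans _ (0 * Cmod (z - 0))); last lra.
  apply: (mean_value_convex unit_disk (fun z => f z * Cexp (- L z))%C (fun _ => 0%C)) => //.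
  - exact: cconvex_unit_disk.
  - move=> w Hw; rewrite Cmod_0; split; last exact: Rle_refl.
    have hL := analytic_cderiv _ HL _ Hw.
    have := cderiv_mult _ _ _ _ _ (analytic_cderiv _ Hf _ Hw)
      (cderiv_comp Cexp _ _ _ _ (cderiv_opp _ _ _ hL) (cderiv_Cexp _)).
    by apply: cderiv_eq; rewrite EL //; field; apply: f0.
  - exact: unit_disk_0.
have [l El] := Cexp_surj (f 0 * Cexp (- L 0))%C
  (Cmult_neq_0 _ _ (f0 _ unit_disk_0) (Cexp_neq0 _)).
have dL z : unit_disk z -> cderiv (fun z => L z + l)%C z (C_derive L z).
  move=> Hz; have := cderiv_plus _ _ _ _ _ (analytic_cderiv _ HL _ Hz) (cderiv_const l z).
  by apply: cderiv_eq; ring.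
exists (fun z => L z + l)%C; split.
- by apply/analyticP => z Hz; eexists; exact: dL.
- by move=> z Hz; rewrite (cderiv_C_derive _ _ _ (dL z Hz)) EL.
- move=> z Hz; rewrite Cexp_plus -El -(Econst z Hz) Cexp_opp.
  by field; apply: Cexp_neq0.
Qed.

(** * The Schwarz-Pick inequality and its consequences *)

Lemma Cmod_one_sub_conj (a b : C) :
  Cmod (1 - Cconj a * b) ^ 2 - Cmod (b - a) ^ 2 = (1 - Cmod a ^ 2) * (1 - Cmod b ^ 2).
Proof.
rewrite !Cmod2_alt; case: a => a1 a2; case: b => b1 b2.
by rewrite /= /Re /Im /=; ring.
Qed.

Lemma Cmod_lt_one_sub_conj (a b : C) : Cmod a < 1 -> Cmod b < 1 ->
  Cmod (b - a) < Cmod (1 - Cconj a * b).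
Proof.
move=> Ha Hb; have := Cmod_one_sub_conj a b.
have := Cmod_ge_0 a; have := Cmod_ge_0 b; have := Cmod_ge_0 (b - a).
have := Cmod_ge_0 (1 - Cconj a * b) => p1 p2 p3 p4 E.
have : 0 < (1 - Cmod a ^ 2) * (1 - Cmod b ^ 2) by apply: Rmult_lt_0_compat; nra.
nra.
Qed.

Lemma one_sub_conj_neq0 (a b : C) : Cmod a < 1 -> Cmod b < 1 -> (1 - Cconj a * b <> 0)%C.
Proof.
move=> Ha Hb E; have := Cmod_lt_one_sub_conj a b Ha Hb; rewrite E Cmod_0.
by have := Cmod_ge_0 (b - a); lra.
Qed.

Lemma Cconj_mul_self (a : C) : (Cconj a * a)%C = RtoC (Cmod a ^ 2).
Proof. by rewrite Cmod2_conj; ring. Qed.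

Definition disk_valued_on_ball (om : C -> C) (a : C) (R : R) : Prop :=
  forall z, Cmod (z - a) < R -> differentiable om z /\ Cmod (om z) < 1.

(** The composition of [om] with the automorphism of the disk that sends [om a] to 0. *)
Definition recentred (om : C -> C) (a z : C) : C :=
  ((om z - om a) / (1 - Cconj (om a) * om z))%C.

Lemma recentred_facts om (a z : C) R : 0 < R -> disk_valued_on_ball om a R ->
  Cmod (z - a) < R ->
  cderiv (recentred om a) z
    (C_derive om z * RtoC (1 - Cmod (om a) ^ 2) / (1 - Cconj (om a) * om z) ^ 2)%C /\
  Cmod (recentred om a z) <= 1.
Proof.
move=> R0 H Hz; have [dz bz] := H z Hz.
have [_ ba] := H a ltac:(rewrite Cmod_sub0; lra).
have n0 := one_sub_conj_neq0 _ _ ba bz.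
split; last first.
  rewrite /recentred Cmod_div //; apply: (Rmult_le_reg_r (Cmod (1 - Cconj (om a) * om z))).
    exact: Cmod_pos.
  have := Cmod_lt_one_sub_conj _ _ ba bz; have := Cmod_pos _ n0 => p q.
  have -> : forall x y, 0 < y -> x / y * y = x by move=> x y hy; field; lra.
    by lra.
  by [].
have d1 := differentiable_C_derive _ _ dz.
have := cderiv_div (fun w => om w - om a)%C (fun w => 1 - Cconj (om a) * om w)%C _ _ _ n0 (cderiv_minus _ _ _ _ _ d1 (cderiv_const (om a) z))
  (cderiv_minus _ _ _ _ _ (cderiv_const 1 z) (cderiv_cmult (Cconj (om a)) _ _ _ d1)).
by apply: cderiv_eq; rewrite RtoC_minus -Cconj_mul_self; field.
Qed.

Lemma one_sub_sq_pos x : 0 <= x < 1 -> 0 < 1 - x ^ 2.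
Proof. by nra. Qed.

(** The Cauchy estimate for the recentred map; its derivative at [a] is that of [om]
    divided by [1 - Cmod (om a) ^ 2]. *)
Lemma schwarz_pick om (a : C) R : 0 < R -> disk_valued_on_ball om a R ->
  Cmod (C_derive om a) * R <= 1 - Cmod (om a) ^ 2.
Proof.
move=> R0 H; have Ha : Cmod (a - a) < R by rewrite Cmod_sub0.
have [_ ba] := H a Ha; have D0 := one_sub_sq_pos _ (conj (Cmod_ge_0 _) ba).
have D0C : RtoC (1 - Cmod (om a) ^ 2) <> 0%C by move=> /RtoC_inj; lra.
have [da _] := recentred_facts om a a R R0 H Ha.
have := cauchy_estimate_center (recentred om a) a _ R 1 R0 _ _ da.
have -> : (C_derive om a * RtoC (1 - Cmod (om a) ^ 2) / (1 - Cconj (om a) * om a) ^ 2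
    = C_derive om a / RtoC (1 - Cmod (om a) ^ 2))%C.
  by rewrite Cconj_mul_self -RtoC_minus; field.
rewrite Cmod_div // (Cmod_RtoC_pos _ (Rlt_le _ _ D0)) => h.
have {}h : Cmod (C_derive om a) / (1 - Cmod (om a) ^ 2) * R <= 1.
  apply: h.
    move=> z Hz; have [d1 b1] := recentred_facts om a z R R0 H Hz.
    by split=> //; eexists; exact: d1.
  rewrite /recentred; have := one_sub_conj_neq0 _ _ ba ba.
  have -> : (om a - om a = 0)%C by ring.
  by move=> ?; field.
have := Rmult_le_compat_l _ _ _ (Rlt_le _ _ D0) h.
have -> : (1 - Cmod (om a) ^ 2) * (Cmod (C_derive om a) / (1 - Cmod (om a) ^ 2) * R) =
  Cmod (C_derive om a) * R by field; lra.
lra.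
Qed.

(** Near [a] a disk-valued map moves at most in proportion to the distance of its value
    from the unit circle. *)
Lemma disk_valued_osc om (a z : C) R : 0 < R -> disk_valued_on_ball om a R ->
  Cmod (z - a) <= R / 8 ->
  Cmod (om z - om a) <= 8 * (Cmod (z - a) / R) * (1 - Cmod (om a) ^ 2).
Proof.
move=> R0 H Hz; have Ha : Cmod (a - a) < R by rewrite Cmod_sub0.
have [_ ba] := H a Ha; have [_ bz] := H z ltac:(lra).
have n0 := one_sub_conj_neq0 _ _ ba bz.
set D := 1 - Cmod (om a) ^ 2.
have D0 : 0 < D := one_sub_sq_pos _ (conj (Cmod_ge_0 _) ba).
set phi := recentred om a.
have phia : phi a = 0%C.
  rewrite /phi /recentred; have := one_sub_conj_neq0 _ _ ba ba.
  have -> : (om a - om a = 0)%C by ring.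
  by move=> ?; field.
have Lphi : Cmod (phi z) <= 4 / R * Cmod (z - a).
  have -> : phi z = (phi z - phi a)%C by rewrite phia; ring.
  apply: (mean_value_convex (fun w => Cmod (w - a) < R / 2) phi
    (fun w => C_derive om w * RtoC (1 - Cmod (om a) ^ 2) / (1 - Cconj (om a) * om w) ^ 2)%C).
  - exact: cconvex_ball.
  - move=> w Hw; have [d1 _] := recentred_facts om a w R R0 H ltac:(lra); split=> //.
    have h := cauchy_estimate phi w _ (R / 2) 1 ltac:(lra) _ d1.
    apply: (Rmult_le_reg_r (R / 2)); first lra.
    have -> : 4 / R * (R / 2) = 2 * 1 by field; lra.
    apply: h => v Hv; have := ball_triangle _ _ _ _ _ Hw Hv => Hva.
    have [d2 b2] := recentred_facts om a v R R0 H ltac:(lra).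
    by split=> //; eexists; exact: d2.
  - by lra.
  - by rewrite Cmod_sub0; lra.
set x := Cmod (z - a) / R.
have Ex : 4 / R * Cmod (z - a) = 4 * x by rewrite /x; field; lra.
have x8 : x <= / 8.
  apply: (Rmult_le_reg_r R) => //; rewrite /x.
  by have -> : Cmod (z - a) / R * R = Cmod (z - a) by [field; lra]; lra.
have x0 : 0 <= x by apply: Rmult_le_pos; [exact: Cmod_ge_0|apply: Rlt_le; exact: Rinv_0_lt_compat].
rewrite Ex in Lphi.
set e := Cmod (om z - om a).
have He : e <= 4 * x * (D + e).
  have E : e = Cmod (phi z) * Cmod (1 - Cconj (om a) * om z).
    by rewrite -Cmod_mult /e /phi /recentred; f_equal; field.
  rewrite {1}E.
  apply: Rmult_le_compat => //; try exact: Cmod_ge_0.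
  have -> : (1 - Cconj (om a) * om z = RtoC D - Cconj (om a) * (om z - om a))%C.
    by rewrite /D RtoC_minus -Cconj_mul_self; ring.
  apply: Rle_trans (Cmod_tri_sub _ _) _.
  rewrite Cmod_mult Cmod_conj (Cmod_RtoC_pos _ (Rlt_le _ _ D0)).
  have := Cmod_ge_0 (om z - om a); rewrite -/e => e0; nra.
have e0 : 0 <= e := Cmod_ge_0 _.
have : 4 * x * e <= / 2 * e by apply: Rmult_le_compat_r; lra.
lra.
Qed.

(** The Cauchy estimate for the oscillation just bounded. *)
Lemma disk_valued_derive om (a z : C) R : 0 < R -> disk_valued_on_ball om a R ->
  Cmod (z - a) <= R / 16 ->
  Cmod (C_derive om z) <= 32 / R * (1 - Cmod (om a) ^ 2).
Proof.
move=> R0 H Hz; have Ha : Cmod (a - a) < R by rewrite Cmod_sub0.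
have [_ ba] := H a Ha; set D := 1 - Cmod (om a) ^ 2.
have D0 : 0 < D := one_sub_sq_pos _ (conj (Cmod_ge_0 _) ba).
have osc w : Cmod (w - a) <= R / 8 -> Cmod (om w - om a) <= D.
  move=> Hw; apply: Rle_trans (disk_valued_osc _ _ _ _ R0 H Hw) _; rewrite -/D.
  have : Cmod (w - a) / R <= / 8; last nra.
  apply: (Rmult_le_reg_r R) => //.
  by have -> : Cmod (w - a) / R * R = Cmod (w - a) by [field; lra]; lra.
have [dz _] := H z ltac:(lra).
have h := cauchy_estimate_osc om z (C_derive om z) (R / 16) (2 * D) ltac:(lra) _
  (differentiable_C_derive _ _ dz).
apply: (Rmult_le_reg_r (R / 16)); first lra.
have -> : 32 / R * D * (R / 16) = 2 * D by field; lra.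
apply: h => w Hw; have Hwa := Cmod_tri_dist z w a.
split; first by case: (H w ltac:(lra)).
have -> : (om w - om z = (om w - om a) - (om z - om a))%C by ring.
apply: Rle_trans (Cmod_tri_sub _ _) _.
by have := osc w ltac:(lra); have := osc z ltac:(lra); lra.
Qed.

Lemma disk_valued_derive2 om (a : C) R : 0 < R -> disk_valued_on_ball om a R ->
  Cmod (C_derive (C_derive om) a) <= 1024 / (R * R) * (1 - Cmod (om a) ^ 2).
Proof.
move=> R0 H; set D := 1 - Cmod (om a) ^ 2.
have d2 z : Cmod (z - a) < R / 16 -> differentiable (C_derive om) z.
  move=> Hz; apply: (C_derive_differentiable om z (R / 16)); first lra.
  by move=> w Hw; have := ball_triangle _ _ _ _ _ Hz Hw => Hwa; case: (H w ltac:(lra)).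
have h := cauchy_estimate (C_derive om) a _ (R / 16) (32 / R * D) ltac:(lra) _
  (differentiable_C_derive _ _ (d2 a ltac:(rewrite Cmod_sub0; lra))).
apply: (Rmult_le_reg_r (R / 16)); first lra.
have -> : 1024 / (R * R) * D * (R / 16) = 2 * (32 / R * D) by field; lra.
apply: h => z Hz; split; first exact: d2.
by apply: disk_valued_derive => //; lra.
Qed.

(** * Quantitative local inversion *)

(** On [A] the map is a similarity of ratio [Cmod c] up to half of that ratio; [T] need
    not be complex differentiable. *)
Definition nearly_linear (T : C -> C) (c : C) (A : C -> Prop) : Prop :=
  forall z w, A z -> A w -> Cmod (T z - T w - c * (z - w)) <= Cmod c / 2 * Cmod (z - w).

Lemma nearly_linear_univalent T (c : C) A : c <> 0%C -> nearly_linear T c A -> univalent_on A T.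
Proof.
move=> c0 H z w Hz Hw E; apply: Cmod_zero_eq.
have := H z w Hz Hw; rewrite E.
have -> : (T w - T w - c * (z - w) = - (c * (z - w)))%C by ring.
rewrite Cmod_opp Cmod_mult; have := Cmod_pos _ c0; have := Cmod_ge_0 (z - w); nra.
Qed.

Lemma nearly_linear_subset T (c : C) A B : (forall z, B z -> A z) ->
  nearly_linear T c A -> nearly_linear T c B.
Proof. by move=> HS H z w /HS Hz /HS Hw; apply: H. Qed.

(** The simplified Newton iteration [z - (T z - y) / c] contracts by the factor 1/2. *)
Lemma nearly_linear_surj T (c a y : C) s : c <> 0%C ->
  nearly_linear T c (fun z => Cmod (z - a) < s) -> Cmod (y - T a) < Cmod c * s / 2 ->
  exists z, Cmod (z - a) < s /\ T z = y.
Proof.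
move=> c0 H Hy; have Pc := Cmod_pos _ c0.
pose N z := (z - (T z - y) / c)%C.
pose u := nat_rect (fun _ => C) a (fun _ z => N z).
set d := Cmod (y - T a) / Cmod c.
have d0 : 0 <= d by apply: Rmult_le_pos; [exact: Cmod_ge_0|apply: Rlt_le; exact: Rinv_0_lt_compat].
have ds : 2 * d < s.
  apply: (Rmult_lt_reg_r (Cmod c)) => //; rewrite /d.
  have -> : 2 * (Cmod (y - T a) / Cmod c) * Cmod c = 2 * Cmod (y - T a) by field; lra.
  lra.
have hp n : 0 < / 2 ^ n by apply: Rinv_0_lt_compat; apply: pow_lt; lra.
have half n : / 2 ^ S n = / 2 ^ n / 2 by rewrite /=; field; apply: pow_nonzero; lra.
have inv n : Cmod (u (S n) - u n) <= d * / 2 ^ n /\ Cmod (u n - a) <= 2 * d * (1 - / 2 ^ n).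
  elim: n => [|n [IH1 IH2]].
    rewrite /= Cmod_sub0 Rinv_1; split; last lra.
    rewrite /N; have -> : (a - (T a - y) / c - a = (y - T a) / c)%C by field.
    by rewrite Cmod_div // /d; lra.
  have h2 : Cmod (u (S n) - a) <= 2 * d * (1 - / 2 ^ S n).
    by rewrite half; have := Cmod_tri_dist (u n) (u (S n)) a; lra.
  split=> //.
  have b1 : Cmod (u (S n) - a) < s by have := hp (S n); nra.
  have b0 : Cmod (u n - a) < s by have := hp n; nra.
  have -> : (u (S (S n)) - u (S n) =
     - ((T (u (S n)) - T (u n) - c * (u (S n) - u n)) / c))%C.
    by rewrite /= -/(u n) /N; field.
  rewrite Cmod_opp Cmod_div //; apply: (Rmult_le_reg_r (Cmod c)) => //.
  have -> : forall x, x / Cmod c * Cmod c = x by move=> x; field; lra.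
  apply: Rle_trans (H _ _ b1 b0) _; rewrite half.
  have := Rmult_le_compat_l _ _ _ (Rlt_le _ _ Pc) IH1; lra.
have far n k : Cmod (u (n + k)%nat - u n) <= 2 * d * / 2 ^ n.
  suff : Cmod (u (n + k)%nat - u n) <= 2 * d * (/ 2 ^ n - / 2 ^ (n + k)).
    by have := hp (n + k)%nat; nra.
  elim: k => [|k IH]; first by rewrite Nat.add_0_r Cmod_sub0; lra.
  rewrite Nat.add_succ_r half.
  have := Cmod_tri_dist (u (n + k)%nat) (u (S (n + k))) (u n).
  by have [h _] := inv (n + k)%nat; lra.
have small eps : 0 < eps -> exists M, forall n, (M <= n)%nat -> 2 * d * / 2 ^ n < eps.
  move=> He.
  have [M HM] := pow_lt_1_zero (/ 2) ltac:(rewrite Rabs_pos_eq; lra) (eps / (2 * d + 1))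
    ltac:(apply: Rdiv_lt_0_compat; lra).
  exists M => n Hn; have := HM n Hn; rewrite pow_inv Rabs_pos_eq; last exact: Rlt_le.
  move=> /(Rmult_lt_compat_r (2 * d + 1) _ _ ltac:(lra)).
  have -> : eps / (2 * d + 1) * (2 * d + 1) = eps by field; lra.
  by have := hp n; nra.
have [|z Hz] := C_complete_seq u.
  move=> eps He; have [M HM] := small (eps / 2) ltac:(lra).
  exists M => n p hn hp'.
  have E k : (M <= k)%nat -> Cmod (u k - u M) < eps / 2.
    move=> hk; have -> : k = (M + (k - M))%nat by lia.
    by apply: Rle_lt_trans (far _ _) (HM M (Nat.le_refl _)).
  have := Cmod_tri_dist (u M) (u n) (u p); rewrite (Cmod_sub_sym (u M)).
  by have := E n hn; have := E p hp'; lra.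
have za : Cmod (z - a) <= 2 * d.
  apply: Rnot_lt_le => h; have [M HM] := Hz (Cmod (z - a) - 2 * d) ltac:(lra).
  have := HM M (Nat.le_refl _); have := Cmod_tri_dist (u M) z a; rewrite (Cmod_sub_sym z (u M)).
  by have [_ h2] := inv M; have := hp M; nra.
have zs : Cmod (z - a) < s by lra.
exists z; split=> //; apply: Cmod_zero_eq; apply: Rnot_lt_le => h.
set e := Cmod (T z - y) in h.
have [M1 H1] := small (e / (4 * Cmod c)) ltac:(apply: Rdiv_lt_0_compat; lra).
have [M2 H2] := Hz (e / (4 * Cmod c)) ltac:(apply: Rdiv_lt_0_compat; lra).
set n := Nat.max M1 M2.
have a1 := H1 n ltac:(lia); have a2 := H2 n ltac:(lia).
have [i1 i2] := inv n.
have b0 : Cmod (u n - a) < s by have := hp n; nra.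
have e1 : (T (u n) - y = - (c * (u (S n) - u n)))%C by rewrite /= -/(u n) /N; field.
have e2 : Cmod (T (u n) - y) <= Cmod c * (e / (4 * Cmod c)).
  rewrite e1 Cmod_opp Cmod_mult; apply: Rmult_le_compat_l; first lra.
  by have := hp n; nra.
have e3 := H z (u n) zs b0; rewrite (Cmod_sub_sym z (u n)) in e3.
have e4 : Cmod (T z - T (u n)) <= 3 / 2 * Cmod c * Cmod (u n - z).
  have := Cmod_le_add (c * (z - u n)) (T z - T (u n)).
  by rewrite Cmod_mult (Cmod_sub_sym z (u n)); lra.
have e5 := Rmult_lt_compat_l _ _ _ Pc a2.
have e6 : Cmod c * (e / (4 * Cmod c)) = e / 4 by field; lra.
by have := Cmod_tri_dist (T (u n)) (T z) y; rewrite -/e; lra.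
Qed.

(** A ball is strictly convex: around the point dividing a chord of length [L] in ratio
    [t : 1 - t] it leaves room of order [t * (1 - t) * L ^ 2]. A map with small second
    differences misses the corresponding point of the image chord by less than that, so
    local inversion recovers it. *)
Lemma nearly_linear_convex_image T (c o x y : C) r M t : c <> 0%C -> 0 < r ->
  nearly_linear T c (fun z => Cmod (z - o) < r) -> 4 * M * r < Cmod c ->
  Cmod (T x + RtoC t * (T y - T x) - T (x + RtoC t * (y - x))%C)
    <= M * (t * (1 - t)) * Cmod (x - y) ^ 2 ->
  Cmod (x - o) < r -> Cmod (y - o) < r -> 0 <= t <= 1 ->
  exists z, Cmod (z - o) < r /\ T z = (T x + RtoC t * (T y - T x))%C.
Proof.
move=> c0 r0 HT HM Hsec Hx Hy Ht.
set m := (x + RtoC t * (y - x))%C in Hsec *.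
set k := t * (1 - t); have k0 : 0 <= k by apply: Rmult_le_pos; lra.
have Emid : Cmod (m - o) ^ 2 + k * Cmod (x - y) ^ 2 =
    (1 - t) * Cmod (x - o) ^ 2 + t * Cmod (y - o) ^ 2.
  rewrite !Cmod2_alt /m /k; case: x {Hx HM Hsec m} => x1 x2; case: y {Hy} => y1 y2.
  by case: o {HT} => o1 o2; rewrite /= /Re /Im /=; ring.
case: (Rle_lt_or_eq_dec 0 (k * Cmod (x - y) ^ 2)) => [| Hpos | Hzero].
- by apply: Rmult_le_pos => //; exact: pow2_ge_0.
- (* The room left around the dividing point by the strict convexity of the ball. *)
  set eta := k * Cmod (x - y) ^ 2 / (2 * r).
  have eta0 : 0 < eta by apply: Rdiv_lt_0_compat; lra.
  have Eeta : k * Cmod (x - y) ^ 2 = 2 * r * eta by rewrite /eta; field; lra.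
  have Pm := Cmod_ge_0 (m - o); have Px := Cmod_ge_0 (x - o); have Py := Cmod_ge_0 (y - o).
  have sx : Cmod (x - o) ^ 2 <= r ^ 2 by nra.
  have sy : Cmod (y - o) ^ 2 <= r ^ 2 by nra.
  have hm : Cmod (m - o) ^ 2 <= r ^ 2 - 2 * r * eta by nra.
  have er : eta <= r by nra.
  have hm2 : Cmod (m - o) <= r - eta by nra.
  have sub z : Cmod (z - m) < eta -> Cmod (z - o) < r.
    by move=> Hz; have := Cmod_tri_dist m z o; lra.
  have [|z [h1 h2]] := nearly_linear_surj T c m (T x + RtoC t * (T y - T x))%C eta c0
      (nearly_linear_subset _ _ _ _ sub HT).
    apply: Rle_lt_trans Hsec _; rewrite -/k Rmult_assoc Eeta; nra.
  by exists z; split=> //; apply: sub.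
(* Degenerate chords: the dividing point is an end point and the error is 0. *)
- have Em : m = x \/ m = y.
    have [kz|xy] : k = 0 \/ x = y.
      case: (Req_dec k 0) => [|kn]; [by left|right].
      have : Cmod (x - y) ^ 2 = 0 by have := pow2_ge_0 (Cmod (x - y)); nra.
      by have := Cmod_ge_0 (x - y) => h1 h2; apply: Cmod_zero_eq; nra.
    - have [Et|Et] : t = 0 \/ t = 1 by rewrite /k in kz; have := Rmult_integral _ _ kz; lra.
      + by left; rewrite /m Et; ring.
      + by right; rewrite /m Et; ring.
    - by left; rewrite /m xy; ring.
  exists m; split; first by case: Em => ->.
  move: Hsec; rewrite -/k Rmult_assoc -Hzero Rmult_0_r.
  by rewrite Cmod_sub_sym; apply: Cmod_zero_eq.
Qed.

(** * Harmonic maps in the disk *)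

Definition harmonic_map (h g : C -> C) (z : C) : C := (h z + Cconj (g z))%C.

Definition analytic_preSchwarzian (h : C -> C) (z : C) : C :=
  (C_derive (C_derive h) z / C_derive h z)%C.

(** The weight [1 - Cmod z] is within a factor 2 of [1 - Cmod z ^ 2], and it is the
    distance to the unit circle. *)
Definition finite_preSchwarzian (h : C -> C) : Prop :=
  exists K, forall z, unit_disk z -> (1 - Cmod z) * Cmod (analytic_preSchwarzian h z) <= K.

Lemma analytic_preSchwarzian_analytic h : analytic h ->
  (forall z, unit_disk z -> C_derive h z <> 0%C) -> analytic (analytic_preSchwarzian h).
Proof.
move=> Hh h0; apply/analyticP => z Hz; eexists; apply: cderiv_div (h0 z Hz) _ _.
  by apply: analytic_cderiv => //; do 2 apply: analytic_C_derive.
by apply: analytic_cderiv => //; apply: analytic_C_derive.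
Qed.

Lemma sense_preserving_facts h g : sense_preserving_harmonic h g ->
  [/\ analytic h, analytic g, forall z, unit_disk z -> C_derive h z <> 0%C,
      forall z, unit_disk z ->
        differentiable (dilatation h g) z /\ Cmod (dilatation h g z) < 1
    & forall z, unit_disk z -> C_derive g z = (dilatation h g z * C_derive h z)%C].
Proof.
move=> [Hh [Hg [_ Hlt]]].
have h0 z : unit_disk z -> C_derive h z <> 0%C.
  by move=> /Hlt H E; move: H; rewrite E Cmod_0; have := Cmod_ge_0 (C_derive g z); lra.
split=> // z Hz.
  split.
    by eexists; apply: cderiv_div (h0 z Hz) (analytic_cderiv _ (analytic_C_derive _ Hg) _ Hz)
      (analytic_cderiv _ (analytic_C_derive _ Hh) _ Hz).
  have P := Cmod_pos _ (h0 z Hz).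
  rewrite /dilatation Cmod_div; last exact: h0.
  apply: (Rmult_lt_reg_r (Cmod (C_derive h z))) => //.
  have -> : forall x, x / Cmod (C_derive h z) * Cmod (C_derive h z) = x by move=> x; field; lra.
  by rewrite Rmult_1_l; apply: Hlt.
by rewrite /dilatation; field; apply: h0.
Qed.

Lemma dilatation_disk_valued h g (a : C) : sense_preserving_harmonic h g ->
  disk_valued_on_ball (dilatation h g) a (1 - Cmod a).
Proof. by move=> /sense_preserving_facts [_ _ _ H _] z /unit_disk_ball; apply: H. Qed.

(** ** Affine normalization *)

(** For [Cmod th < 1] this is an invertible real linear map; near [Cmod th = 1] its inverse
    is large. *)
Definition stretch (th v : C) : C := (v + th * Cconj v)%C.

Definition unstretch (th v : C) : C := ((v - th * Cconj v) / RtoC (1 - Cmod th ^ 2))%C.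

Lemma one_sub_sq_neq0 (th : C) : Cmod th < 1 -> RtoC (1 - Cmod th ^ 2) <> 0%C.
Proof.
move=> H /RtoC_inj; have := one_sub_sq_pos _ (conj (Cmod_ge_0 th) H); lra.
Qed.

Lemma stretch_unstretch th v : Cmod th < 1 -> stretch th (unstretch th v) = v.
Proof.
move=> H; have n0 := one_sub_sq_neq0 th H; rewrite /stretch /unstretch.
rewrite Cdiv_conj // Cminus_conj Cmult_conj Cconj_conj.
have -> : Cconj (RtoC (1 - Cmod th ^ 2)) = RtoC (1 - Cmod th ^ 2).
  by apply: injective_projections => /=; ring.
move: n0; rewrite RtoC_minus -Cconj_mul_self => n0; field => //.
Qed.

Lemma unstretch_stretch th v : Cmod th < 1 -> unstretch th (stretch th v) = v.
Proof.
move=> H; have n0 := one_sub_sq_neq0 th H; rewrite /stretch /unstretch.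
rewrite Cplus_conj Cmult_conj Cconj_conj.
by move: n0; rewrite RtoC_minus -Cconj_mul_self => n0; field.
Qed.

Lemma unstretch_lin th (u v : C) (t : R) :
  unstretch th (u + RtoC t * v)%C = (unstretch th u + RtoC t * unstretch th v)%C.
Proof.
rewrite /unstretch /Cdiv Cplus_conj Cmult_conj.
have -> : Cconj (RtoC t) = RtoC t by apply: injective_projections => /=; ring.
ring.
Qed.

Lemma stretch_lin th (u v : C) (t : R) :
  stretch th (u + RtoC t * v)%C = (stretch th u + RtoC t * stretch th v)%C.
Proof.
rewrite /stretch Cplus_conj Cmult_conj.
have -> : Cconj (RtoC t) = RtoC t by apply: injective_projections => /=; ring.
ring.
Qed.

Lemma unstretch_sub th (u v : C) :
  unstretch th (u - v)%C = (unstretch th u - unstretch th v)%C.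
Proof.
have -> : (u - v = u + RtoC (-1) * v)%C by ring.
by rewrite unstretch_lin; ring.
Qed.

Lemma Cmod_unstretch th v : Cmod th < 1 -> Cmod (unstretch th v) * (1 - Cmod th) <= Cmod v.
Proof.
move=> H; have P := Cmod_ge_0 th; have D0 := one_sub_sq_pos _ (conj P H).
rewrite /unstretch Cmod_div; last exact: one_sub_sq_neq0.
rewrite Cmod_RtoC_pos; last lra.
have := Cmod_tri_sub v (th * Cconj v); rewrite Cmod_mult Cmod_conj => h.
apply: (Rmult_le_reg_r (1 + Cmod th)); first lra.
have -> : Cmod (v - th * Cconj v) / (1 - Cmod th ^ 2) * (1 - Cmod th) * (1 + Cmod th) =
  Cmod (v - th * Cconj v) by field; lra.
lra.
Qed.

(** The differential of [h + Cconj g] at [a] is the multiplication by [C_derive h a]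
    followed by a stretch, whose distortion is unbounded as the dilatation at [a]
    approaches the unit circle. Undoing that stretch leaves a small perturbation of [h],
    uniformly in [a]; univalence and convexity are not affected. *)
Definition normalized (h g : C -> C) (a z : C) : C :=
  unstretch (Cconj (dilatation h g a)) (harmonic_map h g z).

(** The part of [g] which is not accounted for by the stretch; its derivative vanishes at
    [a]. *)
Definition normalization_defect (h g : C -> C) (a z : C) : C :=
  (g z - dilatation h g a * h z)%C.

Lemma normalizedE h g (a z : C) : Cmod (dilatation h g a) < 1 ->
  normalized h g a z =
  (h z + unstretch (Cconj (dilatation h g a)) (Cconj (normalization_defect h g a z)))%C.
Proof.
move=> H; set th := Cconj (dilatation h g a).
have Hth : Cmod th < 1 by rewrite Cmod_conj.
have E : harmonic_map h g z = (stretch th (h z) + RtoC 1 * Cconj (normalization_defect h g a z))%C.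
  by rewrite /harmonic_map /stretch /normalization_defect Cminus_conj Cmult_conj -/th; ring.
by rewrite /normalized -/th E unstretch_lin unstretch_stretch //; ring.
Qed.

Lemma stretch_normalized h g (a z : C) : Cmod (dilatation h g a) < 1 ->
  stretch (Cconj (dilatation h g a)) (normalized h g a z) = harmonic_map h g z.
Proof. by move=> H; rewrite /normalized stretch_unstretch ?Cmod_conj. Qed.

Lemma near_unit_disk (a z : C) s : unit_disk a -> s < 1 ->
  Cmod (z - a) <= s * (1 - Cmod a) -> unit_disk z.
Proof.
by move=> /unit_disk_radius Ha Hs Hz; apply: (unit_disk_ball a); nra.
Qed.

Lemma normalization_defect_derive h g (a z : C) : sense_preserving_harmonic h g ->
  unit_disk z ->
  cderiv (normalization_defect h g a) z
    ((dilatation h g z - dilatation h g a) * C_derive h z)%C.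
Proof.
move=> /sense_preserving_facts [Hh Hg _ _ Eg] Hz.
have := cderiv_minus _ _ _ _ _ (analytic_cderiv _ Hg _ Hz)
  (cderiv_cmult (dilatation h g a) _ _ _ (analytic_cderiv _ Hh _ Hz)).
by apply: cderiv_eq; rewrite Eg //; ring.
Qed.

Lemma dilatation_osc h g (a z : C) s : sense_preserving_harmonic h g -> unit_disk a ->
  0 <= s <= / 8 -> Cmod (z - a) <= s * (1 - Cmod a) ->
  Cmod (dilatation h g z - dilatation h g a) <= 16 * s * (1 - Cmod (dilatation h g a)).
Proof.
move=> hf Ha Hs Hz; have R0 := unit_disk_radius _ Ha.
have [_ _ _ Hom _] := sense_preserving_facts _ _ hf; have [_ ba] := Hom a Ha.
have Hz8 : Cmod (z - a) <= (1 - Cmod a) / 8 by nra.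
have := disk_valued_osc _ _ _ _ R0 (dilatation_disk_valued _ _ a hf) Hz8.
set w := Cmod (dilatation h g a) in ba *; have w0 : 0 <= w := Cmod_ge_0 _.
have : Cmod (z - a) / (1 - Cmod a) <= s.
  apply: (Rmult_le_reg_r (1 - Cmod a)) => //.
  by have -> : Cmod (z - a) / (1 - Cmod a) * (1 - Cmod a) = Cmod (z - a) by [field; lra].
set x := Cmod (z - a) / _ => Hx.
have D : 0 <= 1 - w ^ 2 <= 2 * (1 - w) by nra.
have : x * (1 - w ^ 2) <= s * (2 * (1 - w)) by nra.
lra.
Qed.

(** The derivative of the defect is the oscillation of the dilatation times [h'], and that
    oscillation carries the factor [1 - Cmod (om a)] which the inverse of the stretch
    costs. *)
Lemma normalized_near_h h g (a : C) A s H0 : sense_preserving_harmonic h g -> unit_disk a ->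
  cconvex A -> 0 <= s <= / 8 -> (forall z, A z -> Cmod (z - a) <= s * (1 - Cmod a)) ->
  (forall z, A z -> Cmod (C_derive h z) <= H0) ->
  forall z w, A z -> A w ->
  Cmod (normalized h g a z - normalized h g a w - (h z - h w)) <= 16 * s * H0 * Cmod (z - w).
Proof.
move=> hf Ha HA Hs Hnear HH z w Hz Hw.
have [Hh Hg h0 Hom Eg] := sense_preserving_facts _ _ hf; have [_ ba] := Hom a Ha.
have inD v : A v -> unit_disk v by move=> /Hnear; apply: near_unit_disk => //; lra.
rewrite !normalizedE //; set th := Cconj _; set G := normalization_defect h g a.
have Eth : Cmod th = Cmod (dilatation h g a) by rewrite Cmod_conj.
have -> : (h z + unstretch th (Cconj (G z)) - (h w + unstretch th (Cconj (G w))) - (h z - h w)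
   = unstretch th (Cconj (G z - G w)))%C.
  by rewrite Cminus_conj unstretch_sub; ring.
have h1 := Cmod_unstretch th (Cconj (G z - G w)) ltac:(lra).
have := mean_value_convex A G
  (fun v => (dilatation h g v - dilatation h g a) * C_derive h v)%C
  (16 * s * (1 - Cmod th) * H0) HA.
move=> /(_ _ z w Hz Hw) h2.
apply: (Rmult_le_reg_r (1 - Cmod th)); first lra.
apply: Rle_trans h1 _; rewrite Cmod_conj.
have -> : 16 * s * H0 * Cmod (z - w) * (1 - Cmod th) = 16 * s * (1 - Cmod th) * H0 * Cmod (z - w).
  ring.
apply: h2 => v Hv; split; first exact: normalization_defect_derive (inD v Hv).
rewrite Cmod_mult; apply: Rmult_le_compat; try exact: Cmod_ge_0; last exact: HH.
by rewrite Eth; apply: dilatation_osc => //; apply: Hnear.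
Qed.

(** ** Second differences *)

(** Taylor's inequality at the point dividing the segment, summed with the weights
    [1 - t] and [t]: the first order terms cancel. *)
Lemma analytic_second_difference A (q q1 q2 : C -> C) M : cconvex A ->
  (forall z, A z -> [/\ cderiv q z (q1 z), cderiv q1 z (q2 z) & Cmod (q2 z) <= M]) ->
  forall x y t, A x -> A y -> 0 <= t <= 1 ->
  Cmod (q x + RtoC t * (q y - q x) - q (x + RtoC t * (y - x))%C)
    <= M * (t * (1 - t)) * Cmod (x - y) ^ 2.
Proof.
move=> HA Hq x y t Hx Hy Ht; set m := (x + RtoC t * (y - x))%C.
have Hm : A m by apply: HA.
have M0 : 0 <= M by have [_ _ h] := Hq x Hx; have := Cmod_ge_0 (q2 x); lra.
have one v : A v -> Cmod (q v - q m - q1 m * (v - m)) <= M * Cmod (v - m) * Cmod (v - m).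
  move=> Hv.
  have -> : (q v - q m - q1 m * (v - m) = (q v - q1 m * v) - (q m - q1 m * m))%C by ring.
  apply: (mean_value_convex (fun z => A z /\ Cmod (z - m) <= Cmod (v - m))
    (fun z => q z - q1 m * z)%C (fun z => q1 z - q1 m)%C).
  - by move=> u1 u2 s [a1 b1] [a2 b2] Hs; split; [apply: HA|apply: cconvex_closed_ball].
  - move=> z [Az Bz]; have [d1 _ _] := Hq z Az; split.
      have := cderiv_minus _ _ _ _ _ d1 (cderiv_cmult (q1 m) _ _ _ (cderiv_id z)).
      by apply: cderiv_eq; ring.
    have := mean_value_convex A q1 q2 M HA (fun z Az => let: And3 _ d b := Hq z Az in conj d b) z m Az Hm.
    move=> h; apply: Rle_trans h _; exact: Rmult_le_compat_l.
  - by split=> //; exact: Rle_refl.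
  - by split=> //; rewrite Cmod_sub0; exact: Cmod_ge_0.
have -> : (q x + RtoC t * (q y - q x) - q m =
  RtoC (1 - t) * (q x - q m - q1 m * (x - m)) + RtoC t * (q y - q m - q1 m * (y - m)))%C.
  by rewrite RtoC_minus /m; ring.
apply: Rle_trans (Cmod_triangle _ _) _; rewrite !Cmod_mult !Cmod_RtoC_pos; try lra.
have ex : Cmod (x - m) = t * Cmod (x - y).
  have -> : (x - m = RtoC t * (x - y))%C by rewrite /m; ring.
  by rewrite Cmod_mult Cmod_RtoC_pos; lra.
have ey : Cmod (y - m) = (1 - t) * Cmod (x - y).
  have -> : (y - m = - (RtoC (1 - t) * (x - y)))%C by rewrite /m RtoC_minus; ring.
  by rewrite Cmod_opp Cmod_mult Cmod_RtoC_pos; lra.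
have := Rmult_le_compat_l (1 - t) _ _ ltac:(lra) (one x Hx).
have := Rmult_le_compat_l t _ _ ltac:(lra) (one y Hy).
rewrite ex ey => h1 h2.
apply: Rle_trans (Rplus_le_compat _ _ _ _ h2 h1) _.
by apply: Req_le; ring.
Qed.

(** * Hyperbolic disks *)

Lemma ln_ratio_lt x t : 0 <= x < 1 -> 0 < t < 1 ->
  (ln ((1 + x) / (1 - x)) < ln ((1 + t) / (1 - t)) <-> x < t).
Proof.
move=> Hx Ht.
have P y : 0 <= y < 1 -> 0 < (1 + y) / (1 - y) by move=> ?; apply: Rdiv_lt_0_compat; lra.
have mono u v : 0 <= u < 1 -> 0 <= v < 1 -> u < v ->
    (1 + u) / (1 - u) < (1 + v) / (1 - v).
  move=> Hu Hv Huv; have E y : y < 1 -> (1 + y) / (1 - y) = 2 * / (1 - y) - 1.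
    by move=> ?; field; lra.
  rewrite !E; try lra.
  have : / (1 - u) < / (1 - v) by apply: Rinv_lt_contravar; [apply: Rmult_lt_0_compat; lra|lra].
  lra.
split=> H.
  apply: Rnot_le_lt => Hle.
  have : (1 + t) / (1 - t) <= (1 + x) / (1 - x).
    by case: (Rle_lt_or_eq_dec _ _ Hle) => [h|<-]; [apply: Rlt_le; apply: mono; lra|lra].
  move=> h; have := ln_le _ _ (P t ltac:(lra)) h; lra.
by apply: ln_increasing; [apply: P|apply: mono; lra].
Qed.

Lemma hyperbolic_diskE (a z : C) t : unit_disk a -> 0 < t < 1 ->
  hyperbolic_disk a (ln ((1 + t) / (1 - t))) z <->
  unit_disk z /\ Cmod (z - a) < t * Cmod (1 - Cconj a * z).
Proof.
move=> Ha Ht; rewrite /hyperbolic_disk; split=> -[Hz H]; split=> //;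
  have n0 := one_sub_conj_neq0 _ _ Ha Hz; have P := Cmod_pos _ n0;
  have lt1 := Cmod_lt_one_sub_conj _ _ Ha Hz; have P0 := Cmod_ge_0 (z - a);
  (have Hx : 0 <= Cmod (z - a) / Cmod (1 - Cconj a * z) < 1;
    first by split; [apply: Rmult_le_pos => //; apply: Rlt_le; exact: Rinv_0_lt_compat|
      apply: (Rmult_lt_reg_r _ _ _ P); rewrite /Rdiv Rmult_assoc Rinv_l; lra]);
  have E := ln_ratio_lt _ _ Hx Ht.
- move: H; rewrite /hyperbolic_dist /artanh Cmod_div // -Rmult_assoc Rinv_r; last lra.
  rewrite Rmult_1_l => /E h.
  have := Rmult_lt_compat_r _ _ _ P h; rewrite /Rdiv Rmult_assoc Rinv_l; lra.
- rewrite /hyperbolic_dist /artanh Cmod_div // -Rmult_assoc Rinv_r; last lra.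
  rewrite Rmult_1_l; apply/E; apply: (Rmult_lt_reg_r _ _ _ P).
  by rewrite /Rdiv Rmult_assoc Rinv_l; lra.
Qed.

(** Completing the square in [Cmod (z - a) ^ 2 < t ^ 2 * Cmod (1 - Cconj a * z) ^ 2] gives
    the equation of a Euclidean disk. Its strict convexity is what local convexity rests
    on, with a radius comparable to the distance of [a] from the unit circle. *)
Lemma hyperbolic_disk_euclidean (a : C) t : unit_disk a -> 0 < t < 1 ->
  exists o r, 0 < r <= 2 * t / (1 - t ^ 2) * (1 - Cmod a) /\
    forall z, hyperbolic_disk a (ln ((1 + t) / (1 - t))) z <-> Cmod (z - o) < r.
Proof.
move=> Ha Ht; set k := Cmod a ^ 2.
have Pa := Cmod_ge_0 a; have Ha1 : Cmod a < 1 by [].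
have k01 : 0 <= k < 1 by rewrite /k; nra.
set q := 1 - t ^ 2 * k; have t2 : 0 < t ^ 2 < 1 by nra.
have q0 : 1 - t ^ 2 <= q by rewrite /q; nra.
have qpos : 0 < q by lra.
set r := t * (1 - k) / q.
have r0 : 0 < r by apply: Rdiv_lt_0_compat => //; apply: Rmult_lt_0_compat; lra.
exists (RtoC ((1 - t ^ 2) / q) * a)%C, r; split.
  split=> //; rewrite /r.
  apply: (Rle_trans _ (t * (1 - k) / (1 - t ^ 2))).
    apply: Rmult_le_compat_l; first by apply: Rmult_le_pos; lra.
    by apply: Rinv_le_contravar; lra.
  have -> : 2 * t / (1 - t ^ 2) * (1 - Cmod a) = (t * (2 * (1 - Cmod a))) / (1 - t ^ 2) by field; lra.
  apply: Rmult_le_compat_r; first by apply: Rlt_le; apply: Rinv_0_lt_compat; lra.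
  by apply: Rmult_le_compat_l; rewrite /k; nra.
move=> z; set o := (_ * a)%C.
have Q : q * (Cmod (z - o) ^ 2 - r ^ 2) =
    Cmod (z - a) ^ 2 - t ^ 2 * Cmod (1 - Cconj a * z) ^ 2.
  rewrite /o /r; move: qpos; rewrite /q /k; rewrite !Cmod2_alt.
  case: a {Ha Pa Ha1 k01 q0 k q r r0 o} => a1 a2; case: z => z1 z2; rewrite /= /Re /Im /= => q0.
  by field; lra.
have P1 := Cmod_ge_0 (z - o); have P2 := Cmod_ge_0 (z - a).
have P3 := Cmod_ge_0 (1 - Cconj a * z).
rewrite hyperbolic_diskE //; split.
  move=> [_ H]; apply: Rnot_le_lt => h.
  have : 0 <= q * (Cmod (z - o) ^ 2 - r ^ 2) by apply: Rmult_le_pos; nra.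
  rewrite Q; have : 0 <= t * Cmod (1 - Cconj a * z) by apply: Rmult_le_pos; lra.
  nra.
move=> H; have H1 : Cmod (z - o) ^ 2 - r ^ 2 < 0 by nra.
have H2 := Rmult_lt_compat_l q _ _ qpos H1; rewrite Q Rmult_0_r in H2.
have tP : 0 <= t * Cmod (1 - Cconj a * z) by apply: Rmult_le_pos; lra.
split; last by nra.
apply: Rnot_le_lt => Hz.
have := Cmod_one_sub_conj a z; rewrite -/k => E.
have h1 : 0 <= (1 - k) * (Cmod z ^ 2 - 1).
  by apply: Rmult_le_pos; [lra|have := Cmod_ge_0 z; nra].
have h2 : 0 <= (1 - t ^ 2) * Cmod (1 - Cconj a * z) ^ 2.
  by apply: Rmult_le_pos; [lra|exact: pow2_ge_0].
lra.
Qed.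

Lemma hyperbolic_disk_near (a z : C) t : unit_disk a -> 0 < t <= / 2 ->
  hyperbolic_disk a (ln ((1 + t) / (1 - t))) z -> Cmod (z - a) <= 4 * t * (1 - Cmod a).
Proof.
move=> Ha Ht; rewrite hyperbolic_diskE //; last lra.
move=> [Hz H]; have Pa := Cmod_ge_0 a; have Ha1 : Cmod a < 1 by [].
have : Cmod (1 - Cconj a * z) <= (1 - Cmod a ^ 2) + Cmod (z - a).
  have -> : (1 - Cconj a * z = RtoC (1 - Cmod a ^ 2) - Cconj a * (z - a))%C.
    by rewrite RtoC_minus -Cconj_mul_self; ring.
  apply: Rle_trans (Cmod_tri_sub _ _) _; rewrite Cmod_mult Cmod_conj Cmod_RtoC_pos; last nra.
  by have := Cmod_ge_0 (z - a); nra.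
have := Cmod_ge_0 (z - a); set x := Cmod (z - a) in H *; set y := Cmod (1 - _) in H *.
move=> x0 Hy; have : t * y <= t * (2 * (1 - Cmod a) + x) by apply: Rmult_le_compat_l; nra.
nra.
Qed.

Lemma near_hyperbolic_disk (a z : C) t : unit_disk a -> 0 < t < 1 ->
  Cmod (z - a) <= t / 2 * (1 - Cmod a) -> hyperbolic_disk a (ln ((1 + t) / (1 - t))) z.
Proof.
move=> Ha Ht Hz; have R0 := unit_disk_radius _ Ha; have Pa := Cmod_ge_0 a.
apply/hyperbolic_diskE => //; split; first by apply: (near_unit_disk a z (t / 2)) => //; lra.
have : (1 - Cmod a) - Cmod (z - a) <= Cmod (1 - Cconj a * z).
  have := Cmod_le_add (1 - Cconj a * z) (RtoC (1 - Cmod a ^ 2)).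
  have -> : (RtoC (1 - Cmod a ^ 2) - (1 - Cconj a * z) = Cconj a * (z - a))%C.
    by rewrite RtoC_minus -Cconj_mul_self; ring.
  rewrite Cmod_mult Cmod_conj Cmod_RtoC_pos; last nra.
  by have := Cmod_ge_0 (z - a); nra.
move=> h; apply: (Rlt_le_trans _ (t * ((1 - Cmod a) - Cmod (z - a)))); last nra.
have := Rmult_le_compat_r (1 + t) _ _ ltac:(lra) Hz.
have : 0 < t * (1 - Cmod a) * (1 - t) by do 2 (apply: Rmult_lt_0_compat; try lra).
lra.
Qed.

(** * A finite pre-Schwarzian norm gives uniform local convexity *)

Lemma finite_preSchwarzian_near h (a z : C) K : unit_disk a ->
  (forall z, unit_disk z -> (1 - Cmod z) * Cmod (analytic_preSchwarzian h z) <= K) ->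
  Cmod (z - a) <= (1 - Cmod a) / 2 ->
  Cmod (analytic_preSchwarzian h z) <= 2 * K / (1 - Cmod a).
Proof.
move=> Ha HK Hz; have R0 := unit_disk_radius _ Ha.
have Hz1 : (1 - Cmod a) / 2 <= 1 - Cmod z by have := Cmod_le_add a z; lra.
have := HK z ltac:(rewrite /unit_disk; lra).
set p := Cmod (analytic_preSchwarzian h z); have p0 : 0 <= p := Cmod_ge_0 _.
move=> h1; apply: (Rmult_le_reg_r (1 - Cmod a)) => //.
have -> : 2 * K / (1 - Cmod a) * (1 - Cmod a) = 2 * K by field; lra.
nra.
Qed.

Lemma log_derivative h g : sense_preserving_harmonic h g ->
  exists L, [/\ analytic L,
    forall z, unit_disk z -> C_derive L z = analytic_preSchwarzian h z &
    forall z, unit_disk z -> C_derive h z = Cexp (L z)].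
Proof.
move=> /sense_preserving_facts [Hh _ h0 _ _].
exact: analytic_log (analytic_C_derive _ Hh) h0.
Qed.

(** [P] is the derivative of a logarithm of [h'], which varies little on small hyperbolic
    disks. *)
Lemma finite_preSchwarzian_osc h g (a z : C) K s : sense_preserving_harmonic h g ->
  unit_disk a ->
  (forall z, unit_disk z -> (1 - Cmod z) * Cmod (analytic_preSchwarzian h z) <= K) ->
  0 <= s <= / 2 -> K * s <= / 4 -> Cmod (z - a) <= s * (1 - Cmod a) ->
  Cmod (C_derive h z - C_derive h a) <= 4 * K * s * Cmod (C_derive h a).
Proof.
move=> hf Ha HK Hs HKs Hz; have R0 := unit_disk_radius _ Ha.
have [L [HL L' EL]] := log_derivative _ _ hf.
have inD w : Cmod (w - a) <= s * (1 - Cmod a) -> unit_disk w.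
  by move=> Hw; apply: (near_unit_disk a w s) => //; lra.
have lL : Cmod (L z - L a) <= 2 * K / (1 - Cmod a) * Cmod (z - a).
  apply: (mean_value_convex (fun w => Cmod (w - a) <= s * (1 - Cmod a)) L (C_derive L)) => //.
  - exact: cconvex_closed_ball.
  - move=> w Hw; have Dw := inD w Hw; split; first exact: analytic_cderiv.
    by rewrite L' //; apply: finite_preSchwarzian_near => //; nra.
  - by rewrite Cmod_sub0; apply: Rmult_le_pos; lra.
have K0 : 0 <= K.
  by apply: Rle_trans (HK a Ha); apply: Rmult_le_pos; [lra|exact: Cmod_ge_0].
have lL2 : Cmod (L z - L a) <= 2 * K * s.
  apply: Rle_trans lL _.
  have -> : 2 * K * s = 2 * K / (1 - Cmod a) * (s * (1 - Cmod a)) by field; lra.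
  apply: Rmult_le_compat_l => //; apply: Rmult_le_pos; first lra.
  by apply: Rlt_le; apply: Rinv_0_lt_compat.
rewrite !EL //; last exact: inD.
have -> : (Cexp (L z) - Cexp (L a) = Cexp (L a) * (Cexp (L z - L a) - 1))%C.
  have {1}-> : L z = (L a + (L z - L a))%C by ring.
  by rewrite Cexp_plus; ring.
rewrite Cmod_mult Rmult_comm; apply: Rmult_le_compat_r; first exact: Cmod_ge_0.
by apply: Rle_trans (Cexp_sub1_small _ _) _; lra.
Qed.

Lemma open_C (U : C -> Prop) :
  (forall z, U z -> exists d, 0 < d /\ forall w, Cmod (w - z) < d -> U w) ->
  open (T := C_UniformSpace) U.
Proof.
move=> H z /H [d [d0 Hd]]; have h : 0 < d / 2 by lra.
exists (mkposreal _ h) => w [h1 h2]; apply: Hd.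
have -> : (w - z = RtoC (Re w - Re z) + Ci * RtoC (Im w - Im z))%C.
  by apply: injective_projections; rewrite /= /Re /Im; ring.
apply: Rle_lt_trans (Cmod_triangle _ _) _; rewrite Cmod_mult Cmod_Ci Rmult_1_l !Cmod_R.
by move: h1 h2; rewrite /ball /= /AbsRing_ball /abs /minus /plus /opp /= /Re /Im /Rminus; lra.
Qed.

(** Post-composition with the stretch is linear, so it is enough to treat the
    normalized map. *)
Lemma normalized_convex_image h g (a o : C) r (E : C -> Prop) M : sense_preserving_harmonic h g ->
  unit_disk a -> 0 < r -> (forall z, E z <-> Cmod (z - o) < r) ->
  nearly_linear (normalized h g a) (C_derive h a) (fun z => Cmod (z - o) < r) ->
  4 * M * r < Cmod (C_derive h a) ->
  (forall x y t, Cmod (x - o) < r -> Cmod (y - o) < r -> 0 <= t <= 1 ->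
    Cmod (normalized h g a x + RtoC t * (normalized h g a y - normalized h g a x)
      - normalized h g a (x + RtoC t * (y - x))%C) <= M * (t * (1 - t)) * Cmod (x - y) ^ 2) ->
  convex_on E (harmonic_map h g).
Proof.
move=> hf Ha r0 HE HT HM Hsec.
have [_ _ h0 Hom _] := sense_preserving_facts _ _ hf; have [_ ba] := Hom a Ha.
have c0 := h0 a Ha; have Pc := Cmod_pos _ c0.
set T := normalized h g a in HT Hsec; set th := Cconj (dilatation h g a).
have bth : Cmod th < 1 by rewrite Cmod_conj.
have fT z : harmonic_map h g z = stretch th (T z) by rewrite stretch_normalized.
have Tf z : T z = unstretch th (harmonic_map h g z) by [].
have EE z : Cmod (z - o) < r -> E z by move=> ?; apply/HE.
split.
  move=> z w /HE Hz /HE Hw Ezw; apply: (nearly_linear_univalent _ _ _ c0 HT z w Hz Hw).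
  by rewrite !Tf Ezw.
split; [|split].
- apply: open_C => v [z [/HE Hz ->]].
  set s := r - Cmod (z - o); have s0 : 0 < s by rewrite /s; lra.
  have sub w : Cmod (w - z) < s -> Cmod (w - o) < r.
    by move=> Hw; have := Cmod_tri_dist z w o; rewrite /s in Hw; lra.
  exists ((1 - Cmod th) * (Cmod (C_derive h a) * s / 2)); split.
    by apply: Rmult_lt_0_compat; [lra|have := Rmult_lt_0_compat _ _ Pc s0; lra].
  move=> w Hw.
  have [|z' [h1 h2]] := nearly_linear_surj T _ z (unstretch th w) s c0
      (nearly_linear_subset _ _ _ _ sub HT).
    rewrite Tf -unstretch_sub; have := Cmod_unstretch th (w - harmonic_map h g z) bth => hu.
    by apply: (Rmult_lt_reg_r (1 - Cmod th)); lra.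
  exists z'; split; first by apply: EE; apply: sub.
  by rewrite fT h2 stretch_unstretch.
- by exists (harmonic_map h g o), o; split=> //; apply: EE; rewrite Cmod_sub0.
- move=> u v t [x [/HE Hx ->]] [y [/HE Hy ->]] Ht.
  have [z [h1 h2]] := nearly_linear_convex_image T _ o x y r M t c0 r0 HT HM
    (Hsec x y t Hx Hy Ht) Hx Hy Ht.
  exists z; split; first exact: EE.
  rewrite !fT h2 stretch_lin.
  have -> : (T y - T x = T y + RtoC (-1) * T x)%C by ring.
  by rewrite stretch_lin RtoC_minus; ring.
Qed.

Lemma normalized_second_difference h g (a : C) A M1 M2 : sense_preserving_harmonic h g ->
  unit_disk a -> cconvex A -> (forall z, A z -> unit_disk z) ->
  (forall z, A z -> Cmod (C_derive (C_derive h) z) <= M1) ->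
  (forall z, A z -> Cmod (C_derive (dilatation h g) z * C_derive h z +
     (dilatation h g z - dilatation h g a) * C_derive (C_derive h) z)
       <= M2 * (1 - Cmod (dilatation h g a))) ->
  forall x y t, A x -> A y -> 0 <= t <= 1 ->
  Cmod (normalized h g a x + RtoC t * (normalized h g a y - normalized h g a x)
      - normalized h g a (x + RtoC t * (y - x))%C) <= (M1 + M2) * (t * (1 - t)) * Cmod (x - y) ^ 2.
Proof.
move=> hf Ha HA AD H1 H2 x y t Hx Hy Ht.
have [Hh Hg h0 Hom Eg] := sense_preserving_facts _ _ hf; have [_ ba] := Hom a Ha.
have Hh' := analytic_C_derive _ Hh.
set th := Cconj (dilatation h g a); set G := normalization_defect h g a.
have Eth : Cmod th = Cmod (dilatation h g a) by rewrite Cmod_conj.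
set m := (x + RtoC t * (y - x))%C.
rewrite !normalizedE // -/th -/G.
have -> : (h x + unstretch th (Cconj (G x)) +
   RtoC t * (h y + unstretch th (Cconj (G y)) - (h x + unstretch th (Cconj (G x))))
   - (h m + unstretch th (Cconj (G m))) =
   (h x + RtoC t * (h y - h x) - h m) +
   unstretch th (Cconj (G x + RtoC t * (G y - G x) - G m)))%C.
  have Et : Cconj (RtoC t) = RtoC t by apply: injective_projections => /=; ring.
  rewrite Cminus_conj Cplus_conj Cmult_conj Cminus_conj Et.
  by rewrite unstretch_sub unstretch_lin unstretch_sub; ring.
apply: Rle_trans (Cmod_triangle _ _) _.
rewrite Rmult_plus_distr_r Rmult_plus_distr_r; apply: Rplus_le_compat.
  apply: (analytic_second_difference A h (C_derive h) (C_derive (C_derive h))) => //.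
  by move=> z Az; split; [apply: analytic_cderiv|apply: analytic_cderiv|apply: H1]; try exact: AD.
apply: (Rmult_le_reg_r (1 - Cmod th)); first lra.
apply: Rle_trans (Cmod_unstretch th _ ltac:(lra)) _; rewrite Cmod_conj Eth.
have -> : M2 * (t * (1 - t)) * Cmod (x - y) ^ 2 * (1 - Cmod (dilatation h g a)) =
  M2 * (1 - Cmod (dilatation h g a)) * (t * (1 - t)) * Cmod (x - y) ^ 2 by ring.
apply: (analytic_second_difference A G
  (fun z => (dilatation h g z - dilatation h g a) * C_derive h z)%C
  (fun z => C_derive (dilatation h g) z * C_derive h z +
     (dilatation h g z - dilatation h g a) * C_derive (C_derive h) z)%C) => //.
move=> z Az; have Dz := AD z Az; split; last exact: H2.
  exact: normalization_defect_derive.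
have dom := differentiable_C_derive _ _ (proj1 (Hom z Dz)).
have := cderiv_mult _ _ _ _ _
  (cderiv_minus _ _ _ _ _ dom (cderiv_const (dilatation h g a) z)) (analytic_cderiv _ Hh' _ Dz).
by apply: cderiv_eq; ring.
Qed.

(** On a hyperbolic disk of small fixed radius about [a], [h'] is nearly [h' a], the
    normalized map is nearly linear, and its second differences are
    [O(Cmod (h' a) / (1 - Cmod a))] while the disk has radius
    [O(t * (1 - Cmod a))]. *)
Theorem finite_preSchwarzian_convex h g : sense_preserving_harmonic h g ->
  finite_preSchwarzian h ->
  exists rho, 0 < rho /\
    forall a, unit_disk a -> convex_on (hyperbolic_disk a rho) (harmonic_map h g).
Proof.
move=> hf [K HK].
have [Hh Hg h0 Hom Eg] := sense_preserving_facts _ _ hf.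
have K0 : 0 <= K.
  apply: Rle_trans (HK _ unit_disk_0); rewrite Cmod_0; apply: Rmult_le_pos; first lra.
  exact: Cmod_ge_0.
(* Small enough for the bound [(128 + 8 * K) * c / R] on second differences found below
   to beat the curvature [/ r] of the disk, as [r <= 4 * t * R]. *)
set t := / (4096 * (1 + K)).
have t0 : 0 < t by apply: Rinv_0_lt_compat; lra.
have tK : t * (1 + K) = / 4096 by rewrite /t; field; lra.
have t1 : t <= / 4096 by nra.
exists (ln ((1 + t) / (1 - t))); split.
  rewrite -ln_1; apply: ln_increasing; first lra.
  by apply: (Rmult_lt_reg_r (1 - t)); [lra|rewrite /Rdiv Rmult_assoc Rinv_l; lra].
move=> a Ha; have R0 := unit_disk_radius _ Ha; set R := 1 - Cmod a in R0.
have [o [r [[r0 rR] HE]]] := hyperbolic_disk_euclidean a t Ha ltac:(lra).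
rewrite -/R in rR.
have rR' : r <= 4 * t * R.
  apply: Rle_trans rR _; apply: Rmult_le_compat_r; first lra.
  apply: (Rmult_le_reg_r (1 - t ^ 2)); first nra.
  have -> : 2 * t / (1 - t ^ 2) * (1 - t ^ 2) = 2 * t by field; nra.
  nra.
set A := fun z => Cmod (z - o) < r.
have Anear z : A z -> Cmod (z - a) <= 4 * t * R.
  by move=> /HE; apply: hyperbolic_disk_near => //; lra.
have AD z : A z -> unit_disk z by move=> /Anear; apply: near_unit_disk => //; lra.
have Aconv : cconvex A by exact: cconvex_ball.
set c := Cmod (C_derive h a); have Pc : 0 < c by apply: Cmod_pos; apply: h0.
have osc z : A z -> Cmod (C_derive h z - C_derive h a) <= / 8 * c.
  move=> Az; apply: Rle_trans (finite_preSchwarzian_osc h g a z K (4 * t) hf Ha HK _ _ _) _.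
  - lra.
  - nra.
  - exact: Anear.
  - by apply: Rmult_le_compat_r; [exact: Rlt_le|nra].
have H2c z : A z -> Cmod (C_derive h z) <= 2 * c.
  by move=> /osc h1; have := Cmod_le_add (C_derive h a) (C_derive h z); rewrite -/c; lra.
have HT : nearly_linear (normalized h g a) (C_derive h a) A.
  move=> z w Az Aw.
  have b1 := normalized_near_h h g a A (4 * t) (2 * c) hf Ha Aconv ltac:(lra) Anear H2c z w Az Aw.
  have b2 : Cmod ((h z - C_derive h a * z) - (h w - C_derive h a * w)) <= / 8 * c * Cmod (z - w).
    apply: (mean_value_convex A (fun z => h z - C_derive h a * z)%C
      (fun z => C_derive h z - C_derive h a)%C) => // v Av; split; last exact: osc.
    have := cderiv_minus _ _ _ _ _ (analytic_cderiv _ Hh _ (AD v Av))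
      (cderiv_cmult (C_derive h a) _ _ _ (cderiv_id v)).
    by apply: cderiv_eq; ring.
  have -> : (normalized h g a z - normalized h g a w - C_derive h a * (z - w) =
    (normalized h g a z - normalized h g a w - (h z - h w))
    + ((h z - C_derive h a * z) - (h w - C_derive h a * w)))%C by ring.
  apply: Rle_trans (Cmod_triangle _ _) _; rewrite -/c.
  have := Cmod_ge_0 (z - w) => zw.
  have : 16 * (4 * t) * (2 * c) * Cmod (z - w) <= / 8 * c * Cmod (z - w).
    by apply: Rmult_le_compat_r => //; nra.
  by have := Rmult_le_pos _ _ (Rlt_le _ _ Pc) zw; lra.
have b2 z : A z -> Cmod (C_derive (C_derive h) z) <= 4 * K * c / R.
  move=> Az; have Dz := AD z Az.
  have -> : C_derive (C_derive h) z = (analytic_preSchwarzian h z * C_derive h z)%C.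
    by rewrite /analytic_preSchwarzian; field; apply: h0.
  rewrite Cmod_mult; have -> : 4 * K * c / R = 2 * K / R * (2 * c) by field; lra.
  apply: Rmult_le_compat; try exact: Cmod_ge_0; last exact: H2c.
  apply: finite_preSchwarzian_near => //; apply: Rle_trans (Anear z Az) _.
  by rewrite -/R; nra.
set D := 1 - Cmod (dilatation h g a).
have [_ ba] := Hom a Ha; have Pw := Cmod_ge_0 (dilatation h g a).
apply: (normalized_convex_image h g a o r _ ((128 + 8 * K) * c / R)) => //.
  apply: (Rmult_lt_reg_r R) => //.
  have -> : 4 * ((128 + 8 * K) * c / R) * r * R = 4 * (128 + 8 * K) * r * c by field; lra.
  rewrite -/c (Rmult_comm c R); apply: Rmult_lt_compat_r => //.
  apply: (Rle_lt_trans _ (4 * (128 + 8 * K) * (4 * t * R))).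
    by apply: Rmult_le_compat_l; lra.
  nra.
have -> : (128 + 8 * K) * c / R = 4 * K * c / R + (128 + 4 * K) * c / R by field; lra.
apply: (normalized_second_difference h g a A) => // z Az.
rewrite -/D; apply: Rle_trans (Cmod_triangle _ _) _; rewrite 2!Cmod_mult.
have d1 : Cmod (C_derive (dilatation h g) z) <= 64 / R * D.
  have := disk_valued_derive _ a z R R0 (dilatation_disk_valued _ _ a hf).
  have hz : Cmod (z - a) <= R / 16 by apply: Rle_trans (Anear z Az) _; nra.
  move=> /(_ hz) h1; apply: Rle_trans h1 _.
  have -> : 64 / R * D = 32 / R * (2 * D) by field; lra.
  apply: Rmult_le_compat_l; last by rewrite /D; nra.
  by apply: Rmult_le_pos; [lra|apply: Rlt_le; exact: Rinv_0_lt_compat].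
have d2 : Cmod (dilatation h g z - dilatation h g a) <= D.
  apply: Rle_trans (dilatation_osc h g a z (4 * t) hf Ha ltac:(lra) (Anear z Az)) _.
  by rewrite -/D -{2}(Rmult_1_l D); apply: Rmult_le_compat_r; rewrite /D; lra.
have e1 := Rmult_le_compat _ _ _ _ (Cmod_ge_0 _) (Cmod_ge_0 _) d1 (H2c z Az).
have e2 := Rmult_le_compat _ _ _ _ (Cmod_ge_0 _) (Cmod_ge_0 _) d2 (b2 z Az).
apply: Rle_trans (Rplus_le_compat _ _ _ _ e1 e2) _.
by apply: Req_le; field; lra.
Qed.

(** * Uniform radii *)

Lemma Rbar_glb_correct E : Rbar_is_glb E (Rbar_glb E).
Proof. exact: proj2_sig (Rbar_ex_glb E). Qed.

Lemma uniform_radius_gt0 Q f rho : 0 < rho ->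
  (forall a, unit_disk a -> Q (hyperbolic_disk a rho) f) -> Rbar_lt 0 (uniform_radius Q f).
Proof.
move=> Hr HQ; apply: (Rbar_lt_le_trans _ (Finite rho)) => //.
apply: (proj2 (Rbar_glb_correct _)) => x [a [Ha ->]].
by apply: (proj1 (Lub_Rbar_correct _)); split=> //; apply: HQ.
Qed.

Lemma uniform_radius_univalent Q f : (forall A, Q A f -> univalent_on A f) ->
  Rbar_lt 0 (uniform_radius Q f) ->
  exists rho, 0 < rho /\ forall a, unit_disk a -> univalent_on (hyperbolic_disk a rho) f.
Proof.
move=> HQ Hpos; set N := uniform_radius Q f in Hpos.
have [rho [r0 rN]] : exists rho, 0 < rho /\ Rbar_lt rho N.
  case: N Hpos => [n| |] //= Hn; last by exists 1; split=> //; lra.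
  by exists (n / 2); split; lra.
exists rho; split=> // a Ha.
have [x [hx Qx]] : exists x, rho < x /\ Q (hyperbolic_disk a x) f.
  apply: NNPP => Hn.
  have h1 : Rbar_le N (Lub_Rbar (fun r => 0 < r /\ Q (hyperbolic_disk a r) f)).
    by apply: (proj1 (Rbar_glb_correct _)); exists a.
  have h2 : Rbar_le (Lub_Rbar (fun r => 0 < r /\ Q (hyperbolic_disk a r) f)) rho.
    apply: (proj2 (Lub_Rbar_correct _)) => x [x0 Qx] /=.
    by apply: Rnot_lt_le => h; apply: Hn; exists x.
  have := Rbar_lt_le_trans _ _ _ rN (Rbar_le_trans _ _ _ h1 h2); rewrite /=; lra.
move=> z w [Dz Hz] [Dw Hw]; apply: (HQ _ Qx); split=> //; lra.
Qed.

(** Euclidean disks of radius proportional to the distance of the centre from the unit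
    circle, in place of hyperbolic disks of fixed radius. *)
Definition univalent_at_scale (sigma : R) (f : C -> C) : Prop :=
  forall a, unit_disk a -> univalent_on (fun z => Cmod (z - a) <= sigma * (1 - Cmod a)) f.

Lemma univalent_hyperbolic_scale f rho : 0 < rho ->
  (forall a, unit_disk a -> univalent_on (hyperbolic_disk a rho) f) ->
  exists sigma, 0 < sigma /\ univalent_at_scale sigma f.
Proof.
move=> r0 H; have e1 : 1 < exp rho by rewrite -exp_0; apply: exp_increasing.
set t := (exp rho - 1) / (exp rho + 1).
have t0 : 0 < t by apply: Rdiv_lt_0_compat; lra.
have t1 : t < 1.
  by apply: (Rmult_lt_reg_r (exp rho + 1)); [lra|rewrite /t /Rdiv Rmult_assoc Rinv_l; lra].
have Er : ln ((1 + t) / (1 - t)) = rho.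
  have -> : (1 + t) / (1 - t) = exp rho by rewrite /t; field; lra.
  exact: ln_exp.
exists (t / 2); split; first lra.
move=> a Ha z w Hz Hw.
by apply: (H a Ha); rewrite -Er; apply: near_hyperbolic_disk => //; lra.
Qed.

(** * Univalence at a fixed hyperbolic scale bounds the pre-Schwarzian *)

(** The point maximizing [(r - Cmod z) * Cmod (P z)], up to a factor 2, dominates [P] on a
    disk about it whose radius is comparable to the distance from the circle of radius
    [r]. Hence a bound on [P] need only be proved at points that dominate their
    surroundings. *)
Lemma point_picking P M : analytic P -> 0 <= M ->
  (forall a d, unit_disk a -> 0 < d <= 1 - Cmod a ->
     (forall z, Cmod (z - a) <= d / 2 -> Cmod (P z) <= 4 * Cmod (P a)) ->
     d * Cmod (P a) <= M) ->
  forall z, unit_disk z -> (1 - Cmod z) * Cmod (P z) <= 2 * M.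
Proof.
move=> HP M0 H z Hz; apply: Rnot_lt_le => Hlt; have R0 := unit_disk_radius _ Hz.
set p := Cmod (P z) in Hlt; have p0 : 0 <= p := Cmod_ge_0 _.
have pp : 0 < p by case: p0 => // E; rewrite -E in Hlt; lra.
set eta := ((1 - Cmod z) * p - 2 * M) / (2 * p).
have eta0 : 0 < eta by apply: Rdiv_lt_0_compat; lra.
have Eeta : eta * (2 * p) = (1 - Cmod z) * p - 2 * M by rewrite /eta; field; lra.
set r := 1 - eta.
have rz : 2 * M < (r - Cmod z) * p by rewrite /r; lra.
have zr : Cmod z < r by nra.
have [B HB] := analytic_bounded P r HP ltac:(rewrite /r; lra).
have [||N [N1 N2]] := completeness (fun x => exists w, Cmod w <= r /\ x = (r - Cmod w) * Cmod (P w)).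
- exists B => x [w [Hw ->]]; have := HB w Hw; have := Cmod_ge_0 (P w); have := Cmod_ge_0 w.
  by move=> h1 h2 h3; rewrite /r in Hw *; nra.
- by exists ((r - Cmod z) * p), z; split=> //; lra.
have Nbig : (r - Cmod z) * p <= N by apply: N1; exists z; split=> //; lra.
have [a [Har Hval]] : exists a, Cmod a <= r /\ N / 2 < (r - Cmod a) * Cmod (P a).
  apply: NNPP => Hn.
  have : N <= N / 2; last lra.
  apply: N2 => x [w [Hw ->]]; apply: Rnot_lt_le => h.
  by apply: Hn; exists w.
set d := r - Cmod a in Hval; have Pa := Cmod_ge_0 (P a).
have d0 : 0 < d by have : 0 <= d; [rewrite /d; lra|case=> // E; rewrite -E in Hval; lra].
have := H a d ltac:(rewrite /unit_disk; rewrite /d /r in d0; lra)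
  ltac:(rewrite /d /r in d0 *; lra).
move=> h; have {h} : d * Cmod (P a) <= M; last lra.
apply: h => w Hw; have Hwa := Cmod_le_add a w.
have hw : d / 2 <= r - Cmod w by rewrite /d in Hw *; lra.
have : (r - Cmod w) * Cmod (P w) <= N by apply: N1; exists w; split=> //; lra.
have Pw := Cmod_ge_0 (P w) => h1.
have h2 : d / 2 * Cmod (P w) <= N by nra.
have h3 : d * Cmod (P w) <= d * (4 * Cmod (P a)) by lra.
exact: Rmult_le_reg_l h3.
Qed.

(** The Cauchy estimate on the disk on which [P] is dominated. *)
Lemma dominated_derive P (a z : C) d : analytic P -> unit_disk a -> 0 < d <= 1 - Cmod a ->
  (forall w, Cmod (w - a) <= d / 2 -> Cmod (P w) <= 4 * Cmod (P a)) ->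
  Cmod (z - a) < d / 4 -> Cmod (C_derive P z) <= 32 * Cmod (P a) / d.
Proof.
move=> /analyticP HP Ha Hd Hdom Hz.
have inD w : Cmod (w - a) < d -> differentiable P w.
  by move=> Hw; apply: HP; apply: (unit_disk_ball a); lra.
have h := cauchy_estimate P z _ (d / 4) (4 * Cmod (P a)) ltac:(lra) _
  (differentiable_C_derive _ _ (inD z ltac:(lra))).
apply: (Rmult_le_reg_r (d / 4)); first lra.
have -> : 32 * Cmod (P a) / d * (d / 4) = 2 * (4 * Cmod (P a)) by field; lra.
apply: h => w Hw; have Hwa := ball_triangle _ _ _ _ _ Hz Hw.
by split; [apply: inD; lra|apply: Hdom; lra].
Qed.

(** At a dominating point [a] with [d * Cmod (P a)] large, [h] looks, at scale
    [/ Cmod (P a)], like the exponential, which takes the same value at [Ci * PI] and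
    [- Ci * PI]. Local inversion transfers this coincidence to the normalized map, and
    hence to the harmonic map, within a disk in which the latter is univalent. *)
Lemma univalent_at_scale_dominating h g sigma (a : C) d : sense_preserving_harmonic h g ->
  0 < sigma -> univalent_at_scale sigma (harmonic_map h g) ->
  unit_disk a -> 0 < d <= 1 - Cmod a ->
  (forall z, Cmod (z - a) <= d / 2 ->
     Cmod (analytic_preSchwarzian h z) <= 4 * Cmod (analytic_preSchwarzian h a)) ->
  d * Cmod (analytic_preSchwarzian h a) <= 430080 * exp 6 + 5 / sigma.
Proof.
move=> hf sigma0 Huniv Ha Hd Hdom.
have [Hh Hg h0 Hom _] := sense_preserving_facts _ _ hf; have [_ ba] := Hom a Ha.
have [L [HL L' EL]] := log_derivative _ _ hf.
set P := analytic_preSchwarzian h in Hdom L' *.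
have HP : analytic P := analytic_preSchwarzian_analytic h Hh h0.
set p := Cmod (P a); set X := d * p; apply: Rnot_lt_le => HX.
have e1 : 1 <= exp 6 by rewrite -exp_0; apply: exp_le_compat; lra.
have s0 : 0 < 5 / sigma by apply: Rdiv_lt_0_compat; lra.
have X0 : 0 < X by lra.
have pp : 0 < p by have := Cmod_ge_0 (P a); rewrite -/p => -[] // E; rewrite /X -E in X0; lra.
have Pn0 : P a <> 0%C by move=> E; rewrite /p E Cmod_0 in pp; lra.
have Xinv k : k <= X -> k / X <= 1.
  move=> hk; apply: (Rmult_le_reg_r X) => //; rewrite /Rdiv Rmult_assoc Rinv_l; lra.
have R0 := unit_disk_radius _ Ha.
pose A z := Cmod (z - a) <= 5 / p.
have Aconv : cconvex A by exact: cconvex_closed_ball.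
have E5p : 5 / p = 5 / X * d by rewrite /X; field; lra.
have X5 : 0 < 5 / X by apply: Rdiv_lt_0_compat; lra.
have X5s : 5 / X <= / 8 by have := Xinv 40 ltac:(lra); have -> : 40 / X = 8 * (5 / X) by [field; lra]; lra.
have Anear z : A z -> Cmod (z - a) <= 5 / X * (1 - Cmod a).
  by rewrite /A E5p => h1; apply: Rle_trans h1 _; apply: Rmult_le_compat_l; lra.
have Ad z : A z -> Cmod (z - a) < d / 4.
  rewrite /A E5p => h1; apply: Rle_lt_trans h1 _.
  have := Xinv 40 ltac:(lra); have -> : 40 / X = 8 * (5 / X) by field; lra.
  nra.
have AD z : A z -> unit_disk z by move=> /Ad hz; apply: (unit_disk_ball a); lra.
have Aa : A a by rewrite /A Cmod_sub0; apply: Rlt_le; apply: Rdiv_lt_0_compat; lra.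
(* The error in the approximation of the logarithm of [h'] by an affine function. *)
pose E z := (L z - L a - P a * (z - a))%C.
set nu := 800 / X.
have nu0 : 0 < nu by apply: Rdiv_lt_0_compat; lra.
have nu16 : nu <= / 16.
  by have := Xinv 12800 ltac:(lra); have -> : 12800 / X = 16 * nu by [rewrite /nu; field; lra]; lra.
have dP z : A z -> Cmod (P z - P a) <= 160 / d.
  move=> Az; apply: (Rle_trans _ (32 * p / d * Cmod (z - a))).
    apply: (mean_value_convex (fun w => Cmod (w - a) < d / 4) P (C_derive P)).
    - exact: cconvex_ball.
    - move=> w Hw; split; last exact: (dominated_derive P a).
      by apply: analytic_cderiv => //; apply: (unit_disk_ball a); lra.
    - exact: Ad.
    - by rewrite Cmod_sub0; lra.
  have -> : 160 / d = 32 * p / d * (5 / p) by field; lra.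
  apply: Rmult_le_compat_l => //.
  by apply: Rmult_le_pos; [lra|apply: Rlt_le; apply: Rinv_0_lt_compat; lra].
have bE z : A z -> Cmod (E z) <= nu.
  move=> Az.
  have -> : (E z = (L z - P a * z) - (L a - P a * a))%C by rewrite /E; ring.
  apply: (Rle_trans _ (160 / d * Cmod (z - a))).
    apply: (mean_value_convex A (fun z => L z - P a * z)%C (fun z => P z - P a)%C) => //.
    move=> w Aw; split; last exact: dP.
    have := cderiv_minus _ _ _ _ _ (analytic_cderiv _ HL _ (AD w Aw))
      (cderiv_cmult (P a) _ _ _ (cderiv_id w)).
    by rewrite L'; [apply: cderiv_eq; ring|exact: AD].
  have -> : nu = 160 / d * (5 / p) by rewrite /nu /X; field; lra.
  apply: Rmult_le_compat_l => //.
  by apply: Rmult_le_pos; [lra|apply: Rlt_le; apply: Rinv_0_lt_compat; lra].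
set c := Cmod (C_derive h a); have c0 : 0 < c by apply: Cmod_pos; apply: h0.
have Eh z : A z -> C_derive h z = (C_derive h a * Cexp (P a * (z - a) + E z))%C.
  move=> Az; rewrite !EL //; last exact: AD.
  by rewrite -Cexp_plus /E; f_equal; ring.
have bPz z : A z -> Cmod (P a * (z - a)) <= 5.
  rewrite /A Cmod_mult -/p => h1; have := Rmult_le_compat_l p _ _ (Rlt_le _ _ pp) h1.
  by have -> : p * (5 / p) = 5 by field; lra.
have e65 : exp 5 <= exp 6 by apply: exp_le_compat; lra.
have bh z : A z -> Cmod (C_derive h z) <= c * exp 6.
  move=> Az; rewrite Eh // Cmod_mult -/c; apply: Rmult_le_compat_l; first lra.
  apply: Rle_trans (Cmod_Cexp_le _) _; apply: exp_le_compat.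
  by apply: Rle_trans (Cmod_triangle _ _) _; have := bPz z Az; have := bE z Az; lra.
have s80 : 16 * (5 / X) * (c * exp 6) = c * (80 * exp 6 / X) by field; lra.
(* The term [430080 * exp 6 = 256 * 1680 * exp 6] of the bound is chosen for this. *)
have tiny : 80 * exp 6 / X + 2 * nu * exp 5 < / 256.
  apply: (Rle_lt_trans _ (1680 * exp 6 / X)).
    have -> : 1680 * exp 6 / X = 80 * exp 6 / X + 2 * nu * exp 6 by rewrite /nu; field; lra.
    by apply: Rplus_le_compat_l; apply: Rmult_le_compat_l; lra.
  apply: (Rmult_lt_reg_r X) => //; rewrite /Rdiv Rmult_assoc Rinv_l; lra.
have pos80 : 0 < 80 * exp 6 / X by apply: Rdiv_lt_0_compat; lra.
have posnu : 0 < 2 * nu * exp 5 by have := exp_pos 5 => ?; apply: Rmult_lt_0_compat; lra.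
have Tnear z w : A z -> A w -> Cmod (normalized h g a z - normalized h g a w - (h z - h w))
    <= c * (80 * exp 6 / X) * Cmod (z - w).
  move=> Az Aw; rewrite -s80.
  by apply: (normalized_near_h h g a A) => //; lra.
(* The two points at which the model exponential takes the value -1. *)
pose pt s := (a + RtoC s * Ci / P a)%C.
have Ept s : (P a * (pt s - a) = RtoC s * Ci)%C by rewrite /pt; field.
have HPI1 := PI_RGT_0; have HPI4 := PI_4; have HPI3 := PI2_3_2.
have nearpt s z : Rabs s = PI -> Cmod (z - pt s) < / (16 * p) -> A z.
  move=> Hs Hz; rewrite /A; have := Cmod_tri_dist (pt s) z a.
  have -> : Cmod (pt s - a) = PI / p.
    have -> : (pt s - a = RtoC s * Ci / P a)%C by rewrite /pt; ring.
    by rewrite Cmod_div // Cmod_mult Cmod_Ci Cmod_R Hs Rmult_1_r.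
  have : PI / p <= 4 / p by apply: Rmult_le_compat_r => //; apply: Rlt_le; exact: Rinv_0_lt_compat.
  have -> : 5 / p = 4 / p + / p by field; lra.
  have : / (16 * p) <= / p by apply: Rinv_le_contravar; lra.
  lra.
have HT s : Rabs s = PI -> Cexp (RtoC s * Ci) = (- (1))%C ->
    nearly_linear (normalized h g a) (- C_derive h a)%C (fun z => Cmod (z - pt s) < / (16 * p)).
  move=> Hs Es z w Hz Hw.
  have Az := nearpt s z Hs Hz; have Aw := nearpt s w Hs Hw.
  have -> : (normalized h g a z - normalized h g a w - - C_derive h a * (z - w) =
    (normalized h g a z - normalized h g a w - (h z - h w)) +
    ((h z + C_derive h a * z) - (h w + C_derive h a * w)))%C by ring.
  apply: Rle_trans (Cmod_triangle _ _) _; rewrite Cmod_opp -/c.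
  have b1 := Tnear z w Az Aw.
  have b2 : Cmod (h z + C_derive h a * z - (h w + C_derive h a * w)) <= c * / 4 * Cmod (z - w).
    apply: (mean_value_convex (fun z => Cmod (z - pt s) < / (16 * p))
      (fun z => h z + C_derive h a * z)%C (fun z => C_derive h z + C_derive h a)%C) => //.
      exact: cconvex_ball.
    move=> v Hv; have Av := nearpt s v Hs Hv; split.
      have := cderiv_plus _ _ _ _ _ (analytic_cderiv _ Hh _ (AD v Av))
        (cderiv_cmult (C_derive h a) _ _ _ (cderiv_id v)).
      by apply: cderiv_eq; ring.
    rewrite Eh //.
    have -> : (P a * (v - a) = RtoC s * Ci + P a * (v - pt s))%C by rewrite -Ept; ring.
    rewrite -Cplus_assoc Cexp_plus Es.
    have -> : (C_derive h a * (- (1) * Cexp (P a * (v - pt s) + E v)) + C_derive h a =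
      - (C_derive h a * (Cexp (P a * (v - pt s) + E v) - 1)))%C by ring.
    rewrite Cmod_opp Cmod_mult -/c; apply: Rmult_le_compat_l; first lra.
    have b3 : Cmod (P a * (v - pt s) + E v) <= / 8.
      apply: Rle_trans (Cmod_triangle _ _) _; have := bE v Av; rewrite Cmod_mult -/p.
      have := Rmult_lt_compat_l p _ _ pp Hv.
      have -> : p * / (16 * p) = / 16 by field; lra.
      lra.
    by apply: Rle_trans (Cexp_sub1_small _ _) _; lra.
  have zw := Cmod_ge_0 (z - w).
  have : c * (80 * exp 6 / X) * Cmod (z - w) <= c * / 4 * Cmod (z - w).
    by apply: Rmult_le_compat_r => //; apply: Rmult_le_compat_l; lra.
  lra.
have EPI : Cexp (RtoC PI * Ci) = (- (1))%C := Cexp_Ci_PI.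
have ENPI : Cexp (RtoC (- PI) * Ci) = (- (1))%C.
  have -> : (RtoC (- PI) * Ci = - (RtoC PI * Ci))%C by rewrite RtoC_opp; ring.
  by rewrite Cexp_opp EPI; field.
have aPI : Rabs PI = PI by apply: Rabs_pos_eq; lra.
have aNPI : Rabs (- PI) = PI by rewrite Rabs_Ropp.
have p16 : 0 < / (16 * p) by apply: Rinv_0_lt_compat; lra.
have Ap : A (pt PI) by apply: (nearpt PI) => //; rewrite Cmod_sub0.
have Am : A (pt (- PI)%R) by apply: (nearpt (- PI)%R) => //; rewrite Cmod_sub0.
have dist : Cmod (pt PI - pt (- PI)%R) = 2 * PI / p.
  have -> : (pt PI - pt (- PI)%R = RtoC (2 * PI) * Ci / P a)%C.
    by rewrite /pt RtoC_opp RtoC_mult; field.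
  by rewrite Cmod_div // Cmod_mult Cmod_Ci Cmod_RtoC_pos; [rewrite Rmult_1_r|lra].
have hclose : Cmod (h (pt PI) - h (pt (- PI)%R)) <= c * (2 * nu * exp 5) * (2 * PI / p).
  (* [k] measures the distance from [h] to the model exponential. *)
  pose k z := (h z - C_derive h a * Cexp (P a * (z - a)) / P a)%C.
  have -> : (h (pt PI) - h (pt (- PI)%R) = k (pt PI) - k (pt (- PI)%R))%C.
    by rewrite /k !Ept EPI ENPI; ring.
  rewrite -dist.
  apply: (mean_value_convex A k (fun z => C_derive h z - C_derive h a * Cexp (P a * (z - a)))%C) => //.
  move=> v Av; split.
    have hl : cderiv (fun z => P a * (z - a))%C v (P a).
      have := cderiv_cmult (P a) _ _ _ (cderiv_minus _ _ _ _ _ (cderiv_id v) (cderiv_const a v)).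
      by apply: cderiv_eq; ring.
    have := cderiv_minus _ _ _ _ _ (analytic_cderiv _ Hh _ (AD v Av))
      (cderiv_cmult (C_derive h a / P a) _ _ _ (cderiv_comp Cexp _ _ _ _ hl (cderiv_Cexp _))).
    move=> hd; apply: (cderiv_ext _ _ _ _ _ (cderiv_eq _ _ _ _ _ hd)).
      by move=> w; rewrite /k; field.
    by field.
  rewrite Eh // Cexp_plus.
  have -> : (C_derive h a * (Cexp (P a * (v - a)) * Cexp (E v)) - C_derive h a * Cexp (P a * (v - a))
    = C_derive h a * (Cexp (P a * (v - a)) * (Cexp (E v) - 1)))%C by ring.
  rewrite !Cmod_mult -/c; apply: Rmult_le_compat_l; first lra.
  rewrite (Rmult_comm (2 * nu)).
  apply: Rmult_le_compat; try exact: Cmod_ge_0.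
    by apply: Rle_trans (Cmod_Cexp_le _) _; apply: exp_le_compat; apply: bPz.
  have b := bE v Av; have := Cexp_sub1_small (E v) ltac:(lra); lra.
have Tclose : Cmod (normalized h g a (pt PI) - normalized h g a (pt (- PI)%R))
    < Cmod (- C_derive h a) * / (16 * p) / 2.
  rewrite Cmod_opp -/c.
  have := Cmod_le_add (h (pt PI) - h (pt (- PI)%R))
    (normalized h g a (pt PI) - normalized h g a (pt (- PI)%R)).
  have := Tnear _ _ Ap Am; rewrite dist.
  have -> : c * / (16 * p) / 2 = c * / 256 * (8 / p) by field; lra.
  have : c * (2 * nu * exp 5) * (2 * PI / p) + c * (80 * exp 6 / X) * (2 * PI / p)
      < c * / 256 * (8 / p); last lra.
  rewrite -Rmult_plus_distr_r -Rmult_plus_distr_l.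
  apply: (Rlt_le_trans _ (c * / 256 * (2 * PI / p))).
    apply: Rmult_lt_compat_r; first by apply: Rdiv_lt_0_compat; lra.
    by apply: Rmult_lt_compat_l; lra.
  apply: Rmult_le_compat_l; first lra.
  by apply: Rmult_le_compat_r; [apply: Rlt_le; exact: Rinv_0_lt_compat|lra].
have cn0 : (- C_derive h a <> 0)%C.
  by move=> Ec; have := Cmod_opp (C_derive h a); rewrite Ec Cmod_0 -/c; lra.
have [z [Hz Tz]] := nearly_linear_surj _ _ _ _ _ cn0 (HT (- PI) aNPI ENPI) Tclose.
have Asig v : A v -> Cmod (v - a) <= sigma * (1 - Cmod a).
  move=> /Anear hv; apply: Rle_trans hv _; apply: Rmult_le_compat_r; first lra.
  apply: (Rmult_le_reg_r X) => //; have -> : 5 / X * X = sigma * (5 / sigma) by field; lra.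
  by apply: Rmult_le_compat_l; lra.
have Ez : z = pt PI.
  apply: (Huniv a Ha).
  - exact: Asig (nearpt _ _ aNPI Hz).
  - exact: Asig.
  - by rewrite -!(stretch_normalized h g a) // Tz.
move: Hz; rewrite Ez dist => hz.
have := Rmult_lt_compat_r p _ _ pp hz.
have -> : 2 * PI / p * p = 2 * PI by field; lra.
have -> : / (16 * p) * p = / 16 by field; lra.
lra.
Qed.

Theorem univalent_at_scale_finite_preSchwarzian h g sigma : sense_preserving_harmonic h g ->
  0 < sigma -> univalent_at_scale sigma (harmonic_map h g) -> finite_preSchwarzian h.
Proof.
move=> hf sigma0 Huniv; have [Hh _ h0 _ _] := sense_preserving_facts _ _ hf.
exists (2 * (430080 * exp 6 + 5 / sigma)).
apply: point_picking.
- exact: analytic_preSchwarzian_analytic.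
- have := exp_pos 6; have : 0 < 5 / sigma by apply: Rdiv_lt_0_compat; lra.
  lra.
- by move=> a d Ha Hd Hdom; apply: (univalent_at_scale_dominating h g).
Qed.

(** * Pre-Schwarzian and Schwarzian norms *)

Lemma bounded_norm_Lub (S : R -> Prop) :
  bounded_norm (Lub_Rbar S) <-> exists K, forall x, S x -> x <= K.
Proof.
have [H1 H2] := Lub_Rbar_correct S; rewrite /bounded_norm; split.
- case E : (Lub_Rbar S) H1 => [n| |] //= H1 _.
    by exists n => x /H1.
  by exists 0 => x /H1.
- move=> [K HK]; apply: (Rbar_le_lt_trans _ (Finite K)) => //.
  by apply: H2 => x /HK.
Qed.

Lemma one_sub_sq_bounds (z : C) : unit_disk z ->
  1 - Cmod z <= 1 - Cmod z ^ 2 <= 2 * (1 - Cmod z).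
Proof. by rewrite /unit_disk => Hz; have := Cmod_ge_0 z; nra. Qed.

Lemma dilatation_derive_bounds h g z : sense_preserving_harmonic h g -> unit_disk z ->
  let w := dilatation h g in let d := 1 - Cmod z in let D := 1 - Cmod (w z) ^ 2 in
  [/\ 0 < d, 0 < D, Cmod (w z) < 1, Cmod (C_derive w z) <= D * / d
    & Cmod (C_derive (C_derive w) z) <= D * (1024 / (d * d))].
Proof.
move=> hf Hz w d D; have d0 : 0 < d := unit_disk_radius _ Hz.
have [_ _ _ Hom _] := sense_preserving_facts _ _ hf; have [_ bz] := Hom z Hz.
have Hdv := dilatation_disk_valued h g z hf; rewrite -/d in Hdv.
split=> //.
- exact: one_sub_sq_pos (conj (Cmod_ge_0 _) bz).
- have := schwarz_pick _ _ _ d0 Hdv; rewrite -/w -/D => h1.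
  apply: (Rmult_le_reg_r d) => //; have -> : D * / d * d = D by field; lra.
  by [].
- by rewrite (Rmult_comm D); apply: disk_valued_derive2.
Qed.

Lemma preSchwarzian_norm_bounded h g : sense_preserving_harmonic h g ->
  (bounded_norm (preSchwarzian_norm h g) <-> finite_preSchwarzian h).
Proof.
move=> hf.
have corr z : unit_disk z -> (1 - Cmod z) *
    Cmod (analytic_preSchwarzian h z - preSchwarzian h g z) <= 1.
  move=> Hz; have [d0 D0 w1 b1 _] := dilatation_derive_bounds h g z hf Hz.
  rewrite /preSchwarzian -/(analytic_preSchwarzian h z) -RtoC_minus.
  set w := dilatation h g in D0 w1 b1 *; set D := 1 - Cmod (w z) ^ 2 in D0 b1 *.
  have Dn0 : RtoC D <> 0%C by move=> /RtoC_inj; lra.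
  have -> : (analytic_preSchwarzian h z - (analytic_preSchwarzian h z -
     Cconj (w z) * C_derive w z / RtoC D) = Cconj (w z) * C_derive w z / RtoC D)%C by ring.
  rewrite Cmod_div // Cmod_mult Cmod_conj (Cmod_RtoC_pos _ (Rlt_le _ _ D0)).
  apply: (Rle_trans _ ((1 - Cmod z) * (1 * (D * / (1 - Cmod z)) / D))); last first.
    by apply: Req_le; field; lra.
  apply: Rmult_le_compat_l; first lra.
  apply: Rmult_le_compat_r; first by apply: Rlt_le; apply: Rinv_0_lt_compat.
  by apply: Rmult_le_compat => //; try exact: Cmod_ge_0; lra.
rewrite bounded_norm_Lub; split=> -[K HK].
- exists (K + 1) => z Hz; have [s1 s2] := one_sub_sq_bounds z Hz.
  have d0 := unit_disk_radius _ Hz.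
  have := HK _ (ex_intro _ z (conj Hz eq_refl)) => h1.
  have h2 := Cmod_le_add (preSchwarzian h g z) (analytic_preSchwarzian h z).
  have h3 := corr z Hz; have := Cmod_ge_0 (preSchwarzian h g z); nra.
- exists (2 * (K + 1)) => x [z [Hz ->]]; have [s1 s2] := one_sub_sq_bounds z Hz.
  have d0 := unit_disk_radius _ Hz.
  have h1 := HK z Hz; have h3 := corr z Hz.
  have h2 := Cmod_le_add (analytic_preSchwarzian h z) (preSchwarzian h g z).
  rewrite Cmod_sub_sym in h2; have := Cmod_ge_0 (preSchwarzian h g z); nra.
Qed.

Lemma analytic_SchwarzianE h z : analytic h ->
  (forall z, unit_disk z -> C_derive h z <> 0%C) -> unit_disk z ->
  let P := analytic_preSchwarzian h in
  analytic_Schwarzian h z = (C_derive P z - P z * P z / 2)%C.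
Proof.
move=> Hh h0 Hz P; have n0 := h0 z Hz.
have Hh1 := analytic_C_derive _ Hh; have Hh2 := analytic_C_derive _ Hh1.
have := cderiv_div _ _ _ _ _ n0 (analytic_cderiv _ Hh2 _ Hz) (analytic_cderiv _ Hh1 _ Hz).
move=> /cderiv_C_derive; rewrite -/P => ->.
rewrite /analytic_Schwarzian /P /analytic_preSchwarzian RtoC_div; last lra.
by field.
Qed.

(** The Schwarzian of the analytic part is [P' - P ^ 2 / 2]; the Schwarz-Pick inequalities
    of first and second order bound what the dilatation adds. *)
Lemma Schwarzian_riccati h g z : sense_preserving_harmonic h g -> unit_disk z ->
  let P := analytic_preSchwarzian h in let d := 1 - Cmod z in
  Cmod (Schwarzian h g z - (C_derive P z - P z * P z / 2)) <= Cmod (P z) * / d + 1026 / (d * d).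
Proof.
move=> hf Hz P d; have [d0 D0 w1 b1 b2] := dilatation_derive_bounds h g z hf Hz.
have [Hh _ h0 _ _] := sense_preserving_facts _ _ hf.
rewrite -/d in d0 b1 b2.
rewrite /Schwarzian analytic_SchwarzianE // -RtoC_minus -/(analytic_preSchwarzian h z) -/P.
set w := dilatation h g in D0 w1 b1 b2 *; set D := 1 - Cmod (w z) ^ 2 in D0 b1 b2 *.
have Dn0 : RtoC D <> 0%C by move=> /RtoC_inj; lra.
set S0 := (C_derive P z - P z * P z / 2)%C.
set q := (C_derive w z / RtoC D)%C; set q2 := (C_derive (C_derive w) z / RtoC D)%C.
have bq : Cmod q <= / d.
  rewrite /q Cmod_div // (Cmod_RtoC_pos _ (Rlt_le _ _ D0)).
  by apply: (Rmult_le_reg_r D) => //; rewrite /Rdiv Rmult_assoc Rinv_l; lra.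
have bq2 : Cmod q2 <= 1024 / (d * d).
  rewrite /q2 Cmod_div // (Cmod_RtoC_pos _ (Rlt_le _ _ D0)).
  by apply: (Rmult_le_reg_r D) => //; rewrite /Rdiv Rmult_assoc Rinv_l; lra.
have -> : (S0 + Cconj (w z) / D * (P z * C_derive w z - C_derive (C_derive w) z)
   - RtoC (3 / 2) * (Cconj (w z) * C_derive w z / D) ^ 2 - S0 =
   Cconj (w z) * (P z * q) - Cconj (w z) * q2
     - RtoC (3 / 2) * ((Cconj (w z) * q) * (Cconj (w z) * q)))%C.
  by rewrite /q /q2; field.
have wq : Cmod (Cconj (w z) * q) <= / d.
  rewrite Cmod_mult Cmod_conj; have := Cmod_ge_0 q; have := Cmod_ge_0 (w z); nra.
have d1 : 0 < / d by apply: Rinv_0_lt_compat.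
apply: Rle_trans (Cmod_tri_sub _ _) _.
have t1 : Cmod (Cconj (w z) * (P z * q) - Cconj (w z) * q2) <= Cmod (P z) * / d + 1024 / (d * d).
  apply: Rle_trans (Cmod_tri_sub _ _) _.
  rewrite !(Cmod_mult (Cconj _)) (Cmod_mult (P z)) Cmod_conj.
  rewrite -(Rmult_1_l (_ * / d)) -(Rmult_1_l (1024 / _)).
  have P0 := Cmod_ge_0 (P z); have Q0 := Cmod_ge_0 q.
  apply: Rplus_le_compat; apply: Rmult_le_compat; try exact: Cmod_ge_0; try lra.
    exact: Rmult_le_pos.
  exact: Rmult_le_compat_l.
have t2 : Cmod (RtoC (3 / 2) * ((Cconj (w z) * q) * (Cconj (w z) * q))) <= 2 / (d * d).
  rewrite Cmod_mult (Cmod_mult (_ * q)) Cmod_RtoC_pos; last lra.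
  have -> : 2 / (d * d) = 2 * (/ d * / d) by field; lra.
  apply: Rmult_le_compat; try lra; first by apply: Rmult_le_pos; exact: Cmod_ge_0.
  by apply: Rmult_le_compat => //; exact: Cmod_ge_0.
have -> : 1026 / (d * d) = 1024 / (d * d) + 2 / (d * d) by field; lra.
lra.
Qed.

(** One direction is the Cauchy estimate for the derivative of [P]. For the other, at a
    point dominating its surroundings the derivative of [P] is at most of order
    [Cmod (P a) / d], so that in the Riccati relation the term [P ^ 2 / 2] has nothing to
    cancel against. *)
Lemma Schwarzian_norm_bounded h g : sense_preserving_harmonic h g ->
  (bounded_norm (Schwarzian_norm h g) <-> finite_preSchwarzian h).
Proof.
move=> hf; have [Hh _ h0 _ _] := sense_preserving_facts _ _ hf.
set P := analytic_preSchwarzian h.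
have HP : analytic P := analytic_preSchwarzian_analytic h Hh h0.
have two : RtoC 2 <> 0%C by move=> /RtoC_inj; lra.
have modPP z : Cmod (P z * P z / 2) = Cmod (P z) * Cmod (P z) / 2.
  by rewrite Cmod_div // Cmod_mult Cmod_RtoC_pos; lra.
rewrite bounded_norm_Lub; split=> -[K HK].
- exists (2 * (Rabs K + 1100)); have K0 := Rabs_pos K.
  apply: (point_picking P) => // [|a d Ha Hd Hdom]; first lra.
  apply: Rnot_lt_le => HX.
  set p := Cmod (P a) in Hdom HX; set X := d * p in HX.
  have p0 : 0 <= p := Cmod_ge_0 _.
  have [s1 s2] := one_sub_sq_bounds a Ha; set D := 1 - Cmod a in Hd s1 s2.
  have hS := HK _ (ex_intro _ a (conj Ha eq_refl)).
  set S := Cmod (Schwarzian h g a) in hS; have S0 : 0 <= S := Cmod_ge_0 _.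
  have dS : d * d * S <= Rabs K.
    apply: Rle_trans (Rle_abs K); apply: Rle_trans hS; rewrite /= Rmult_1_r.
    apply: Rmult_le_compat_r => //; nra.
  have hR := Schwarzian_riccati h g a hf Ha; cbv zeta in hR; rewrite -/P -/D -/p in hR.
  have hP' : Cmod (C_derive P a) <= 32 * p / d.
    apply: (dominated_derive P a a) => //; rewrite Cmod_sub0; lra.
  have h1 : Cmod (P a * P a / 2) <= Cmod (C_derive P a) + (S + (p * / D + 1026 / (D * D))).
    have -> : (P a * P a / 2 = C_derive P a - (C_derive P a - P a * P a / 2))%C by ring.
    apply: Rle_trans (Cmod_tri_sub _ _) _; apply: Rplus_le_compat_l.
    have := Cmod_le_add (Schwarzian h g a) (C_derive P a - P a * P a / 2).
    by rewrite (Cmod_sub_sym (C_derive P a - P a * P a / 2)) -/S; lra.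
  rewrite modPP -/p in h1.
  have Dd : / D <= / d by apply: Rinv_le_contravar; lra.
  have dd0 : 0 < / d by apply: Rinv_0_lt_compat; lra.
  have DD : 1026 / (D * D) <= 1026 / (d * d).
    apply: Rmult_le_compat_l; first lra.
    by apply: Rinv_le_contravar; nra.
  have h2 : p * p / 2 <= 32 * p / d + (S + (p * / d + 1026 / (d * d))).
    have := Rmult_le_compat_l _ _ _ p0 Dd; lra.
  have h3 : X * X / 2 <= 32 * X + (d * d * S + (X + 1026)).
    have := Rmult_le_compat_l (d * d) _ _ ltac:(nra) h2.
    have -> : d * d * (p * p / 2) = X * X / 2 by rewrite /X; field.
    have -> : d * d * (32 * p / d + (S + (p * / d + 1026 / (d * d)))) =
      32 * X + (d * d * S + (X + 1026)) by rewrite /X; field; lra.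
    by [].
  nra.
- exists (4 * (9 * K + K * K / 2 + 1026)) => x [z [Hz ->]].
  have [s1 s2] := one_sub_sq_bounds z Hz.
  have d0 := unit_disk_radius _ Hz; set d := 1 - Cmod z in d0 s1 s2.
  have hK := HK z Hz; rewrite -/d -/P in hK.
  set p := Cmod (P z) in hK; have p0 : 0 <= p := Cmod_ge_0 _.
  have K0 : 0 <= K by apply: Rle_trans hK; apply: Rmult_le_pos; lra.
  have hP' : d * d * Cmod (C_derive P z) <= 8 * K.
    have := cauchy_estimate P z _ (d / 2) (2 * K / d) ltac:(lra) _ (analytic_cderiv _ HP _ Hz).
    move=> hC; have {}hC : Cmod (C_derive P z) * (d / 2) <= 2 * (2 * K / d).
      apply: hC => w Hw; split.
        by apply: (proj1 (analyticP P) HP); apply: (unit_disk_ball z); rewrite -/d; lra.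
      by apply: (finite_preSchwarzian_near h z w K) => //; rewrite -/d; lra.
    have := Rmult_le_compat_l (2 * d) _ _ ltac:(lra) hC.
    have -> : 2 * d * (2 * (2 * K / d)) = 8 * K by field; lra.
    lra.
  have hR := Schwarzian_riccati h g z hf Hz; cbv zeta in hR; rewrite -/P -/d -/p in hR.
  set S := Cmod (Schwarzian h g z).
  have h1 : S <= (Cmod (C_derive P z) + p * p / 2) + (p * / d + 1026 / (d * d)).
    apply: Rle_trans (Cmod_le_add (C_derive P z - P z * P z / 2) _) _.
    apply: Rplus_le_compat hR; apply: Rle_trans (Cmod_tri_sub _ _) _.
    by rewrite modPP -/p; lra.
  have h2 : d * d * S <= 9 * K + K * K / 2 + 1026.
    have := Rmult_le_compat_l (d * d) _ _ ltac:(nra) h1.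
    have -> : d * d * (Cmod (C_derive P z) + p * p / 2 + (p * / d + 1026 / (d * d))) =
      d * d * Cmod (C_derive P z) + (d * p) * (d * p) / 2 + d * p + 1026 by field; lra.
    have := Rmult_le_pos _ _ (Rlt_le _ _ d0) p0; nra.
  apply: (Rle_trans _ (4 * (d * d) * S)); last lra.
  apply: Rmult_le_compat_r; first exact: Cmod_ge_0.
  by rewrite /= Rmult_1_r; nra.
Qed.

(** * Powers of derivatives of univalent functions *)

(** On the segment from [a] to [v], at parameter [t], the distance to the unit circle is
    at least [(1 - t) * r], so [l] grows at most like [- ln (1 - t) / 4]. *)
Lemma small_preSchwarzian_segment (F l : C -> C) (a v : C) r : analytic F -> analytic l ->
  (forall z, unit_disk z -> C_derive F z = Cexp (l z)) ->
  (forall z, unit_disk z -> (1 - Cmod z) * Cmod (C_derive l z) <= / 12) ->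
  unit_disk v -> 0 < r -> r <= 1 - Cmod a -> Cmod (v - a) <= 3 * r ->
  Cmod (F v - F a - C_derive F a * (v - a)) <= / 3 * (Cmod (C_derive F a) * Cmod (v - a)).
Proof.
move=> HF Hl EF Hsmall Dv r0 ra va.
have Da : unit_disk a by rewrite /unit_disk; lra.
pose zeta t := (a + RtoC t * (v - a))%C.
have Dzeta t : 0 <= t <= 1 -> unit_disk (zeta t) by move=> Ht; apply: cconvex_unit_disk.
have room t : 0 <= t < 1 -> (1 - t) * r <= 1 - Cmod (zeta t).
  move=> Ht; have -> : zeta t = (RtoC (1 - t) * a + RtoC t * v)%C by rewrite /zeta RtoC_minus; ring.
  have := Cmod_triangle (RtoC (1 - t) * a) (RtoC t * v).
  rewrite !Cmod_mult !Cmod_RtoC_pos; try lra.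
  rewrite /unit_disk in Dv; nra.
have growth T : 0 <= T < 1 -> Cmod (l (zeta T) - l a) <= - (/ 4 * ln (1 - T)).
  move=> HT.
  have := segment_mean_value l (C_derive l) a (v - a)%C (fun t => - (/ 4 * ln (1 - t)))
    (fun t => / (4 * (1 - t))) T (proj1 HT).
  have -> : - (/ 4 * ln (1 - T)) - - (/ 4 * ln (1 - 0)) = - (/ 4 * ln (1 - T)).
    by rewrite Rminus_0_r ln_1; ring.
  apply=> t Ht; split.
  - by apply: analytic_cderiv => //; apply: Dzeta; lra.
  - by auto_derive; [lra|field; lra].
  - have := Hsmall _ (Dzeta t ltac:(lra)); have := room t ltac:(lra).
    rewrite -/(zeta t); set q := Cmod (C_derive l (zeta t)) => h1 h2.
    have q0 : 0 <= q := Cmod_ge_0 _.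
    apply: (Rle_trans _ (q * (3 * r))); first exact: Rmult_le_compat_l.
    apply: (Rmult_le_reg_r (4 * (1 - t))); first lra.
    rewrite Rinv_l; last lra.
    have : (1 - t) * r * q <= / 12 by apply: Rle_trans h2; apply: Rmult_le_compat_r.
    lra.
(* [q] is compared with the primitive of [exp (- (/ 4 * ln (1 - t))) - 1]; letting [t]
   tend to 1 leaves the factor [4 / 3 - 1]. *)
pose q z := (F z - C_derive F a * z)%C.
set c := Cmod (C_derive F a) * Cmod (v - a).
have c0 : 0 <= c by apply: Rmult_le_pos; exact: Cmod_ge_0.
have dq z : unit_disk z -> cderiv q z (C_derive F z - C_derive F a)%C.
  move=> Dz; have := cderiv_minus _ _ _ _ _ (analytic_cderiv _ HF _ Dz)
    (cderiv_cmult (C_derive F a) _ _ _ (cderiv_id z)).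
  by apply: cderiv_eq; ring.
have bound T : 0 <= T < 1 -> Cmod (q (zeta T) - q a) <= c * (4 / 3 - T).
  move=> HT.
  have := segment_mean_value q (fun z => C_derive F z - C_derive F a)%C a (v - a)%C
    (fun t => c * (- (4 / 3) * exp (3 / 4 * ln (1 - t)) - t))
    (fun t => c * (exp (- (/ 4 * ln (1 - t))) - 1)) T (proj1 HT).
  have E0 : exp (3 / 4 * ln (1 - 0)) = 1 by rewrite Rminus_0_r ln_1 Rmult_0_r exp_0.
  rewrite E0 => h; apply: Rle_trans (h _) _; last first.
    have := exp_pos (3 / 4 * ln (1 - T)) => e0.
    have -> : c * (- (4 / 3) * exp (3 / 4 * ln (1 - T)) - T) - c * (- (4 / 3) * 1 - 0) =
      c * (4 / 3 - T - 4 / 3 * exp (3 / 4 * ln (1 - T))) by ring.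
    by apply: Rmult_le_compat_l; lra.
  move=> t Ht; split.
  - by apply: dq; apply: Dzeta; lra.
  - have -> : - (/ 4 * ln (1 - t)) = 3 / 4 * ln (1 - t) + - ln (1 - t) by field.
    rewrite exp_plus exp_Ropp exp_ln; last lra.
    auto_derive; first lra.
    rewrite -/(1 - t); field; lra.
  - rewrite -/(zeta t) !EF //; last by apply: Dzeta; lra.
    have -> : (Cexp (l (zeta t)) - Cexp (l a) = Cexp (l a) * (Cexp (l (zeta t) - l a) - 1))%C.
      have {1}-> : l (zeta t) = (l a + (l (zeta t) - l a))%C by ring.
      by rewrite Cexp_plus; ring.
    rewrite -EF // Cmod_mult.
    have -> : forall u x y : R, u * x * y = u * y * x by move=> *; ring.
    rewrite -/c; apply: Rmult_le_compat_l => //.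
    apply: Rle_trans (Cexp_sub1_le _) _.
    by have := exp_le_compat _ _ (growth t ltac:(lra)); lra.
have -> : (F v - F a - C_derive F a * (v - a) = q v - q a)%C by rewrite /q; ring.
rewrite -/c; apply: Rnot_lt_le => Hlt.
set e := Cmod (q v - q a) - / 3 * c in Hlt; have e0 : 0 < e by rewrite /e; lra.
have [dl [dl0 Hdl]] := cderiv_continuous _ _ _ (dq v Dv) (e / 2) ltac:(lra).
have Pv := Cmod_ge_0 (v - a).
set k := c + Cmod (v - a) + 1; have k0 : 0 < k by rewrite /k; lra.
set eta := Rmin (/ 2) (Rmin (dl / (2 * k)) (e / (2 * k))).
have u1 : 0 < dl / (2 * k) by apply: Rdiv_lt_0_compat; lra.
have u2 : 0 < e / (2 * k) by apply: Rdiv_lt_0_compat; lra.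
have eta0 : 0 < eta by do !apply: Rmin_pos; lra.
have eta1 : eta <= / 2 by exact: Rmin_l.
have eta2 : eta <= dl / (2 * k) by apply: Rle_trans (Rmin_r _ _) (Rmin_l _ _).
have eta3 : eta <= e / (2 * k) by apply: Rle_trans (Rmin_r _ _) (Rmin_r _ _).
have E1 : dl / (2 * k) * k = dl / 2 by field; lra.
have E2 : e / (2 * k) * k = e / 2 by field; lra.
have h1 : eta * Cmod (v - a) < dl.
  have := Rmult_le_compat_r _ _ _ (Rlt_le _ _ k0) eta2; rewrite E1 /k; nra.
have h2 : eta * c <= e / 2.
  have := Rmult_le_compat_r _ _ _ (Rlt_le _ _ k0) eta3; rewrite E2 /k; nra.
have := Hdl (zeta (1 - eta)).
have -> : (zeta (1 - eta)%R - v = - (RtoC eta * (v - a)))%C by rewrite /zeta RtoC_minus; ring.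
rewrite Cmod_opp Cmod_mult Cmod_RtoC_pos; last lra.
move=> /(_ h1) h3; have := bound (1 - eta) ltac:(lra).
have := Cmod_tri_dist (q (zeta (1 - eta))) (q v) (q a).
rewrite (Cmod_sub_sym (q v) (q (zeta _))); rewrite /e in h2 h3; lra.
Qed.

(** Two points at distance [d] are joined through a point [a] at depth at least [d / 2]
    in the disk. *)
Lemma small_preSchwarzian_univalent (F l : C -> C) : analytic F -> analytic l ->
  (forall z, unit_disk z -> C_derive F z = Cexp (l z)) ->
  (forall z, unit_disk z -> (1 - Cmod z) * Cmod (C_derive l z) <= / 12) ->
  univalent_on unit_disk F.
Proof.
move=> HF Hl EF Hsmall z w Dz Dw E; apply: Cmod_zero_eq; apply: Rnot_lt_le => d0.
set d := Cmod (z - w) in d0.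
have d2 : d < 2 by have := Cmod_tri_sub z w; rewrite /unit_disk in Dz Dw; rewrite -/d; lra.
set a := (RtoC (1 - d / 2) * z)%C.
have Pz := Cmod_ge_0 z; rewrite /unit_disk in Dz Dw.
have ma : d / 2 <= 1 - Cmod a by rewrite /a Cmod_mult Cmod_RtoC_pos; nra.
have za : Cmod (z - a) <= d / 2.
  have -> : (z - a = RtoC (d / 2) * z)%C by rewrite /a RtoC_minus; ring.
  by rewrite Cmod_mult Cmod_RtoC_pos; nra.
have wa : Cmod (w - a) <= 3 * (d / 2).
  by have := Cmod_tri_dist z w a; rewrite (Cmod_sub_sym w z) -/d; lra.
have Da : unit_disk a by rewrite /unit_disk; lra.
have hz := small_preSchwarzian_segment F l a z (d / 2) HF Hl EF Hsmall Dz ltac:(lra) ma ltac:(lra).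
have hw := small_preSchwarzian_segment F l a w (d / 2) HF Hl EF Hsmall Dw ltac:(lra) ma wa.
set c := Cmod (C_derive F a) in hz hw.
have c0 : 0 < c by rewrite /c EF // Cmod_Cexp; apply: exp_pos.
have : c * d <= / 3 * (c * Cmod (z - a)) + / 3 * (c * Cmod (w - a)).
  rewrite /c /d -Cmod_mult.
  have -> : (C_derive F a * (z - w) = (F w - F a - C_derive F a * (w - a))
     - (F z - F a - C_derive F a * (z - a)))%C by rewrite E; ring.
  by apply: Rle_trans (Cmod_tri_sub _ _) _; rewrite Rplus_comm; apply: Rplus_le_compat.
nra.
Qed.

Definition zero_map : C -> C := fun _ => RtoC 0.

Lemma C_derive_zero_map z : C_derive zero_map z = 0%C.
Proof. exact: cderiv_C_derive (cderiv_const _ _). Qed.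

Lemma locally_univalent_sense_preserving k : analytic k ->
  (forall z, unit_disk z -> C_derive k z <> 0%C) -> sense_preserving_harmonic k zero_map.
Proof.
move=> Hk k0; split=> //; split; first by apply/analyticP => z _; exists 0%C; apply: cderiv_const.
by split=> // z Hz; rewrite C_derive_zero_map Cmod_0; apply: Cmod_pos; apply: k0.
Qed.

Lemma harmonic_map_zero k : harmonic_map k zero_map = k.
Proof.
apply: functional_extensionality => z; rewrite /harmonic_map /zero_map.
by apply: injective_projections => /=; ring.
Qed.

(** If [k'] is [F' ^ m], the logarithmic derivatives of [k'] and [F'] differ by the factor
    [m]: a univalent [F] bounds that of [k'], and conversely a large [m] makes that of
    [F'] small. *)
Lemma power_of_univalent_iff k : analytic k ->
  (forall z, unit_disk z -> C_derive k z <> 0%C) ->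
  (power_of_univalent k <-> finite_preSchwarzian k).
Proof.
move=> Hk k0; split.
- move=> [m [F [m0 [HF [uF [L [HL EL]]]]]]].
  have F0 z : unit_disk z -> C_derive F z <> 0%C by move=> /EL [-> _]; apply: Cexp_neq0.
  have [K HK] : finite_preSchwarzian F.
    apply: (univalent_at_scale_finite_preSchwarzian F zero_map (/ 2)); last 1 first.
    + rewrite harmonic_map_zero => a Ha z w Hz Hw.
      by apply: uF; apply: (near_unit_disk a _ (/ 2)) => //; lra.
    + exact: locally_univalent_sense_preserving.
    + lra.
  have der (u : C -> C) (s : C) z : unit_disk z -> (forall z, unit_disk z -> C_derive u z = Cexp (s * L z)%C) ->
      analytic_preSchwarzian u z = (s * C_derive L z)%C.
    move=> Hz E; rewrite /analytic_preSchwarzian E //.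
    have dL := analytic_cderiv _ HL _ Hz.
    have d1 := cderiv_comp Cexp _ _ _ _ (cderiv_cmult s _ _ _ dL) (cderiv_Cexp _).
    rewrite (C_derive_local _ (fun z => Cexp (s * L z)%C) z Hz E); last by eexists; exact: d1.
    by rewrite (cderiv_C_derive _ _ _ d1); field; apply: Cexp_neq0.
  exists (m * K) => z Hz.
  rewrite (der k (RtoC m)) //; last by move=> v /EL [_ ->].
  have := HK z Hz; rewrite (der F 1%C) //; last by move=> v /EL [-> _]; rewrite Cmult_1_l.
  rewrite Cmult_1_l Cmod_mult Cmod_RtoC_pos; last lra.
  by move=> h; have := Rmult_le_compat_l m _ _ (Rlt_le _ _ m0) h; lra.
- move=> [K HK].
  have [L [HL L' EL]] := analytic_log _ (analytic_C_derive _ Hk) k0.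
  have K0 : 0 <= K.
    apply: Rle_trans (HK _ unit_disk_0); rewrite Cmod_0; apply: Rmult_le_pos; first lra.
    exact: Cmod_ge_0.
  (* With this [m] the logarithmic derivative of [F'] is below [/ 12 / (1 - Cmod z)]. *)
  set m := 12 * (K + 1); have m0 : 0 < m by rewrite /m; lra.
  have mn0 : RtoC m <> 0%C by move=> /RtoC_inj; lra.
  pose l z := (/ RtoC m * L z)%C.
  have dl z : unit_disk z -> cderiv l z (/ RtoC m * C_derive L z)%C.
    by move=> Hz; apply: cderiv_cmult; apply: analytic_cderiv.
  have Hl : analytic l by apply/analyticP => z Hz; eexists; exact: dl.
  have HE : analytic (fun z => Cexp (l z)).
    apply/analyticP => z Hz; eexists; exact: cderiv_comp (dl z Hz) (cderiv_Cexp _).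
  have [F [HF EF]] := analytic_primitive _ HE.
  exists m, F; split=> //; split=> //; split.
    apply: (small_preSchwarzian_univalent F l) => // z Hz.
    rewrite (cderiv_C_derive _ _ _ (dl z Hz)) Cmod_mult Cmod_inv // Cmod_RtoC_pos; last lra.
    rewrite L' // -/(analytic_preSchwarzian k z).
    apply: (Rmult_le_reg_r m) => //.
    have -> : forall u v, u * (/ m * v) * m = u * v by move=> *; field; lra.
    by apply: Rle_trans (HK z Hz) _; rewrite /m; lra.
  exists l; split=> // z Hz; split; first exact: EF.
  by rewrite EL //; f_equal; rewrite /l; field.
Qed.

(** * Stability *)

Lemma ULU_iff h g : sense_preserving_harmonic h g ->
  (ULU (harmonic_map h g) <-> finite_preSchwarzian h).
Proof.
move=> hf; split.
- move=> /(uniform_radius_univalent _ _ (fun A H => H)) [rho [r0 H]].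
  have [sigma [s0 Hs]] := univalent_hyperbolic_scale _ _ r0 H.
  exact: univalent_at_scale_finite_preSchwarzian hf s0 Hs.
- move=> /(finite_preSchwarzian_convex h g hf) [rho [r0 H]].
  by apply: (uniform_radius_gt0 _ _ rho) => // a /H [].
Qed.

Lemma ULC_iff h g : sense_preserving_harmonic h g ->
  (ULC (harmonic_map h g) <-> finite_preSchwarzian h).
Proof.
move=> hf; split.
- move=> /(uniform_radius_univalent _ _ (fun A H => proj1 H)) [rho [r0 H]].
  have [sigma [s0 Hs]] := univalent_hyperbolic_scale _ _ r0 H.
  exact: univalent_at_scale_finite_preSchwarzian hf s0 Hs.
- move=> /(finite_preSchwarzian_convex h g hf) [rho [r0 H]].
  exact: (uniform_radius_gt0 _ _ rho).
Qed.

Lemma analytic_comb_derive h g eps z : analytic h -> analytic g -> unit_disk z ->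
  cderiv (analytic_comb h g eps) z (C_derive h z + eps * C_derive g z)%C.
Proof.
move=> Hh Hg Hz; apply: cderiv_plus; first exact: analytic_cderiv.
by apply: cderiv_cmult; apply: analytic_cderiv.
Qed.

Lemma one_add_neq0 (u : C) : Cmod u < 1 -> (1 + u <> 0)%C.
Proof.
move=> Hu E; have := Cmod_le_add (- u) 1; have -> : (1 - - u = 0)%C by rewrite -E; ring.
by rewrite Cmod_0 Cmod_1 Cmod_opp; lra.
Qed.

Lemma Cmod_mul_lt1 (u v : C) : Cmod u <= 1 -> Cmod v < 1 -> Cmod (u * v) < 1.
Proof. by rewrite Cmod_mult => hu hv; have := Cmod_ge_0 u; have := Cmod_ge_0 v; nra. Qed.

Lemma analytic_comb_sense_preserving h g eps : sense_preserving_harmonic h g ->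
  closed_unit_disk eps -> sense_preserving_harmonic (analytic_comb h g eps) zero_map.
Proof.
move=> /sense_preserving_facts [Hh Hg h0 Hom Eg] He.
apply: locally_univalent_sense_preserving.
  by apply/analyticP => z Hz; eexists; apply: analytic_comb_derive.
move=> z Hz; rewrite (cderiv_C_derive _ _ _ (analytic_comb_derive h g eps z Hh Hg Hz)) Eg //.
have -> : (C_derive h z + eps * (dilatation h g z * C_derive h z) =
  C_derive h z * (1 + eps * dilatation h g z))%C by ring.
apply: Cmult_neq_0; first exact: h0.
by apply: one_add_neq0; apply: Cmod_mul_lt1 => //; case: (Hom z Hz).
Qed.

(** [(h + eps * g)' = h' * (1 + eps * om)], and the logarithmic derivative of the second
    factor is controlled by the Schwarz-Pick inequality. *)
Lemma analytic_comb_finite h g eps : sense_preserving_harmonic h g -> closed_unit_disk eps ->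
  (finite_preSchwarzian (analytic_comb h g eps) <-> finite_preSchwarzian h).
Proof.
move=> hf He; have [Hh Hg h0 Hom Eg] := sense_preserving_facts _ _ hf.
set k := analytic_comb h g eps; set w := dilatation h g in Hom Eg.
have near1 z : unit_disk z ->
    (1 - Cmod z) * Cmod (analytic_preSchwarzian k z - analytic_preSchwarzian h z) <= 2.
  move=> Hz; have [d0 D0 w1 b1 _] := dilatation_derive_bounds h g z hf Hz.
  rewrite -/w in D0 w1 b1; set d := 1 - Cmod z in d0 b1 *.
  have Ek v : unit_disk v -> C_derive k v = (C_derive h v * (1 + eps * w v))%C.
    move=> Hv; rewrite (cderiv_C_derive _ _ _ (analytic_comb_derive h g eps v Hh Hg Hv)) Eg //.
    ring.
  have dw := differentiable_C_derive _ _ (proj1 (Hom z Hz)).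
  have d2 := cderiv_mult _ _ _ _ _ (analytic_cderiv _ (analytic_C_derive _ Hh) _ Hz)
    (cderiv_plus _ _ _ _ _ (cderiv_const 1 z) (cderiv_cmult eps _ _ _ dw)).
  have n1 : (1 + eps * w z <> 0)%C by apply: one_add_neq0; apply: Cmod_mul_lt1.
  have -> : (analytic_preSchwarzian k z - analytic_preSchwarzian h z
      = eps * C_derive w z / (1 + eps * w z))%C.
    rewrite /analytic_preSchwarzian (C_derive_local (C_derive k) _ z Hz Ek); last by eexists; exact: d2.
    by rewrite (cderiv_C_derive _ _ _ d2) Ek //; field; split=> //; apply: h0.
  rewrite Cmod_div // Cmod_mult; set u := Cmod (w z) in D0 w1 b1.
  have lo : 1 - u <= Cmod (1 + eps * w z).
    have := Cmod_le_add (1 + eps * w z) 1; have -> : (1 - (1 + eps * w z) = - (eps * w z))%C by ring.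
    rewrite Cmod_1 Cmod_opp Cmod_mult -/u; have := Cmod_ge_0 (w z); rewrite -/u.
    by move: He; rewrite /closed_unit_disk; nra.
  have u0 : 0 <= u := Cmod_ge_0 _.
  set y := Cmod (1 + eps * w z) in lo *; have y0 : 0 < y by lra.
  apply: (Rmult_le_reg_r y) => //.
  have -> : d * (Cmod eps * Cmod (C_derive w z) / y) * y = d * (Cmod eps * Cmod (C_derive w z)).
    by field; lra.
  have b2 : d * Cmod (C_derive w z) <= 1 - u ^ 2.
    have := Rmult_le_compat_l d _ _ (Rlt_le _ _ d0) b1.
    by have -> : d * ((1 - u ^ 2) * / d) = 1 - u ^ 2 by [field; lra].
  have e1 : Cmod eps <= 1 by [].
  have := Cmod_ge_0 eps; have := Cmod_ge_0 (C_derive w z) => c0 c1.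
  have : Cmod eps * (d * Cmod (C_derive w z)) <= 1 * (1 - u ^ 2).
    by apply: Rmult_le_compat => //; apply: Rmult_le_pos; lra.
  nra.
split=> -[K HK]; exists (K + 2) => z Hz; have := HK z Hz; have := near1 z Hz;
  have d0 := unit_disk_radius _ Hz.
- have := Cmod_le_add (analytic_preSchwarzian k z) (analytic_preSchwarzian h z).
  rewrite (Cmod_sub_sym (analytic_preSchwarzian h z)); nra.
- have := Cmod_le_add (analytic_preSchwarzian h z) (analytic_preSchwarzian k z); nra.
Qed.

Lemma harmonic_comb_sense_preserving h g eps : sense_preserving_harmonic h g ->
  closed_unit_disk eps -> sense_preserving_harmonic h (fun z => Cconj eps * g z)%C.
Proof.
move=> [Hh [Hg [g0 Hlt]]] He.
have dg z : unit_disk z -> cderiv (fun z => Cconj eps * g z)%C z (Cconj eps * C_derive g z)%C.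
  by move=> Hz; apply: cderiv_cmult; apply: analytic_cderiv.
split=> //; split; first by apply/analyticP => z Hz; eexists; exact: dg.
split; first by rewrite g0; ring.
move=> z Hz; rewrite (cderiv_C_derive _ _ _ (dg z Hz)) Cmod_mult Cmod_conj.
apply: Rle_lt_trans (Hlt z Hz); have := Cmod_ge_0 (C_derive g z).
by move: He; rewrite /closed_unit_disk; nra.
Qed.

Lemma harmonic_combE h g eps :
  harmonic_comb h g eps = harmonic_map h (fun z => Cconj eps * g z)%C.
Proof.
apply: functional_extensionality => z.
by rewrite /harmonic_comb /harmonic_map Cmult_conj Cconj_conj.
Qed.

Lemma stable_of_iff (Q : Prop) (P : C -> Prop) :
  (forall eps, closed_unit_disk eps -> (P eps <-> Q)) -> stable P.
Proof. by move=> H e1 e2 h1 h2 _; rewrite (H e1 h1) (H e2 h2). Qed.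

Theorem theorem4p1 (h g : C -> C) (hf : sense_preserving_harmonic h g) :
  [<-> SAULU h g;
       SAULC h g;
       SBAPSN h g;
       SBASN h g;
       stable (fun eps => power_of_univalent (analytic_comb h g eps));
       SHULU h g;
       SHULC h g;
       SBHPSN h g;
       SBHSN h g].
Proof.
have Hk eps := analytic_comb_sense_preserving h g eps hf.
have Hc eps := harmonic_comb_sense_preserving h g eps hf.
have Hfin eps := analytic_comb_finite h g eps hf.
have c1 : SAULU h g.
  apply: (stable_of_iff (finite_preSchwarzian h)) => eps He; rewrite -(Hfin eps He).
  by rewrite -{1}(harmonic_map_zero (analytic_comb h g eps)); apply: ULU_iff; apply: Hk.
have c2 : SAULC h g.
  apply: (stable_of_iff (finite_preSchwarzian h)) => eps He; rewrite -(Hfin eps He).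
  by rewrite -{1}(harmonic_map_zero (analytic_comb h g eps)); apply: ULC_iff; apply: Hk.
have c3 : SBAPSN h g.
  apply: (stable_of_iff (finite_preSchwarzian h)) => eps He; rewrite -(Hfin eps He).
  exact: preSchwarzian_norm_bounded (Hk eps He).
have c4 : SBASN h g.
  apply: (stable_of_iff (finite_preSchwarzian h)) => eps He; rewrite -(Hfin eps He).
  exact: Schwarzian_norm_bounded (Hk eps He).
have c5 : stable (fun eps => power_of_univalent (analytic_comb h g eps)).
  apply: (stable_of_iff (finite_preSchwarzian h)) => eps He; rewrite -(Hfin eps He).
  have [Ha _ a0 _ _] := sense_preserving_facts _ _ (Hk eps He).
  exact: power_of_univalent_iff.
have c6 : SHULU h g.
  apply: (stable_of_iff (finite_preSchwarzian h)) => eps He; rewrite harmonic_combE.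
  exact: ULU_iff (Hc eps He).
have c7 : SHULC h g.
  apply: (stable_of_iff (finite_preSchwarzian h)) => eps He; rewrite harmonic_combE.
  exact: ULC_iff (Hc eps He).
have c8 : SBHPSN h g.
  apply: (stable_of_iff (finite_preSchwarzian h)) => eps He.
  exact: preSchwarzian_norm_bounded (Hc eps He).
have c9 : SBHSN h g.
  apply: (stable_of_iff (finite_preSchwarzian h)) => eps He.
  exact: Schwarzian_norm_bounded (Hc eps He).
by [].
Qed.
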